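(* There is an absolute constant $C>0$ such that for all integers $1\le k\le n$ there is an online paging algorithm for $n$ pages and cache size $k$ (given the time horizon $T$), with per-round running time $\mathrm{poly}(n,\log T)$, such that: 1. its competitive ratio is $2H_k$, where $H_k=\sum_{i=1}^k\frac1i$; 2. its regret on every time interval $I\subseteq\{1,\dots,T\}$ is at most $C\,k\sqrt{|I|\log(nT)}$.
   Context: Online paging problem, as a metrical task system. There is a set $P$ of $n$ pages. The states are the caches $C\subseteq P$ with $|C|=k$, with distance $d(C_1,C_2)=|C_1\setminus C_2|$. There is one possible loss function $\ell_i$ for each page $i\in P$ (a request for page $i$): $\ell_i(C)=0$ if $i\in C$ and $\ell_i(C)=2$ if $i\notin C$. At each step $t=1,\dots,T$ the (possibly randomized) algorithm is given the request, i.e. $l_t\in\{\ell_i:i\in P\}$, then chooses a cache $C_t$, and pays $l_t(C_t)$ plus, for $t\ge2$, $d(C_t,C_{t-1})$. The request sequence is fixed in advance (oblivious adversary) and $T$ is known to the algorithm. Competitive ratio $\alpha$: there is a constant $\beta>0$ independent of $T$ such that for every request sequence the algorithm's expected total cost $\mathbb{E}[\sum_{t=1}^Tl_t(C_t)+\sum_{t=2}^Td(C_t,C_{t-1})]$ is at most $\alpha$ times the minimum of $\sum_{t=1}^Tl_t(C_t^* )+\sum_{t=2}^Td(C_t^*,C_{t-1}^* )$ over all sequences of caches $C_1^*,\dots,C_T^*$, plus $\beta$. Regret on a time interval $I=\{t_0+1,\dots,t_0+m\}$ (consecutive steps, $|I|=m$): the smallest $R(I)$ such that for every request sequence $\mathbb{E}[\sum_{t\in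 I}l_t(C_t)+\sum_{t\in I\setminus\{t_0+1\}}d(C_t,C_{t-1})]\le\min_{C}\sum_{t\in I}l_t(C)+R(I)$, the minimum being over all caches $C$. Computation model: arithmetic operations, exponentiation, evaluating the error function, and sampling uniformly from $[0,1]$ each cost $O(1)$. *)

(* Defs.v *)
From HB Require Import structures.
From mathcomp Require Import all_boot all_order all_algebra.
From mathcomp Require Import all_classical all_reals all_analysis.
Import Order.TTheory GRing.Theory Num.Theory.
Import numFieldNormedType.Exports.

Set Implicit Arguments.
Unset Strict Implicit.
Unset Printing Implicit Defensive.

Local Open Scope classical_set_scope.
Local Open Scope ring_scope.

(* Rounds are numbered from 0, so that the interval {t0+1, ..., t0+m} of steps
   is t0 <= t < t0 + m.  A request sequence is a function nat -> 'I_n of which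
   only the first T values are ever used. *)

Section Paging.
Variable n : nat.
Implicit Types (i : 'I_n) (C : {set 'I_n}) (r : nat -> 'I_n).

Definition loss i C : nat := if i \in C then 0%N else 2%N.

Definition dist C1 C2 : nat := #|C1 :\: C2|.

(* No movement is charged for entering the first round a. *)
Definition cost r (Cs : nat -> {set 'I_n}) (a b : nat) : nat :=
  (\sum_(a <= t < b) loss (r t) (Cs t)
   + \sum_(a.+1 <= t < b) dist (Cs t) (Cs t.-1))%N.

(* Both infima are minima for k <= n: the values are natural numbers. *)
Definition opt_dynamic (R : realType) (k : nat) r (T : nat) : R :=
  inf [set (cost r Cs 0 T)%:R |
        Cs in [set Cs : nat -> {set 'I_n} | forall t, #|Cs t| = k]].

Definition opt_fixed (R : realType) (k : nat) r (a b : nat) : R :=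
  inf [set (\sum_(a <= t < b) loss (r t) C)%:R |
        C in [set C : {set 'I_n} | #|C| = k]].

End Paging.

(* Real RAM.  The memory consists of unboundedly long arrays of naturals and
   of reals, named by a natural number; a program only mentions finitely many
   array names, while cell indices are computed.  Naturals may be converted to
   reals but there is no rounding of reals and no integer division, and the
   only constants are naturals.  An instruction evaluates a bounded number of
   operations (those written in the program), hence costs O(1). *)

Inductive iexp :=
  | IConst of nat
  | IGet of nat & iexp
  | IAdd of iexp & iexp
  | ISub of iexp & iexp
  | IMul of iexp & iexp.

Inductive rexp :=
  | RNat of iexp
  | RGet of nat & iexp
  | RAdd of rexp & rexp
  | RSub of rexp & rexp
  | RMul of rexp & rexp
  | RDiv of rexp & rexp
  | RExp of rexp
  | RPow of rexp & rexp
  | RErf of rexp.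

Inductive bexp :=
  | BILt of iexp & iexp
  | BRLt of rexp & rexp
  | BNot of bexp
  | BAnd of bexp & bexp.

Inductive cmd :=
  | Skip
  | ISet of nat & iexp & iexp    (* array, index, value *)
  | RSet of nat & iexp & rexp
  | Sample of nat & iexp         (* store a fresh uniform sample of [0, 1] *)
  | Seq of cmd & cmd
  | Ite of bexp & cmd & cmd
  | While of bexp & cmd.

Section Machine.
Variable R : realType.

Definition erf (x : R) : R :=
  Num.sg x * (2 / Num.sqrt pi) *
  \int[lebesgue_measure]_(t in `[0, `|x|]) expR (- t ^+ 2).

Record state := State { imem : nat -> nat -> nat; rmem : nat -> nat -> R }.

Definition upd (V : Type) (f : nat -> nat -> V) (a i : nat) (v : V) :=
  fun a' i' => if (a' == a) && (i' == i) then v else f a' i'.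

Fixpoint ieval (s : state) (e : iexp) : nat :=
  match e with
  | IConst c => c
  | IGet a e => imem s a (ieval s e)
  | IAdd e f => ieval s e + ieval s f
  | ISub e f => ieval s e - ieval s f
  | IMul e f => ieval s e * ieval s f
  end%N.

Fixpoint reval (s : state) (e : rexp) : R :=
  match e with
  | RNat e => (ieval s e)%:R
  | RGet a e => rmem s a (ieval s e)
  | RAdd e f => reval s e + reval s f
  | RSub e f => reval s e - reval s f
  | RMul e f => reval s e * reval s f
  | RDiv e f => reval s e / reval s f
  | RExp e => expR (reval s e)
  | RPow e f => powR (reval s e) (reval s f)
  | RErf e => erf (reval s e)
  end.

Fixpoint beval (s : state) (b : bexp) : bool :=
  match b with
  | BILt e f => (ieval s e < ieval s f)%N
  | BRLt e f => reval s e < reval s f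
  | BNot b => ~~ beval s b
  | BAnd b c => beval s b && beval s c
  end.

(* The commands still to be executed, and the memory; halted on [::]. *)
Definition config := (seq cmd * state)%type.

(* The number u is the random sample of this step; only Sample reads it. *)
Definition step (u : R) (c : config) : config :=
  match c with
  | ([::], s) => ([::], s)
  | (Skip :: K, s) => (K, s)
  | (ISet a e v :: K, s) =>
      (K, State (upd (imem s) a (ieval s e) (ieval s v)) (rmem s))
  | (RSet a e v :: K, s) =>
      (K, State (imem s) (upd (rmem s) a (ieval s e) (reval s v)))
  | (Sample a e :: K, s) =>
      (K, State (imem s) (upd (rmem s) a (ieval s e) u))
  | (Seq c1 c2 :: K, s) => (c1 :: c2 :: K, s)
  | (Ite b c1 c2 :: K, s) => ((if beval s b then c1 else c2) :: K, s)
  | (While b c1 :: K, s) =>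
      (if beval s b then c1 :: While b c1 :: K else K, s)
  end.

Fixpoint run (w : nat -> R) (m : nat) (c : config) : config :=
  if m is m'.+1 then step (w m') (run w m' c) else c.

(* Interface: cells 0, 1, 2 of the natural array 0 initially hold n, k, T, and
   cell 3 receives the request at the start of each round; all other memory
   is 0 initially and persists between rounds.  At the end of a round, page i
   is in the cache iff cell i of the natural array 1 is nonzero. *)
Definition init_state (n k T : nat) : state :=
  State (fun a i => if a == 0%N then nth 0%N [:: n; k; T] i else 0%N)
        (fun _ _ => 0).

Definition put_request (i : nat) (s : state) : state :=
  State (upd (imem s) 0 3 i) (rmem s).

Definition read_cache (n : nat) (s : state) : {set 'I_n} :=
  [set i : 'I_n | imem s 1 i != 0%N].

Section OnlineRun.
Variables (p : cmd) (n k T B : nat).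
Implicit Types (r : nat -> 'I_n) (w : nat -> R).

(* B is the number of steps allotted to each round; step j of round t gets
   the sample w (t * B + j). *)
Definition play_round (i : 'I_n) (w : nat -> R) (s : state) : config :=
  run w B ([:: p], put_request i s).

Fixpoint state_before r w (t : nat) : state :=
  if t is t'.+1 then
    (play_round (r t') (fun j => w (t' * B + j)%N) (state_before r w t')).2
  else init_state n k T.

Definition end_of_round r w (t : nat) : config :=
  play_round (r t) (fun j => w (t * B + j)%N) (state_before r w t).

Definition alg_cache r w (t : nat) : {set 'I_n} :=
  read_cache n (end_of_round r w t).2.

(* Every round halts within B steps, with a valid cache, whatever the samples. *)
Definition runs_in_time : Prop :=
  forall r w, (forall j, 0 <= w j <= 1) -> forall t, (t < T)%N ->
    (end_of_round r w t).1 = [::] /\ #|alg_cache r w t| = k.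

End OnlineRun.

(* Expectation of F (U_0, ..., U_(N-1), 0, 0, ...) with U_i independent and
   uniform on [0, 1]. *)
Fixpoint expect_uniform (N : nat) (F : (nat -> R) -> \bar R) : \bar R :=
  if N is N'.+1 then
    (\int[lebesgue_measure]_(u in `[0%R, 1%R])
       expect_uniform N' (fun w => F (fun j => if j is j'.+1 then w j' else u)))%E
  else F (fun=> 0).

Definition expected_cost (p : cmd) (n k T B : nat) (r : nat -> 'I_n)
    (a b : nat) : \bar R :=
  expect_uniform (T * B)
    (fun w => (cost r (alg_cache p k T B r w) a b)%:R%:E).

(* B gives the number of steps allotted to each round in terms of T. *)
Definition competitive (p : cmd) (n k : nat) (B : nat -> nat) (alpha : R) :=
  exists2 beta : R, 0 < beta &
    forall (T : nat) (r : nat -> 'I_n), (0 < T)%N ->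
      (expected_cost p k T (B T) r 0 T
         <= (alpha * opt_dynamic R k r T + beta)%:E)%E.

Definition regret (p : cmd) (n k T B : nat) (t0 m : nat) : \bar R :=
  ereal_inf [set rho%:E | rho in [set rho : R | forall r : nat -> 'I_n,
    (expected_cost p k T B r t0 (t0 + m)
       <= (opt_fixed R k r t0 (t0 + m) + rho)%:E)%E]].

Definition harmonic_sum (k : nat) : R := \sum_(1 <= i < k.+1) i%:R^-1.

End Machine.

Definition time_bound (c d n T : nat) : nat :=
  (c * (n + trunc_log 2 T).+1 ^ d)%N.

(* Main.v *)
(** Write ell for about log2 (n T) and G = 2 ^ (4 ell).  All samples are drawn in the
    first round and rounded to elements of [0, G), so that expectations become
    finite means.  The algorithm follows one of ell + 1 experts.  Expert 0 is the
    randomised marking algorithm, which is 2 H_k-competitive here because the number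
    of requests to clean pages is at most twice the optimal cost plus k.  Expert
    e > 0 is follow-the-perturbed-leader with noise of size 2 ^ e, restarted every
    4 ^ e rounds: on one of its blocks it has regret O(k 2 ^ e), since a perturbed
    leader admits a page with probability at most 2 ^ -e per request.

    The experts are combined from the coarsest scale e = ell down to e = 1: the
    mixture found so far is mixed with expert e, with odds w that are multiplied by
    1 + eta (x - 4 k eta |x|), where x is the cost advantage of expert e.  The
    correction 4 k eta |x| pays for k times the variation of the mixing probability,
    hence for the cache replacements caused by switching, because every switch
    compares one fixed sample with that probability.  The mixture then loses almost
    nothing to the coarser scales, and in particular to marking, and
    O(k sqrt(ell) 2 ^ e) to expert e on each of its blocks.  An interval of length m
    splits into aligned blocks of lengths 4 ^ e which grow and then shrink
    geometrically, so that the regrets add up to O(k sqrt(ell m)). *)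

Require Import Defs.
From HB Require Import structures.
From mathcomp Require Import all_boot all_order all_algebra.
From mathcomp Require Import fingroup.perm.
From mathcomp Require Import all_classical all_reals all_analysis.
From mathcomp Require Import measurable_realfun.
From mathcomp Require Import ring lra zify.
Import Order.TTheory GRing.Theory Num.Theory.
Import numFieldNormedType.Exports.

Set Implicit Arguments.
Unset Strict Implicit.
Unset Printing Implicit Defensive.

(** * Ranking pages by integer keys *)

(** The ratio must be exactly [2 H_k], so the combination may lose only a constant to marking over
    all [T] rounds. This forces initial odds of [1 / G] and rounding errors that stay bounded after
    multiplication by the number of rounds. Marking itself leaves no slack to spend: since the
    request is known before the cache is chosen, a miss costs one replacement and never the loss 2.

    Two sources of randomness are kept apart. The noise of the pages determines the costs of all
    experts and hence all weights; the coins, one per scale, only select the expert. So each coin is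
    independent of the probabilities it is compared with, and the inequalities on weights hold for
    every value of the noise and are averaged only at the end. One noise vector serves all phases
    and blocks, because only expectations of single rounds are needed and the requests are fixed in
    advance.

    A restarting leader may change its whole cache. This is never paid for, since its coin rejects
    in the round of the restart. Scales with [2 ^ e < 8 k lam] are switched off: on [4 ^ e] rounds
    even a cost of 2 per round is only O([k lam 2 ^ e]). *)

Section Ranking.
Variable n : nat.
Implicit Types (key sc : nat -> nat) (A C U : {set 'I_n}).

Definition rank_in U key (i : nat) : nat := \sum_(j in U) (key i < key j)%N.

Definition rank key (i : nat) : nat := \sum_(j < n) (key i < key j)%N.

Definition topk k key : {set 'I_n} := [set i : 'I_n | rank key i < k].

(** The lexicographic order on pairs (score, page), packed into one number so that distinct pages
    have distinct keys. *)
Definition tiebreak sc (i : nat) : nat := sc i * n + i.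

Lemma rankE key i : rank key i = rank_in [set: 'I_n]%SET key i.
Proof. by apply: eq_bigl => j; rewrite inE. Qed.

Lemma tiebreak_inj sc (i j : 'I_n) : tiebreak sc i = tiebreak sc j -> i = j.
Proof.
move=> /(congr1 (fun x => x %% n)); rewrite /tiebreak !modnMDl !modn_small //.
exact: val_inj.
Qed.

Lemma tiebreak_ltn sc (i j : 'I_n) : sc i < sc j -> tiebreak sc i < tiebreak sc j.
Proof. by rewrite /tiebreak => ij; have := ltn_ord i; nia. Qed.

Lemma tiebreak_leq sc (i j : 'I_n) : tiebreak sc i <= tiebreak sc j -> sc i <= sc j.
Proof. by rewrite leqNgt [sc i <= _]leqNgt; apply: contra; exact: tiebreak_ltn. Qed.

Lemma rank_in_card U key i : rank_in U key i = #|[set j in U | key i < key j]|.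
Proof.
rewrite -sum1_card /rank_in [RHS](eq_bigl _ _ (finset.in_set _)) big_mkcondr /=.
by apply: eq_bigr => j _; case: ltnP.
Qed.

Lemma rank_in_lt U key (i : 'I_n) : i \in U -> rank_in U key i < #|U|.
Proof.
move=> iU; rewrite rank_in_card; apply: proper_card; apply/properP; split.
  by apply/fintype.subsetP => j; rewrite inE => /andP[].
by exists i => //; rewrite inE ltnn andbF.
Qed.

Lemma rank_in_mono U key (i j : 'I_n) : j \in U -> key i < key j ->
  rank_in U key j < rank_in U key i.
Proof.
move=> jU ij; rewrite !rank_in_card; apply: proper_card; apply/properP; split.
  by apply/fintype.subsetP => h; rewrite !inE => /andP[-> /=]; apply: ltn_trans.
by exists j; rewrite inE ?jU // ltnn andbF.
Qed.

(** Keys are distinct, so the ranks are injective on [U] with values below [#|U|]; hence they are a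
    permutation of [iota 0 #|U|]. *)
Lemma card_rank_in_lt U sc m : m <= #|U| ->
  #|[set i in U | rank_in U (tiebreak sc) i < m]| = m.
Proof.
move=> mU; pose f (i : 'I_n) := rank_in U (tiebreak sc) i.
have us : uniq (map f (enum U)).
  rewrite map_inj_in_uniq ?enum_uniq // => i j; rewrite !mem_enum => iU jU fij.
  apply: (@tiebreak_inj sc).
  by case: (ltngtP (tiebreak sc i) (tiebreak sc j)) => // /rank_in_mono h;
    [have := h _ jU|have := h _ iU]; rewrite -/(f i) -/(f j) fij ltnn.
have sub : {subset map f (enum U) <= iota 0 #|U|}.
  move=> x /mapP[i]; rewrite mem_enum => iU ->.
  by rewrite mem_iota add0n /=; exact: rank_in_lt.
have [_ e] := uniq_min_size us sub (eq_leq (etrans (size_iota _ _)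
  (esym (etrans (size_map _ _) (esym (cardE _)))))).
have pe := uniq_perm us (iota_uniq _ _) e.
have cardS P : #|[set i in U | P i]| = \sum_(i in U) (P i : nat).
  rewrite -sum1_card [LHS](eq_bigl _ _ (finset.in_set _)) big_mkcondr /=.
  by apply: eq_bigr => j _; case: ifP.
rewrite cardS -big_enum /= -(big_map f xpredT (fun x => nat_of_bool (x < m))).
rewrite (perm_big _ pe) -[#|U|]subn0 -/(index_iota 0 #|U|) (big_cat_nat (n := m)) //=.
rewrite big_nat_cond (eq_bigr (fun=> 1)) => [|x /andP[/andP[_ ->]]] //.
rewrite -big_nat_cond sum_nat_const_nat muln1 subn0 big_nat_cond big1 ?addn0 //.
by move=> x /andP[/andP[mx _] _]; rewrite ltnNge mx.
Qed.

Lemma card_topk k sc : k <= n -> #|topk k (tiebreak sc)| = k.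
Proof.
move=> kn; have := @card_rank_in_lt [set: 'I_n]%SET sc k.
rewrite cardsT card_ord => /(_ kn) {2}<-.
by apply: eq_card => i; rewrite !inE rankE.
Qed.

Lemma topk_eq k key A : #|A| = k ->
  (forall i j : 'I_n, i \in A -> j \notin A -> key j < key i) -> topk k key = A.
Proof.
move=> Ak sep; apply/setP => i; rewrite inE rankE rank_in_card.
have [iA|iA] := boolP (i \in A).
  rewrite -Ak; apply: proper_card; apply/properP; split.
    apply/fintype.subsetP => j; rewrite !inE /=; apply: contraTT => jA.
    by rewrite -leqNgt ltnW ?sep.
  by exists i => //; rewrite !inE ltnn.
apply/negbTE; rewrite -leqNgt -Ak; apply: subset_leq_card.
by apply/fintype.subsetP => j jA; rewrite !inE /= sep.
Qed.

Lemma rank_raise key key' (i : 'I_n) : key i <= key' i ->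
  (forall j : 'I_n, j != i -> key' j = key j) ->
  forall j : 'I_n, j != i -> rank key j <= rank key' j.
Proof.
move=> le_i eq_j j ji; apply: leq_sum => h _.
rewrite (eq_j j ji); have [->|/eq_j -> //] := eqVneq h i.
by case: ltnP => // /leq_trans/(_ le_i) ->.
Qed.

Lemma rank_raise_self key key' (i : 'I_n) : key i <= key' i ->
  (forall j : 'I_n, j != i -> key' j = key j) -> rank key' i <= rank key i.
Proof.
move=> le_i eq_j; apply: leq_sum => h _.
have [->|/eq_j ->] := eqVneq h i; first by rewrite ltnn.
by case: (ltnP (key' i)) => // /(leq_ltn_trans le_i) ->.
Qed.

(** Raising the key of [i] cannot improve the rank of any other page, so only [i] can enter. This is
    why a request makes an expert replace at most one page. *)
Lemma topk_raise k key key' (i : 'I_n) : key i <= key' i ->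
  (forall j : 'I_n, j != i -> key' j = key j) ->
  #|topk k key' :\: topk k key| <= (i \notin topk k key) && (i \in topk k key').
Proof.
move=> le_i eq_j.
have sub j : j \in topk k key' :\: topk k key -> j = i.
  rewrite !inE => /andP[nj j']; apply/eqP; apply: contraNT nj => ji.
  by apply: leq_ltn_trans j'; apply: (rank_raise le_i eq_j).
have [/andP[h1 h2]|] := boolP (_ && _).
  rewrite -[nat_of_bool true](cards1 i); apply: subset_leq_card.
  by apply/fintype.subsetP => j /sub ->; rewrite inE.
apply: contraNleq; rewrite card_gt0 => /set0Pn[j jD]; move: (jD).
by rewrite (sub j jD) inE.
Qed.

(** An exchange argument: the two set differences have equal size, and every score in one is at most
    every score in the other. Summing over all pairs compares the sums, multiplied by that size. *)
Lemma topk_max k sc C : k <= n -> #|C| = k ->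
  \sum_(i in C) sc i <= \sum_(i in topk k (tiebreak sc)) sc i.
Proof.
move=> kn Ck; set T := topk _ _; have Tk : #|T| = k by exact: card_topk.
have sep (i j : 'I_n) : i \in T -> j \notin T -> sc j <= sc i.
  rewrite !inE -leqNgt => iT jT; apply: tiebreak_leq; rewrite leqNgt.
  apply/negP => ij; have : rank (tiebreak sc) j < rank (tiebreak sc) i.
    by rewrite !rankE; apply: rank_in_mono => //; rewrite inE.
  by rewrite ltnNge (ltnW (leq_trans iT jT)).
have cD : #|C :\: T| = #|T :\: C|.
  by apply/eqP; rewrite -(eqn_add2l #|C :&: T|) cardsID finset.setIC cardsID Ck Tk.
rewrite (big_setID T) /= [leqRHS](big_setID C) /= finset.setIC leq_add2l.
have [d0|d0] := posnP #|T :\: C|.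
  by rewrite big_pred0 // => i; move: d0; rewrite -cD => /eqP; rewrite cards_eq0 => /eqP ->; rewrite inE.
have l1 : \sum_(j in C :\: T) \sum_(i in T :\: C) sc j = #|T :\: C| * \sum_(j in C :\: T) sc j.
  by rewrite big_distrr; apply: eq_bigr => j _; rewrite sum_nat_const.
have l2 : \sum_(j in C :\: T) \sum_(i in T :\: C) sc i = #|T :\: C| * \sum_(i in T :\: C) sc i.
  by rewrite sum_nat_const cD.
rewrite -(leq_pmul2l d0) -l1 -l2; apply: leq_sum => j; rewrite inE => /andP[jT _].
by apply: leq_sum => i; rewrite inE => /andP[_ iT]; exact: sep.
Qed.

End Ranking.

(** * The experts *)

Definition fupd (f : nat -> nat) (j v : nat) : nat -> nat :=
  fun i => if i == j then v else f i.

Section Experts.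
Variables (n k G : nat) (r : nat -> 'I_n).
Implicit Types (m V : nat -> nat).

Definition marked m : {set 'I_n} := [set i : 'I_n | 1 < m i].
Definition stale m : {set 'I_n} := [set i : 'I_n | odd (m i)].

(* Expert 0 is the marking algorithm: the counter of a page is 2 * [marked]
   + [marked in the previous phase].  Expert e > 0 is follow-the-perturbed-leader,
   whose request counters are reset every 4 ^ e rounds. *)
Definition prepare e t m : nat -> nat :=
  if e == 0 then
    if (m (r t) < 2) && (k <= #|marked m|) then fun i => (1 < m i : nat) else m
  else if t %% 4 ^ e == 0 then fun=> 0 else m.

(** For expert 0, adding 2 sets the mark and keeps the parity, which remembers the previous
    phase. *)
Definition register e t m : nat -> nat :=
  if e == 0 then if m (r t) < 2 then fupd m (r t) (m (r t) + 2) else m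
  else fupd m (r t) (m (r t) + 1).

Fixpoint counts e t : nat -> nat :=
  if t is t'.+1 then register e t' (prepare e t' (counts e t')) else fun=> 0.

Arguments counts : simpl never.

Definition before e t : nat -> nat := prepare e t (counts e t).

Lemma countsS e t : counts e t.+1 = register e t (before e t).
Proof. by []. Qed.

(** Divided by [G], this is the counter plus noise in [0, 2 ^ e) when [V i < G]. For [e = 0] the
    noise is below one unit of the counter and only orders pages with equal counters. *)
Definition score V e m (i : nat) : nat := m i * G + V i * 2 ^ e.

Definition expert_cache V e m : {set 'I_n} := topk n k (tiebreak n (score V e m)).

(* Bounds the loss of expert e in round t plus its movement, the latter only
   if its counters were not reset. *)
Definition expert_cost V e t : nat :=
  if r t \in expert_cache V e (counts e t.+1) then
    r t \notin expert_cache V e (before e t) : nat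
  else 2.

Lemma register_other e t m (j : 'I_n) : j != r t -> register e t m j = m j.
Proof.
by move=> jr; rewrite /register; case: ifP => _; rewrite /fupd; [case: ifP => _|];
  rewrite // ifN.
Qed.

Lemma register_ge e t m i : m i <= register e t m i.
Proof.
rewrite /register; case: ifP => _; rewrite /fupd; [case: ifP => _ //|];
  case: eqP => [->|//]; lia.
Qed.

Lemma register_score V e t m i : score V e m i <= score V e (register e t m) i.
Proof. by rewrite leq_add2r leq_mul2r register_ge orbT. Qed.

(** Only the score of the requested page rises, so by [topk_raise] no other page enters. A missed
    request pays 2 and moves nothing; a served one pays at most one replacement. *)
Lemma expert_move V e t :
  loss (r t) (expert_cache V e (counts e t.+1))
  + dist (expert_cache V e (counts e t.+1)) (expert_cache V e (before e t))
  <= expert_cost V e t.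
Proof.
have := @topk_raise n k (tiebreak n (score V e (before e t)))
  (tiebreak n (score V e (counts e t.+1))) (r t).
rewrite -/(expert_cache V e (before e t)) -/(expert_cache V e (counts e t.+1)).
rewrite /expert_cost /loss /dist /=; move=> H.
have {}/H : tiebreak n (score V e (before e t)) (r t) <=
    tiebreak n (score V e (counts e t.+1)) (r t).
  by rewrite countsS leq_add2r leq_mul2r register_score orbT.
move=> H; have {H} := H _; case: ifP => _ H.
  rewrite add0n; apply: leq_trans (H _) _; last by rewrite andbT.
  by move=> j jr; rewrite /tiebreak /score countsS register_other.
rewrite -[leqRHS]addn0 leq_add2l; apply: leq_trans (H _) _; last by rewrite andbF.
by move=> j jr; rewrite /tiebreak /score countsS register_other.
Qed.

Lemma expert_cost_le2 V e t : expert_cost V e t <= 2.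
Proof. by rewrite /expert_cost; case: ifP => // _; case: (_ \in _). Qed.

Hypothesis kn : k <= n.

Lemma card_expert_cache V e m : #|expert_cache V e m| = k.
Proof. exact: card_topk. Qed.

Section Leader.
Variables (V : nat -> nat) (e a : nat).
Hypotheses (VG : forall i, V i < G) (e0 : 0 < e) (a0 : a %% 4 ^ e = 0).

Lemma before_count t (i : 'I_n) : a <= t < a + 4 ^ e ->
  before e t i = \sum_(a <= s < t) (r s == i).
Proof.
have en0 : (e == 0) = false by rewrite gtn_eqF.
have at0 d : 0 < d < 4 ^ e -> (a + d) %% 4 ^ e == 0 = false.
  by move=> /andP[d0 d4]; rewrite -modnDml a0 add0n modn_small // gtn_eqF.
move=> /andP[/subnKC <-]; elim: (t - a) => [|d IH].
  by rewrite addn0 big_geq // /before /prepare en0 a0 eqxx.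
rewrite addnS => ad; have dm : d.+1 < 4 ^ e by lia.
rewrite /before /prepare en0 -addnS at0 // addnS.
rewrite countsS.
rewrite big_nat_recr ?leq_addr //= -IH; last by lia.
rewrite /register en0 /fupd eq_sym.
have -> : (r (a + d) == i) = (nat_of_ord (r (a + d)) == i) by [].
by case: eqP => [->|_]; rewrite ?addn0.
Qed.

Lemma counts_count t (i : 'I_n) : a <= t < a + 4 ^ e ->
  counts e t.+1 i = \sum_(a <= s < t.+1) (r s == i).
Proof.
move=> at4; have en0 : (e == 0) = false by rewrite gtn_eqF.
rewrite big_nat_recr /=; last by case/andP: at4.
rewrite -before_count //.
rewrite countsS /register en0 /fupd eq_sym.
have -> : (r t == i) = (nat_of_ord (r t) == i) by [].
by case: eqP => [->|_]; rewrite ?addn0.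
Qed.

(* Be the leader: the current leader is chosen after the request is seen. *)
Lemma be_the_leader b (C : {set 'I_n}) : b <= 4 ^ e -> #|C| = k ->
  \sum_(i in C) ((\sum_(a <= s < a + b) (r s == i)) * G + V i * 2 ^ e)
  <= k * (G * 2 ^ e)
     + G * \sum_(a <= t < a + b) (r t \in expert_cache V e (counts e t.+1)).
Proof.
elim: b C => [|b IH] C b4 Ck.
  rewrite addn0 big_geq // muln0 addn0 -Ck -sum_nat_const.
  by apply: leq_sum => i _; rewrite big_geq // mul0n add0n leq_mul2r ltnW ?orbT.
have ab : a <= a + b < a + 4 ^ e by lia.
rewrite addnS; pose L := expert_cache V e (counts e (a + b).+1).
have Lk : #|L| = k by exact: card_expert_cache.
(* [L] maximises the scores that include the current request, so it dominates [C]; the induction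
   hypothesis is then applied to [L] in place of [C]. *)
apply: (@leq_trans (\sum_(i in L) score V e (counts e (a + b).+1) i)).
  apply: leq_trans (topk_max (score V e (counts e (a + b).+1)) kn Ck).
  by apply: leq_sum => i _; rewrite /score counts_count.
rewrite [in leqRHS]big_nat_recr ?leq_addr //= mulnDr addnA.
apply: leq_trans (_ : _ <= \sum_(i in L)
  ((\sum_(a <= s < a + b) (r s == i)) * G + V i * 2 ^ e) + G * (r (a + b) \in L)) _; last first.
  by rewrite leq_add2r; apply: IH => //; lia.
rewrite (eq_bigr (fun i : 'I_n => ((\sum_(a <= s < a + b) (r s == i)) * G + V i * 2 ^ e)
   + (r (a + b) == i) * G)) => [|i _]; last first.
  by rewrite /score counts_count // big_nat_recr ?leq_addr //=; lia.
rewrite big_split /= leq_add2l -big_distrl /= mulnC leq_mul2l; apply/orP; right.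
have [rL|rL] := boolP (_ \in L).
  rewrite (bigD1 (r (a + b))) //= eqxx big1 // => i /andP[_ /negbTE]; rewrite eq_sym.
  by move=> ->.
by rewrite big1 // => i iL; case: eqP => // ri; rewrite ri iL in rL.
Qed.

(** Dropping the noise of [C] and dividing by [G] leaves a bound on hits; complementing within the
    [b] rounds turns it into one on misses. *)
Lemma leader_loss (C : {set 'I_n}) b : 0 < G -> b <= 4 ^ e -> #|C| = k ->
  \sum_(a <= t < a + b) (r t \notin expert_cache V e (counts e t.+1))
  <= \sum_(a <= t < a + b) (r t \notin C) + k * 2 ^ e.
Proof.
move=> G0 b4 Ck; have := be_the_leader b4 Ck.
have -> : \sum_(i in C) ((\sum_(a <= s < a + b) (r s == i)) * G + V i * 2 ^ e)
   = G * \sum_(a <= s < a + b) (r s \in C) + \sum_(i in C) V i * 2 ^ e.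
  rewrite big_split /= -big_distrl /= mulnC exchange_big /=; congr (_ * _ + _).
  apply: eq_bigr => s _; have [rC|rC] := boolP (r s \in C).
    rewrite (bigD1 (r s)) //= eqxx big1 // => i /andP[_ /negbTE]; rewrite eq_sym.
    by move=> ->.
  by rewrite big1 // => i iC; case: eqP => // ri; rewrite ri iC in rC.
move=> /(leq_trans (leq_addr _ _)).
rewrite mulnCA -mulnDr leq_pmul2l // => H.
have compl (P : nat -> bool) : \sum_(a <= t < a + b) (~~ P t) = b - \sum_(a <= t < a + b) P t.
  rewrite -[X in X - _](addKn a b) -[in X in X - _](muln1 (_ - _)) -sum_nat_const_nat.
  rewrite -sumnB; first by apply: eq_bigr => t _; case: (P t).
  by move=> t _; case: (P t).
rewrite !compl; lia.
Qed.

End Leader.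
End Experts.

Arguments counts : simpl never.

(** For monotone [f] the summand is [f (v + Q) - f v], and the sum telescopes to at most [Q] values
    of [f]. *)
Lemma crossing_count (f : nat -> bool) Q G :
  (forall x y, x <= y -> f x -> f y) ->
  \sum_(v < G) (f (v + Q) && ~~ f v) <= Q.
Proof.
move=> fmono; rewrite -(leq_add2r (\sum_(v < G) f v)) -big_split /=.
rewrite (eq_bigr (fun v : 'I_G => f (v + Q) : nat)) => [|v _]; last first.
  have := fmono v (v + Q) (leq_addr _ _).
  by case: (f v) => [->//|_]; rewrite andbT addn0.
apply: (@leq_trans (\sum_(0 <= v < G + Q) f v)).
  rewrite -(big_mkord predT (fun v => f (v + Q) : nat)).
  have <- : \sum_(Q <= v < G + Q) f v = \sum_(0 <= v < G) f (v + Q).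
    by rewrite -{1}[Q]add0n big_addn addnK.
  by rewrite [leqRHS](big_cat_nat (n := Q)) //= ?leq_addl.
rewrite (big_cat_nat (n := G)) //= ?leq_addr // -(big_mkord predT (fun v => f v : nat)) addnC leq_add2r.
rewrite -[leqRHS](addKn G Q) -[leqRHS]muln1 -sum_nat_const_nat.
by apply: leq_sum => i _; case: (f i).
Qed.

Section ExpertProbability.
Variables (n k G : nat) (r : nat -> 'I_n).
Implicit Types (m V : nat -> nat).

(** One more request weighs as much as raising the noise of the requested page by [Q]. So the page
    enters only if its noise [v] is below a threshold that [v + Q] reaches. *)
Lemma leader_entering V e t Q : 0 < e -> G = Q * 2 ^ e ->
  \sum_(v < G) ((r t \in expert_cache n k G (fupd V (r t) v) e (counts k r e t.+1))
    && (r t \notin expert_cache n k G (fupd V (r t) v) e (before k r e t))) <= Q.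
Proof.
move=> e0 GQ; set m := before k r e t; set i := r t.
pose key x := tiebreak n (fun j => if j == i then m i * G + x * 2 ^ e else score G V e m j).
pose f x := rank n (key x) i < k.
apply: leq_trans (@crossing_count f Q G _); last first.
  move=> x y xy; apply: leq_ltn_trans.
  apply: rank_raise_self => [|j ji]; rewrite /key /tiebreak ?eqxx.
    by rewrite leq_add2r leq_mul2r leq_add2l leq_mul2r xy !orbT.
  by rewrite (_ : (_ == _) = false) //; apply/negbTE; apply: contra ji => /eqP/val_inj ->.
apply: leq_sum => v _; rewrite -/m countsS -/m /register gtn_eqF // -/i !inE.
suff [-> ->] : rank n (tiebreak n (score G (fupd V i v) e (fupd m i (m i + 1)))) i = rank n (key (v + Q)) i
   /\ rank n (tiebreak n (score G (fupd V i v) e m)) i = rank n (key v) i by [].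
have E : (m i + 1) * G + v * 2 ^ e = m i * G + (v + Q) * 2 ^ e by rewrite mulnDl mulnDl mul1n -GQ; lia.
split; apply: eq_bigr => j _; rewrite /key /tiebreak /score /fupd !eqxx ?E;
  by have [->|_] := eqVneq (j : nat) (i : nat); rewrite ?eqxx ?E.
Qed.

End ExpertProbability.

(** * Marking *)

Lemma topk_top n k (key : nat -> nat) (A : {set 'I_n}) : #|A| <= k ->
  (forall i j : 'I_n, i \in A -> j \notin A -> key j < key i) -> A \subset topk n k key.
Proof.
move=> Ak sep; apply/fintype.subsetP => i iA; rewrite inE rankE rank_in_card.
apply: leq_trans Ak; apply: proper_card; apply/properP; split.
  apply/fintype.subsetP => j; rewrite !inE /=; apply: contraTT => jA.
  by rewrite -leqNgt ltnW ?sep.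
by exists i => //; rewrite !inE ltnn.
Qed.

Section Marking.
Variables (n k G : nat) (r : nat -> 'I_n).
Implicit Types (m V : nat -> nat).

Definition marking_inv m :=
  [/\ #|marked n m| <= k, stale n m = finset.set0 \/ #|stale n m| = k & forall i, m i < 4].

(** A phase is closed only when one more mark would exceed [k]; closing removes all marks, so in
    either case the new mark fits. *)
Lemma marking_before t : marking_inv (counts k r 0 t) ->
  [/\ marking_inv (before k r 0 t), stale n (before k r 0 t) = marked n (counts k r 0 t) /\
        marked n (before k r 0 t) = finset.set0 /\ #|marked n (counts k r 0 t)| = k
        \/ before k r 0 t = counts k r 0 t
    & r t \notin marked n (before k r 0 t) -> 0 < k -> #|marked n (before k r 0 t)| < k].
Proof.
set m := counts k r 0 t => -[Mk Sk m4]; rewrite /before -/m /prepare eqxx.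
case: ifP => [/andP[mr kM]|/negbT]; last first.
  rewrite negb_and -leqNgt -ltnNge => h.
  split=> //; first by right.
  by move=> rm _; case/orP: h => // h; rewrite inE h in rm.
have Mk' : #|marked n m| = k by apply/eqP; rewrite eqn_leq Mk.
have M0 : marked n (fun i => (1 < m i : nat)) = finset.set0.
  by apply/setP => i; rewrite !inE; case: (1 < m i).
have SM : stale n (fun i => (1 < m i : nat)) = marked n m.
  by apply/setP => i; rewrite !inE; case: (1 < m i).
split; last by rewrite M0 cards0.
  by split; rewrite ?M0 ?cards0 // ?SM; [right | move=> i; case: (1 < m i)].
by left.
Qed.

Lemma marked_counts t : marked n (counts k r 0 t.+1) = r t |: marked n (before k r 0 t).
Proof.
apply/setP => i; rewrite countsS /register eqxx !inE; case: ifP => [lt2|/negbT ge2].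
  rewrite /fupd; have [ir|ir] := eqVneq (i : nat) (r t : nat).
    by rewrite -[i == _]/(nat_of_ord i == _) ir eqxx addn2.
  by rewrite -[i == _]/(nat_of_ord i == _) (negbTE ir).
by have [->|] := eqVneq i (r t); rewrite //= ltnNge -ltnS.
Qed.

Lemma stale_counts t : stale n (counts k r 0 t.+1) = stale n (before k r 0 t).
Proof.
apply/setP => i; rewrite countsS /register eqxx !inE; case: ifP => [lt2|//].
by rewrite /fupd; case: eqP => [->|//]; rewrite addn2 /= negbK.
Qed.

Hypotheses (k0 : 0 < k) (kn : k <= n).

Lemma marking_invP t : marking_inv (counts k r 0 t).
Proof.
elim: t => [|t /marking_before[[Mk Sk b4] _ H]].
  split=> //; last (left; apply/setP => i; by rewrite !inE).
  by rewrite (_ : marked _ _ = finset.set0) ?cards0 //; apply/setP => i; rewrite !inE.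
split; rewrite ?marked_counts ?stale_counts //.
  by rewrite cardsU1; case: (boolP (r t \in _)) => // /H /(_ k0).
move=> i; rewrite countsS /register eqxx; case: ifP => // lt2.
by rewrite /fupd; case: eqP => // _; rewrite addn2.
Qed.

Section Cost.
Variable V : nat -> nat.
Hypothesis VG : forall i, V i < G.

Lemma marked_top m : #|marked n m| <= k -> marked n m \subset expert_cache n k G V 0 m.
Proof.
move=> Mk; apply: topk_top => // i j; rewrite !inE -leqNgt => mi mj.
apply: tiebreak_ltn; rewrite /score expn0 !muln1.
have := VG j; have := leq_mul mj (leqnn G); have := leq_mul mi (leqnn G); lia.
Qed.

(** Closing a phase does not move the cache. It held exactly the [k] marked pages; these become the
    stale ones, with counter 1 against counter 0, and noise below [G] cannot reverse that. So
    marking can be followed across its restarts. *)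
Lemma expert_cache_before t :
  expert_cache n k G V 0 (before k r 0 t) = expert_cache n k G V 0 (counts k r 0 t).
Proof.
have [[_ _ b4] [[SM [M0 Mk]]|-> //] _] := marking_before (marking_invP t).
rewrite [RHS](_ : _ = marked n (counts k r 0 t)).
  apply: topk_eq => // i j iM jM; apply: tiebreak_ltn.
  have: i \in stale n (before k r 0 t) by rewrite SM.
  have: j \notin stale n (before k r 0 t) by rewrite SM.
  have: j \notin marked n (before k r 0 t) by rewrite M0 inE.
  rewrite !inE -leqNgt /score expn0 !muln1 => j2 jo io.
  have -> : before k r 0 t j = 0 by case: (before k r 0 t j) j2 jo => [|[]].
  have := VG j; have : 0 < before k r 0 t i by case: (before k r 0 t i) io.
  by move/leq_mul/(_ (leqnn G)); lia.
by apply/esym/eqP; rewrite eqEcard card_expert_cache // Mk leqnn andbT marked_top // Mk.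
Qed.

(* A miss of the marking algorithm on a page of the previous phase means that
   the page ranks low among the [#|U|] unmarked ones, of which as many have been
   evicted as there were requests to new pages. *)
Lemma marking_cost t (p := before k r 0 t) (U := stale n p :\: marked n p) :
  expert_cost k G r V 0 t <= (r t \notin marked n p)
    && ((r t \in stale n p) ==> (k - #|marked n p| <= rank_in U (tiebreak n V) (r t))).
Proof.
have [[Mk _ p4] _ _] := marking_before (marking_invP t); rewrite -/p in Mk p4.
have [Mk1 _ _] := marking_invP t.+1.
(* The request is marked at once and marked pages rank highest, so the loss 2 is never paid and a
   miss costs only its replacement. *)
have post_in : r t \in expert_cache n k G V 0 (counts k r 0 t.+1).
  by apply: (fintype.subsetP (marked_top Mk1)); rewrite marked_counts setU11.
rewrite /expert_cost post_in -/p; case: (boolP (r t \in marked n p)) => rM.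
  by rewrite (fintype.subsetP (marked_top Mk)).
rewrite /=; case: (boolP (_ \in stale n p)) => rS; last by case: (_ \in _).
case: (boolP (r t \in _)) => // miss; rewrite lt0b leq_subLR.
move: miss; rewrite inE -leqNgt => /leq_trans; apply.
rewrite rankE !rank_in_card -/U.
(* Pages that rank above an unmarked stale page are either marked or unmarked and stale with larger
   noise. A miss has at least [k] pages above it, hence at least [k - #|marked n p|] of the second
   kind. *)
apply: leq_trans (leq_card_setU _ _).
apply: subset_leq_card; apply/fintype.subsetP => j; rewrite !inE /= => lt_rj.
rewrite -implyNb; apply/implyP; rewrite -leqNgt => j2 /=.
have rp : p (r t) = 1.
  by move: rM rS; rewrite !inE -leqNgt; case: (p (r t)) => [|[]].
have jp : p j = 1.
  apply/eqP; rewrite eqn_leq j2 /= lt0n; apply: contraTneq lt_rj => pj.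
  rewrite -leqNgt ltnW // tiebreak_ltn // /score pj rp expn0 !muln1.
  by have := VG j; lia.
rewrite jp /=; move: lt_rj; rewrite /tiebreak /score jp rp; nia.
Qed.

End Cost.

Definition clean t : bool :=
  (r t \notin marked n (before k r 0 t)) && (r t \notin stale n (before k r 0 t)).

End Marking.

(** * Clean requests against the cost of an arbitrary schedule *)

Section Offline.
Variables (n k : nat) (r : nat -> 'I_n) (Cs : nat -> {set 'I_n}).

Definition requested a b : {set 'I_n} := [set i | has (fun t => r t == i) (index_iota a b)].

Lemma requestedP a b i : reflect (exists2 t, a <= t < b & r t = i) (i \in requested a b).
Proof.
rewrite inE; apply: (iffP hasP) => [[t]|[t tab ri]].
  by rewrite mem_index_iota => tab /eqP; exists t.
by exists t; rewrite ?mem_index_iota // ri.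
Qed.

Lemma cost_cat a b c : a <= b -> b <= c -> cost r Cs a b + cost r Cs b c <= cost r Cs a c.
Proof.
rewrite leq_eqVlt => /orP[/eqP -> bc|ab bc].
  by rewrite [X in X + _](_ : _ = 0) // /cost !big_geq.
rewrite /cost addnACA; apply: leq_add.
  by rewrite [leqRHS](big_cat_nat (n := b)) //= ltnW.
rewrite [leqRHS](big_cat_nat (n := b)) //= leq_add2l.
move: bc; rewrite leq_eqVlt => /orP[/eqP ->|bc]; first by rewrite big_geq.
by rewrite [leqRHS]big_ltn // leq_addl.
Qed.

Hypothesis Ck : forall t, #|Cs t| = k.

(** The first cache covers [k] pages; any other requested page is missed or brought in by a
    replacement. The induction also counts the pages of the current cache, so that a page is paid
    for when it enters. *)
Lemma requested_cost a b : #|requested a b| <= k + cost r Cs a b.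
Proof.
have [ba|/subnKC <-] := leqP b a.
  rewrite (_ : requested a b = finset.set0) ?cards0 //; apply/setP => i; rewrite !inE.
  by rewrite /index_iota (eqP ba).
move: (b - a.+1) => d; rewrite addSn.
suff: #|requested a (a + d).+1 :|: Cs (a + d)| <= k + cost r Cs a (a + d).+1.
  by apply: leq_trans; apply: subset_leq_card; exact: finset.subsetUl.
elim: d => [|d IH].
  rewrite addn0 /cost big_nat1 big_geq // addn0.
  have -> : requested a a.+1 :|: Cs a = r a |: Cs a.
    congr (_ :|: _); apply/setP => i; rewrite !inE /index_iota subSnn /= orbF.
    by rewrite eq_sym.
  by rewrite cardsU1 addnC leq_add ?Ck // /loss; case: (_ \in _).
rewrite addnS; set b' := a + d.
have -> : cost r Cs a b'.+2 = cost r Cs a b'.+1 + (loss (r b'.+1) (Cs b'.+1) + dist (Cs b'.+1) (Cs b')).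
  rewrite /cost [in LHS]big_nat_recr /=; last by lia.
  by rewrite [X in _ + X = _]big_nat_recr /=; [lia | lia].
rewrite addnA; apply: leq_trans (leq_add IH (leqnn _)).
have sub : requested a b'.+2 :|: Cs b'.+1 \subset (requested a b'.+1 :|: Cs b')
    :|: (([set r b'.+1] :\: Cs b'.+1) :|: (Cs b'.+1 :\: Cs b')).
  apply/fintype.subsetP => i; rewrite !finset.in_setU => /orP[/requestedP[t tab ri]|iC].
    have [tb|tb] := leqP t b'.
      by rewrite (_ : i \in requested _ _) //; apply/requestedP; exists t => //; lia.
    have e : t = b'.+1 by lia.
    rewrite -ri e !finset.in_setD finset.in_set1 eqxx.
    by case: (_ \in Cs _); case: (_ \in Cs _); rewrite ?orbT.
  by rewrite !finset.in_setD iC andbT; case: (i \in Cs b'); rewrite ?orbT.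
apply: leq_trans (subset_leq_card sub) _.
apply: leq_trans (leq_card_setU _ _) _; rewrite leq_add2l.
apply: leq_trans (leq_card_setU _ _) _; rewrite leq_add2r /loss.
case: ifP => h; last by apply: leq_trans (subset_leq_card (finset.subsetDl _ _)) _; rewrite cards1.
by rewrite leqn0 cards_eq0; apply/eqP/setP => i; rewrite !inE; case: eqP => [->|]; rewrite ?h ?andbF.
Qed.

Hypotheses (k0 : 0 < k) (kn : k <= n).

Let S t := stale n (counts k r 0 t).
Let M t := marked n (counts k r 0 t).

(** Here [a, b) is the previous phase and [b, u) the current one. Together they request
    [k + #|M u :\: S u|] pages, so the schedule pays at least [#|M u :\: S u|] within [a, u). In the
    first phase [S u] is empty and there are at most [k] clean requests. *)
Lemma clean_close u a b : a <= b <= u -> S u \subset requested a b -> M u \subset requested b u ->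
   \sum_(0 <= s < u) clean k r s <= k + cost r Cs 0 a + cost r Cs 0 b + #|M u :\: S u| ->
   (S u = finset.set0 -> \sum_(0 <= s < u) clean k r s = #|M u|) ->
   \sum_(0 <= s < u) clean k r s <= k + cost r Cs 0 b + cost r Cs 0 u.
Proof.
move=> /andP[ab bu] Sab Mbu le_c S0_c; have [Mk Sk _] := marking_invP r k0 u.
case: Sk => [/S0_c ->|Sk]; first by apply: leq_trans Mk _; lia.
apply: leq_trans le_c _.
have := cost_cat (leq0n a) (leq_trans ab bu).
have := requested_cost a u.
have : #|S u :|: M u| <= #|requested a u|.
  apply: subset_leq_card; apply/fintype.subsetP => i; rewrite finset.in_setU => /orP[|].
    by move=> /(fintype.subsetP Sab)/requestedP[s sab <-]; apply/requestedP; exists s => //; lia.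
  by move=> /(fintype.subsetP Mbu)/requestedP[s sab <-]; apply/requestedP; exists s => //; lia.
have : #|S u :|: M u| = k + #|M u :\: S u|.
  by rewrite -(cardsID (S u) (S u :|: M u)) finset.setUK Sk finset.setDUl finset.setDv finset.set0U.
lia.
Qed.

(** The clean requests of a phase are charged to the window made of this phase and its predecessor.
    Every round lies in at most two windows; the two families of windows appear as the costs up to
    [a] and up to [b]. *)
Lemma clean_count t :
  exists a b, [/\ a <= b <= t, S t \subset requested a b /\ M t \subset requested b t,
    \sum_(0 <= s < t) clean k r s <= k + cost r Cs 0 a + cost r Cs 0 b + #|M t :\: S t|
    & S t = finset.set0 -> \sum_(0 <= s < t) clean k r s = #|M t|].
Proof.
have inv := marking_invP r k0.
elim: t => [|t [a [b [abt [SR MR] le_c S0_c]]]].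
  have M0 : M 0 = finset.set0 by apply/setP => i; rewrite !inE.
  have S0 : S 0 = finset.set0 by apply/setP => i; rewrite !inE.
  exists 0, 0; rewrite big_geq // M0 S0; split; rewrite ?finset.sub0set ?cards0 //.
have ft := clean_close abt SR MR le_c S0_c.
have [[Mk' Sk' _] alt _] := marking_before (inv t).
have rt : r t \in requested t t.+1 by apply/requestedP; exists t; rewrite ?leqnn ?ltnSn.
have rsub x : x <= t -> requested x t \subset requested x t.+1.
  by move=> xt; apply/fintype.subsetP => i /requestedP[s sab <-]; apply/requestedP; exists s => //; lia.
have cS : \sum_(0 <= s < t.+1) clean k r s = \sum_(0 <= s < t) clean k r s + clean k r t.
  by rewrite big_nat_recr.
have MS u (m := before k r 0 u) : #|M u.+1 :\: S u.+1| = #|marked n m :\: stale n m| + clean k r u.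
  rewrite /M /S marked_counts stale_counts -/m /clean -/m.
  have [rS|rS] := boolP (r u \in stale n m).
    rewrite andbF addn0; apply: eq_card => i; rewrite !inE.
    by case: eqP => [->|] //; move: rS; rewrite inE => ->.
  rewrite andbT addnC; have [rM|rM] := boolP (r u \in marked n m).
    by apply: eq_card => i; rewrite !inE; case: eqP => [->|] //; move: rM; rewrite inE => ->.
  rewrite (_ : _ :\: _ = r u |: (marked n m :\: stale n m)).
    by rewrite cardsU1 finset.in_setD (negbTE rM) andbF.
  by apply/setP => i; rewrite !finset.in_setD !in_setU1 finset.in_setD; case: eqP => [->|//]; rewrite rS.
have [[SM [M0 Mk]]|eqb] := alt.
  (* A phase opens at [t]: [b, t) becomes the previous phase, and [clean_close] has already charged
     its clean requests. *)
  exists b, t; split.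
  - by case/andP: abt => _ ->; rewrite leqnSn.
  - split; first by rewrite /S stale_counts SM; apply: fintype.subset_trans MR _.
    by rewrite /M marked_counts M0 finset.setU0; apply/fintype.subsetP => i; rewrite inE => /eqP ->.
  - by rewrite cS MS M0 finset.set0D cards0 add0n leq_add2r.
  - by rewrite /S stale_counts SM => M0'; move: Mk; rewrite M0' cards0; lia.
exists a, b; split.
- by case/andP: abt => -> /leqW.
- split; first by rewrite /S stale_counts eqb.
  rewrite /M marked_counts eqb finset.subUset finset.sub1set; apply/andP; split.
    by apply/requestedP; exists t => //; lia.
  by apply: fintype.subset_trans MR _; apply: rsub; lia.
- by rewrite cS MS eqb addnA leq_add2r.
- rewrite /S stale_counts eqb => S0; have := MS t; rewrite /S stale_counts eqb S0 !finset.setD0 => ->.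
  by rewrite cS (S0_c S0).
Qed.

Lemma clean_offline T : \sum_(0 <= s < T) clean k r s <= 2 * cost r Cs 0 T + k.
Proof.
have [a [b [abT [SR MR] le_c S0_c]]] := clean_count T.
have := clean_close abT SR MR le_c S0_c.
have /andP[_ bT] := abT; have := cost_cat (leq0n b) bT; lia.
Qed.

End Offline.

Local Open Scope ring_scope.

(** * Discretised uniform samples *)

Section Digit.
Variable R : realType.

(** One step of the binary expansion: the digits read so far and the remaining fraction. Rounding
    goes bit by bit because the machine compares reals but has no integer part. The sample 1 keeps
    remainder 1 and ends at the largest value. *)
Definition dig_step (vx : nat * R) : nat * R :=
  if 2 * vx.2 < 1 then ((2 * vx.1)%N, 2 * vx.2) else ((2 * vx.1 + 1)%N, 2 * vx.2 - 1).

Definition dig_iter (u : R) (l : nat) : nat * R := iter l dig_step (0%N, u).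

Definition dig (l : nat) (u : R) : nat := (dig_iter u l).1.

Lemma dig_lt l u : (dig l u < 2 ^ l)%N.
Proof.
rewrite /dig; elim: l => [|l IH] //=.
by rewrite /dig_step; case: ifP => _ /=; rewrite expnS; lia.
Qed.

Lemma dig0 l : dig l 0 = 0%N.
Proof.
rewrite /dig; suff -> : dig_iter 0 l = (0%N, 0) by [].
by rewrite /dig_iter; elim: l => //= l ->; rewrite /dig_step /= mulr0 ltr01.
Qed.

Lemma dig_floor l u : 0 <= u < 1 ->
  (dig l u)%:R <= 2 ^+ l * u < (dig l u).+1%:R.
Proof.
move=> /andP[u0 u1].
suff [-> /andP[h0 h1]] : 2 ^+ l * u = (dig l u)%:R + (dig_iter u l).2 /\
    0 <= (dig_iter u l).2 < 1.
  by rewrite -natr1; apply/andP; split; lra.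
rewrite /dig; elim: l => [|l [IH /andP[h0 h1]]] /=.
  by rewrite expr0 mul1r add0r u0.
rewrite exprS -mulrA IH /dig_step; case: ifP => /= [h|/negbT]; last rewrite -leNgt => h.
  have natE : (2 * (dig_iter u l).1)%:R = 2 * (dig_iter u l).1%:R :> R by rewrite natrM.
  by split; [rewrite natE; ring | apply/andP; split; lra].
  have natE : (2 * (dig_iter u l).1 + 1)%:R = 2 * (dig_iter u l).1%:R + 1 :> R by rewrite natrD natrM.
  by split; [rewrite natE; ring | apply/andP; split; lra].
Qed.

Lemma dig_eq l u g : 0 <= u < 1 -> (dig l u == g) = (g%:R <= 2 ^+ l * u < g.+1%:R).
Proof.
move=> u01; have /andP[h1 h2] := @dig_floor l u u01.
apply/eqP/idP => [<-|/andP[g1 g2]]; first exact/andP.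
have := le_lt_trans h1 g2; have := le_lt_trans g1 h2.
by rewrite !ltr_nat; lia.
Qed.

(** Each value is taken on an interval of length [(2 ^+ l)^-1]; the last one is closed so as to
    contain the sample 1. The integrand is thus a finite combination of indicators. *)
Lemma integral_dig l (h : nat -> R) : (forall g, 0 <= h g) ->
  (\int[lebesgue_measure]_(u in `[0%R, 1%R]) (h (dig l u))%:E
   = ((2 ^+ l)^-1 * \sum_(g < 2 ^ l) h g)%:E)%E.
Proof.
move=> h0; set G := (2 ^ l)%N.
have Gn : G%:R = 2 ^+ l :> R by rewrite natrX.
have G0 : 0 < 2 ^+ l :> R by rewrite exprn_gt0.
pose A (g : nat) : set R := if g.+1 == G then `[g%:R / 2 ^+ l, 1]%classic
  else `[g%:R / 2 ^+ l, g.+1%:R / 2 ^+ l[%classic.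
have mA g : measurable (A g).
  by rewrite /A; case: ifP => _; exact: measurable_itv.
have AS (g : 'I_G) : (A g `<=` `[0, 1])%classic.
  rewrite /A; case: ifP => _ x /=; rewrite !in_itv /= => /andP[x0 x1].
    by rewrite x1 andbT; apply: le_trans x0; rewrite divr_ge0 // ltW.
  apply/andP; split; first by apply: le_trans x0; rewrite divr_ge0 // ltW.
  apply: ltW; apply: lt_le_trans x1 _.
  by rewrite ler_pdivrMr // mul1r -Gn ler_nat.
have muA (g : 'I_G) : lebesgue_measure (A g) = ((2 ^+ l)^-1)%:E :> \bar R.
  rewrite /A; case: ifP => [/eqP e|_]; rewrite lebesgue_measure_itv /= lte_fin.
    have lt1 : g%:R / 2 ^+ l < 1 :> R by rewrite ltr_pdivrMr // mul1r -Gn ltr_nat.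
    rewrite lt1 -EFinD; congr _%:E.
    have e1 : 2 ^+ l = g%:R + 1 :> R by rewrite natr1 e Gn.
    by apply: (mulIf (lt0r_neq0 G0)); rewrite mulrBl divfK ?gt_eqF // mulVf ?gt_eqF // mul1r e1; ring.
  rewrite ltr_pM2r ?invr_gt0 // ltr_nat ltnSn -EFinD; congr _%:E.
  by rewrite -mulrBl -natr1 addrAC subrr add0r mul1r.
have dA u (g : 'I_G) : 0 <= u <= 1 -> (dig l u == g) = (u \in A g).
  move=> /andP[u0]; rewrite le_eqVlt => /orP[/eqP u1|u1].
    have d1 : dig l u = (2 ^ l).-1.
      rewrite u1 /dig; suff -> : dig_iter 1 l = ((2 ^ l).-1, 1) by [].
      rewrite /dig_iter; elim: (l) => //= m ->.
      rewrite /dig_step /= mulr1 ifN; last by rewrite -leNgt ler1n.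
      congr pair; last by ring.
      by have := expn_gt0 2 m; rewrite expnS; lia.
    rewrite d1 -/G /A; case: ifP => [/eqP e|/eqP e]; rewrite mem_setE.
      have -> : G.-1 = g by rewrite -[in LHS]e.
      rewrite eqxx in_itv /= u1 lexx andbT; symmetry.
      by rewrite ler_pdivrMr // mul1r -Gn ler_nat ltnW.
    rewrite in_itv /= u1 [X in _ = _ && X]ltr_pdivlMr // mul1r -Gn ltr_nat.
    have := ltn_ord g => gG; rewrite [in RHS]ltnNge gG andbF.
    by apply/eqP => E; apply: e; rewrite -E; lia.
  rewrite dig_eq ?u0 // /A; case: ifP => [/eqP e|e]; rewrite mem_setE in_itv /=.
    by rewrite ler_pdivrMr // (mulrC u) (ltW u1) andbT e Gn gtr_pMr // u1 andbT.
  by rewrite ler_pdivrMr // ltr_pdivlMr // mulrC.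
have -> : (\int[lebesgue_measure]_(u in `[0%R, 1%R]) (h (dig l u))%:E =
  \int[lebesgue_measure]_(u in `[0%R, 1%R]) \sum_(g < G) (h g * \1_(A g) u)%:E)%E.
  apply: eq_integral => u; rewrite inE /= in_itv /= => u01.
  rewrite (bigD1 (Ordinal (dig_lt l u))) //= big1 => [|g ng].
    by rewrite adde0 indicE -(dA _ (Ordinal (dig_lt l u)) u01) eqxx mulr1.
  rewrite indicE -dA // (_ : (_ == _) = false) ?mulr0 //.
  by apply: contra_neqF ng => /eqP e; apply/val_inj.
rewrite ge0_integral_sum //.
- rewrite mulr_sumr -sumEFin; apply: eq_bigr => g _.
  under eq_integral do rewrite EFinM.
  have mI : measurable_fun (`[0%R, 1%R]%classic : set R) (\1_(A g) : R -> R).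
    by apply: measurable_indic; exact: mA.
  rewrite ge0_integralZl //.
  - rewrite integral_indic //; last exact: mA.
    have -> : (A g `&` `[0, 1]%classic)%classic = A g.
      by apply/classical_sets.setIidl; exact: AS.
    by rewrite [X in (_ * X)%E](muA g) -EFinM mulrC.
  - exact/measurable_EFinP.
  - by rewrite lee_fin.
- move=> g; apply/measurable_EFinP; apply: measurable_funM => //.
  by apply: measurable_indic; exact: mA.
- by move=> g u _; rewrite lee_fin mulr_ge0 // indicE.
Qed.

End Digit.

Definition scons {A : Type} (x : A) (f : nat -> A) : nat -> A :=
  fun j => if j is j'.+1 then f j' else x.

Section UniformMean.
Variables (R : realType) (G : nat).
Implicit Types (F H : (nat -> nat) -> R) (w : nat -> nat).

(** The mean over [N] independent coordinates uniform on {0, ..., G - 1}, the others being 0; the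
    recursion mirrors [expect_uniform]. *)
Fixpoint EE (N : nat) F : R :=
  if N is N'.+1 then G%:R^-1 * \sum_(g < G) EE N' (fun w => F (scons (g : nat) w))
  else F (fun=> 0%N).

Lemma EE_ext N F H : F =1 H -> EE N F = EE N H.
Proof. by move=> /funext ->. Qed.

Lemma EED N F H : EE N (fun w => F w + H w) = EE N F + EE N H.
Proof.
elim: N F H => [//|N IH] F H /=.
by rewrite -mulrDr -big_split; congr (_ * _); apply: eq_bigr => g _; rewrite IH.
Qed.

Lemma EEZ N c F : EE N (fun w => c * F w) = c * EE N F.
Proof.
elim: N F => [//|N IH] F /=.
rewrite [RHS]mulrCA [c * _]mulr_sumr; congr (_ * _).
by apply: eq_bigr => g _; rewrite IH.
Qed.

Lemma EE_sum (I : Type) N (s : seq I) (P : pred I) (F : I -> (nat -> nat) -> R) :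
  EE N (fun w => \sum_(i <- s | P i) F i w) = \sum_(i <- s | P i) EE N (F i).
Proof.
elim: s => [|i s IH].
  rewrite big_nil -[RHS](mul0r (EE N (fun=> 0))) -EEZ.
  by apply: EE_ext => w; rewrite big_nil mul0r.
rewrite big_cons; case: ifP => Pi; last first.
  by rewrite -IH; apply: EE_ext => w; rewrite big_cons Pi.
by rewrite -IH -EED; apply: EE_ext => w; rewrite big_cons Pi.
Qed.

Hypothesis G0 : (0 < G)%N.

Let GR0 : 0 < G%:R :> R. Proof. by rewrite ltr0n. Qed.

Lemma EE_cst N c : EE N (fun=> c) = c.
Proof.
elim: N => [//|N IH] /=; rewrite IH sumr_const card_ord.
by rewrite -[c *+ _]mulr_natl mulKf // gt_eqF.
Qed.

Lemma EE_le N F H : (forall w, (forall j, (w j < G)%N) -> F w <= H w) ->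
  EE N F <= EE N H.
Proof.
elim: N F H => [|N IH] F H FH /=; first exact: FH.
rewrite ler_pM2l ?invr_gt0 //; apply: ler_sum => g _.
by apply: IH => w wG; apply: FH => -[|j] /=.
Qed.

Lemma EE_ge0 N F : (forall w, (forall j, (w j < G)%N) -> 0 <= F w) -> 0 <= EE N F.
Proof. by move=> F0; rewrite -[0](EE_cst N 0); apply: EE_le. Qed.

(* The coordinates are independent: averaging over one of them, the others
   being fixed, does not change the mean. *)
Lemma EE_resample N F j : (j < N)%N ->
  EE N F = EE N (fun w => G%:R^-1 * \sum_(g < G) F (fupd w j g)).
Proof.
elim: N F j => [//|N IH] F [|j] /= jN.
  congr (_ * _).
  have E (h : nat) : EE N (fun w => G%:R^-1 * \sum_(g < G) F (fupd (scons h w) 0 g))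
      = G%:R^-1 * \sum_(g < G) EE N (fun w => F (scons (g : nat) w)).
    rewrite EEZ EE_sum; congr (_ * _); apply: eq_bigr => g _.
    by apply: EE_ext => w; congr F; apply/funext => -[|i].
  under [RHS]eq_bigr => h _ do rewrite E.
  by rewrite sumr_const card_ord -[RHS]mulr_natl mulVKf // gt_eqF.
congr (_ * _); apply: eq_bigr => h _; rewrite (IH _ j) //; apply: EE_ext => w.
congr (_ * _); apply: eq_bigr => g _; congr F.
by apply/funext => -[|i]; rewrite /fupd //= eqSS.
Qed.

Definition fswap w (i j : nat) : nat -> nat :=
  fun x => if x == i then w j else if x == j then w i else w x.

(** Both coordinates are resampled, in opposite orders on the two sides; the swap then only renames
    the two averaged values. *)
Lemma EE_swap N F i j : (i < N)%N -> (j < N)%N ->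
  EE N (fun w => F (fswap w i j)) = EE N F.
Proof.
move=> iN jN; have [<-|ij] := eqVneq i j.
  apply: EE_ext => w; congr F; apply/funext => x; rewrite /fswap.
  by case: eqP => // ->.
rewrite (EE_resample _ iN) [RHS](EE_resample _ jN).
rewrite (EE_resample _ jN) [RHS](EE_resample _ iN).
apply: EE_ext => w; congr (_ * _); apply: eq_bigr => g _.
congr (_ * _); apply: eq_bigr => h _.
congr F; apply/funext => x; rewrite /fswap /fupd.
have ji : (j == i) = false by rewrite eq_sym (negbTE ij).
have [->|xi] := eqVneq x i; first by rewrite ?eqxx ?ji ?(negbTE ij).
by have [xj|xj] := eqVneq x j; rewrite ?xj ?eqxx ?ji ?(negbTE ij) ?(negbTE xi).
Qed.

End UniformMean.
Arguments EE_resample {R G} G0 {N F} j.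
Arguments EE_swap {R G} G0 {N F} i j.

Lemma expect_uniform_dig (R : realType) l N (F : (nat -> nat) -> R) :
  (forall w, 0 <= F w) ->
  expect_uniform N (fun w : nat -> R => (F (fun j => dig l (w j)))%:E)
  = (EE (2 ^ l) N F)%:E.
Proof.
elim: N F => [|N IH] F F0 /=.
  by congr (F _)%:E; apply/funext => j; rewrite dig0.
have E u : expect_uniform N (fun w : nat -> R =>
    (F (fun j => dig l (scons u w j)))%:E)
  = (EE (2 ^ l) N (fun w => F (scons (dig l u) w)))%:E.
  rewrite -IH //; congr expect_uniform; apply/funext => w.
  by congr (F _)%:E; apply/funext => -[|j].
under eq_integral do rewrite E.
have EE0 g : 0 <= EE (2 ^ l) N (fun w => F (scons g w)).
  by apply: EE_ge0; rewrite ?expn_gt0.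
by rewrite (@integral_dig R l (fun g => EE (2 ^ l) N (fun w => F (scons g w)))) // natrX.
Qed.

(** * Combining two experts *)

Section ProdStep.
Variable R : realType.
Implicit Types w x eta c : R.

Definition mixing w : R := w / (1 + w).

Definition prod_loss c eta x : R := x - 4 * c * eta * `|x|.

(** The Prod rule: with a linear factor, the total weight [1 + w] is multiplied by exactly
    [1 + p * (eta * y)], where [p] is the mixing probability and [y] the corrected advantage. *)
Definition prod_update c eta w x : R := w * (1 + eta * prod_loss c eta x).

Lemma ln_ge1D (z : R) : - 2^-1 <= z -> z - 2 * z ^+ 2 <= ln (1 + z).
Proof.
move=> z2; have z1 : 0 < 1 + z by lra.
have h : ln ((1 + z)^-1) <= (1 + z)^-1 - 1.
  have := @le_ln1Dx R ((1 + z)^-1 - 1).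
  rewrite [1 + (_ - 1)]addrC subrK; apply.
  by rewrite ltrBrDr addrC subrr invr_gt0.
rewrite lnV ?posrE // in h.
have : (1 + z)^-1 <= 1 - z + 2 * z ^+ 2; last lra.
rewrite -[_^-1]mul1r ler_pdivrMr //.
have : 0 <= z ^+ 2 * (1 + 2 * z); last by lra.
by apply: mulr_ge0; [exact: sqr_ge0 | lra].
Qed.

Lemma mixing_ge0 w : 0 <= w -> 0 <= mixing w.
Proof. by move=> w0; rewrite divr_ge0 // addr_ge0. Qed.

Lemma mixing_le1 w : 0 <= w -> mixing w <= 1.
Proof. by move=> w0; rewrite ler_pdivrMr ?mul1r ?lerDr // ltr_wpDr. Qed.

Lemma mixing_lew w : 0 <= w -> mixing w <= w.
Proof. by move=> w0; rewrite ler_pdivrMr ?ltr_wpDr // mulrDr mulr1 lerDl mulr_ge0. Qed.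

Lemma mixing_ln w : 0 <= w -> mixing w <= ln (1 + w).
Proof.
move=> w0; have w1 : 0 < 1 + w by rewrite ltr_wpDr.
have := @le_ln1Dx R ((1 + w)^-1 - 1).
rewrite [1 + (_ - 1)]addrC subrK lnV ?posrE // => H.
have -> : mixing w = 1 - (1 + w)^-1.
  by rewrite /mixing; field; rewrite gt_eqF.
have : - ln (1 + w) <= (1 + w)^-1 - 1; last lra.
by apply: H; rewrite ltrBrDr addrC subrr invr_gt0.
Qed.

Section Update.
Variables (c eta w x : R).
Hypotheses (c1 : 1 <= c) (eta0 : 0 < eta) (c_eta : 8 * c * eta <= 1).
Hypotheses (w0 : 0 <= w) (x2 : `|x| <= 2).

Local Notation p := (mixing w).
Local Notation y := (prod_loss c eta x).
Local Notation w' := (prod_update c eta w x).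

Let ceta0 : 0 <= c * eta. Proof. by rewrite mulr_ge0 // ltW // (lt_le_trans ltr01). Qed.

Let y_abs : `|y| <= 2 * `|x|.
Proof.
move: c1 eta0 c_eta w0 x2 => c1_ eta0_ c_eta_ w0_ x2_.
rewrite /prod_loss; apply: le_trans (ler_normB _ _) _.
have h : 0 <= 4 * c * eta by rewrite -mulrA mulr_ge0.
rewrite normrM normr_id (ger0_norm h).
have h1 : 4 * c * eta <= 1 by have := c_eta; lra.
have := ler_wpM2r (normr_ge0 x) h1; lra.
Qed.

Let eta_y : `|eta * y| <= 2^-1.
Proof.
move: c1 eta0 c_eta w0 x2 => c1_ eta0_ c_eta_ w0_ x2_.
rewrite normrM (gtr0_norm eta0).
have eta8 : eta <= 8^-1.
  by nra.
have : eta * `|y| <= 8^-1 * 4; last lra.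
by apply: ler_pM => //; [exact: ltW | have := y_abs; lra].
Qed.

Let factor_gt0 : 0 < 1 + eta * y.
Proof.
move: c1 eta0 c_eta w0 x2 => c1_ eta0_ c_eta_ w0_ x2_.
by move: eta_y; rewrite ler_norml => /andP[h _]; lra.
Qed.

Lemma prod_update_ge0 : 0 <= w'.
Proof. by rewrite /prod_update mulr_ge0 // ltW. Qed.

Lemma prod_update_gt0 : 0 < w -> 0 < w'.
Proof. by move=> ?; rewrite /prod_update mulr_gt0. Qed.

Let w1 : 0 < 1 + w. Proof. by rewrite ltr_wpDr. Qed.
Let p0 : 0 <= p. Proof. exact: mixing_ge0. Qed.
Let p1 : p <= 1. Proof. exact: mixing_le1. Qed.

Let pz_abs : `|p * (eta * y)| <= 2^-1.
Proof. by rewrite normrM ger0_norm //; apply: le_trans eta_y; rewrite ler_piMl. Qed.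

Let pz_gt0 : 0 < 1 + p * (eta * y).
Proof.
move: c1 eta0 c_eta w0 x2 => c1_ eta0_ c_eta_ w0_ x2_.
by move: pz_abs; rewrite ler_norml => /andP[h _]; lra.
Qed.

Let sum_w' : 1 + w' = (1 + w) * (1 + p * (eta * y)).
Proof.
rewrite /prod_update /mixing; field.
by rewrite gt_eqF.
Qed.

(** The probability changes by [p (1 - p) eta y / (1 + p eta y)]. As [|y| <= 2 |x|] and the
    denominator is at least 1/2, this is at most [4 p eta |x|] in absolute value; times [c] it is
    exactly [p (x - y)]. Hence the factor 4 in [prod_loss]. *)
Lemma mixing_drift : c * `|mixing w' - p| <= p * (x - y).
Proof.
move: c1 eta0 c_eta w0 x2 => c1_ eta0_ c_eta_ w0_ x2_.
have -> : mixing w' - p = p * (1 - p) * (eta * y) / (1 + p * (eta * y)).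
  have n1 : 1 + w != 0 by rewrite gt_eqF.
  have n2 : 1 + p * (eta * y) != 0 by rewrite gt_eqF.
  have n3 : 1 + w * (1 + eta * y) != 0.
    by rewrite -/(prod_update c eta w x) sum_w' mulf_neq0.
  rewrite /prod_update; move: n2 n3; rewrite /mixing.
  move: (eta * y) => z n2 n3; have n4 : 1 + w + w * z != 0 by move: n3; rewrite mulrDr mulr1 addrA.
  have n5 : 1 + w / (1 + w) * z = (1 + w + w * z) / (1 + w) by field.
  by rewrite n5; field; rewrite n1 n4.
have pp0 : 0 <= p * (1 - p) by rewrite mulr_ge0 ?subr_ge0.
rewrite normrM [`|p * (1 - p) * _|]normrM (ger0_norm pp0) [`|eta * _|]normrM normfV (gtr0_norm pz_gt0).
rewrite (gtr0_norm eta0) /prod_loss opprB addrCA subrr addr0.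
have h1 : (1 + p * (eta * y))^-1 <= 2.
  rewrite -[_^-1]mul1r ler_pdivrMr //.
  by move: pz_abs; rewrite ler_norml => /andP[h _]; lra.
have : p * (1 - p) * (eta * `|y|) / (1 + p * (eta * y)) <= (p * (eta * (2 * `|x|))) * 2.
  apply: ler_pM => //.
  - by rewrite mulr_ge0 // mulr_ge0 // ltW.
  - by rewrite invr_ge0 ltW.
  - apply: ler_pM => //.
    + by rewrite mulr_ge0 // ltW.
    + by rewrite ler_piMr // lerBlDr lerDl.
    + by rewrite ler_wpM2l // ltW.
move=> /(ler_wpM2l (le_trans ler01 c1))/le_trans; apply.
rewrite le_eqVlt; apply/orP; left; apply/eqP; ring.
Qed.

Lemma mixing_gain : (ln (1 + w') - ln (1 + w)) / eta <= p * y.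
Proof.
move: c1 eta0 c_eta w0 x2 => c1_ eta0_ c_eta_ w0_ x2_.
rewrite sum_w' lnM ?posrE // addrAC subrr add0r ler_pdivrMr //.
have -> : p * y * eta = p * (eta * y) by ring.
by apply: le_ln1Dx; have := pz_gt0; lra.
Qed.

(* The mixture loses nothing to the first expert, up to a change of potential. *)
Lemma prod_step_base :
  - p * x + c * `|mixing w' - p| <= (ln (1 + w) - ln (1 + w')) / eta.
Proof.
move: c1 eta0 c_eta w0 x2 => c1_ eta0_ c_eta_ w0_ x2_.
have := mixing_drift; have := mixing_gain.
move: (c * `|mixing w' - p|) (ln (1 + w')) (ln (1 + w)) (mixing w) (prod_loss c eta x) => d a b q z.
lra.
Qed.

(** Discarding the updated odds [w'] adds at most [mixing w' + mixing w_] to the drift. Since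
    [c <= eta^-1], the first part costs at most [ln (1 + w') / eta], the very potential that the
    restart releases. *)
Lemma prod_step_reset w_ : 0 <= w_ ->
  - p * x + c * `|mixing w_ - p|
  <= (ln (1 + w) - ln (1 + w_)) / eta + 2 * w_ / eta.
Proof.
move: c1 eta0 c_eta w0 x2 => c1_ eta0_ c_eta_ w0_ x2_.
move=> w_0; have := prod_step_base.
have w'0 := prod_update_ge0.
have t1 : `|mixing w_ - p| <= `|mixing w' - p| + mixing w' + mixing w_.
  have -> : mixing w_ - p = (mixing w' - p) + (mixing w_ - mixing w') by ring.
  apply: le_trans (ler_normD _ _) _; rewrite -addrA lerD2l addrC.
  apply: le_trans (ler_normB _ _) _.
  by rewrite !ger0_norm ?mixing_ge0.
have ci : c <= eta^-1.
  rewrite -[eta^-1]mul1r ler_pdivlMr //; have := ceta0; lra.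
have e0 : 0 <= eta^-1 by rewrite invr_ge0 ltW.
have t2 : c * mixing w' <= ln (1 + w') / eta.
  rewrite mulrC; apply: ler_pM => //; [exact: mixing_ge0 | lra | exact: mixing_ln].
have t3 : c * mixing w_ <= w_ / eta.
  rewrite mulrC; apply: ler_pM => //; [exact: mixing_ge0 | lra | exact: mixing_lew].
have t4 : ln (1 + w_) / eta <= w_ / eta.
  by rewrite ler_wpM2r // le_ln1Dx // (lt_le_trans _ w_0) // ltrN10.
have t5 := ler_wpM2l (le_trans ler01 c1) t1.
rewrite ![(ln _ - ln _) / eta]mulrBl; rewrite -mulrA; lra.
Qed.

(** The potential is [ln (1 + w) - ln w]: one part follows the mixture, the other the expert. Of the
    constant 40, 8 comes from [x - y] and 32 from the quadratic error of the logarithm with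
    [|y| <= 4]. *)
Lemma prod_step_regret : 0 < w ->
  x - p * x + c * `|mixing w' - p|
  <= 40 * c * eta + (ln (1 + w^-1) - ln (1 + w'^-1)) / eta.
Proof.
move: c1 eta0 c_eta w0 x2 => c1_ eta0_ c_eta_ w0_ x2_.
move=> wp; have wp' := prod_update_gt0 wp.
have lnE v : 0 < v -> ln (1 + v^-1) = ln (1 + v) - ln v :> R.
  move=> v0; have -> : 1 + v^-1 = (1 + v) / v by field; rewrite gt_eqF.
  by rewrite ln_div ?posrE // addr_gt0.
rewrite !lnE //.
have := mixing_drift; have := mixing_gain.
have : y <= (ln w' - ln w) / eta + 32 * eta.
  rewrite /prod_update lnM ?posrE // addrAC subrr add0r.
  rewrite -lerBlDr ler_pdivlMr //.
  have /ln_ge1D : - 2^-1 <= eta * y by move: eta_y; rewrite ler_norml => /andP[].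
  have : (eta * y) ^+ 2 <= eta ^+ 2 * 16.
    rewrite exprMn ler_wpM2l ?sqr_ge0 // -real_normK ?num_real //.
    have -> : 16 = 4 ^+ 2 :> R by ring.
    by rewrite lerXn2r ?nnegrE // (le_trans y_abs) //; lra.
  lra.
have : x <= y + 8 * c * eta.
  rewrite /prod_loss -addrA lerDl addrC subr_ge0.
  have : 4 * c * eta * `|x| <= 4 * c * eta * 2.
    by rewrite ler_wpM2l // -mulrA mulr_ge0.
  lra.
have : eta <= c * eta by rewrite ler_peMl // ltW.
rewrite !mulrBr !mulrBl; lra.
Qed.

Lemma mixing_drift_le : c * `|mixing w' - p| <= 8 * c * eta.
Proof.
move: c1 eta0 c_eta w0 x2 => c1_ eta0_ c_eta_ w0_ x2_.
apply: le_trans mixing_drift _; rewrite /prod_loss opprB addrCA subrr addr0.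
apply: le_trans (_ : 1 * (4 * c * eta * 2) <= _); last by lra.
apply: ler_pM => //; first by rewrite !mulr_ge0 // ltW // (lt_le_trans ltr01).
by rewrite ler_wpM2l // -mulrA mulr_ge0.
Qed.

End Update.
End ProdStep.

(** * The hierarchy of experts *)

Section Hierarchy.
Variables (R : realType) (ell k G : nat) (lam : R).

(** With [lam] the square root of [ell], both regret terms of a block of [4 ^ e] rounds, the sum of
    the [40 k eta] and [ln (1 + G) / eta], are O([k lam 2 ^ e]). *)
Definition rate (e : nat) : R := lam / 2 ^+ e.

(* Scales whose learning rate would be too large are never used; the weight
   G^-1 is so small that no value of the coin selects scale e when its block starts. *)
Definition init_weight (e : nat) : R :=
  if 2 ^+ e < 8 * k%:R * lam then 0 else G%:R^-1.

(* Mean cost of the mixture of expert 0 and of the l largest scales. *)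
Fixpoint mixture (W a : nat -> R) (l : nat) : R :=
  if l is l'.+1 then
    mixture W a l' - mixing (W (ell - l')%N) * (mixture W a l' - a (ell - l')%N)
  else a 0%N.

Section Dynamics.
Variable a : nat -> nat -> R.  (* cost of expert e in round t *)

Definition advantage W t e : R := mixture W (a^~ t) (ell - e) - a e t.

(** Weights as the previous round leaves them; a restart takes effect only when they are read, by
    [weight], whose body is inlined here for the recursion. *)
Fixpoint stored_weight t : nat -> R :=
  if t is t'.+1 then
    fun e => let W := fun e => if (t' %% 4 ^ e == 0)%N then init_weight e
                               else stored_weight t' e in
             prod_update k%:R (rate e) (W e) (advantage W t' e)
  else fun=> 0.

Definition weight t e : R :=
  if (t %% 4 ^ e == 0)%N then init_weight e else stored_weight t e.

Arguments stored_weight : simpl never.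

Lemma stored_weightS t e : stored_weight t.+1 e
  = prod_update k%:R (rate e) (weight t e) (advantage (weight t) t e).
Proof. by []. Qed.

Lemma weight_reset t e : (t %% 4 ^ e == 0)%N -> weight t e = init_weight e.
Proof. by rewrite /weight => ->. Qed.

Definition mix l t : R := mixture (weight t) (a^~ t) l.

Definition prob e t : R := mixing (weight t e).

Lemma probE e t : prob e t = mixing (weight t e). Proof. by []. Qed.

Lemma mixS l t :
  mix l.+1 t = mix l t - prob (ell - l) t * (mix l t - a (ell - l)%N t).
Proof. by []. Qed.

Hypotheses (k0 : (0 < k)%N) (G0 : (0 < G)%N) (lam1 : 1 <= lam).
Hypothesis a02 : forall e t, 0 <= a e t <= 2.

Let rate0 e : 0 < rate e.
Proof. by rewrite divr_gt0 ?exprn_gt0 // (lt_le_trans ltr01). Qed.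

Let kR1 : 1 <= k%:R :> R. Proof. by rewrite ler1n. Qed.

Definition active e : bool := 8 * k%:R * lam <= 2 ^+ e.

Lemma active_rate e : active e -> 8 * k%:R * rate e <= 1.
Proof. by rewrite /active /rate mulrA ler_pdivrMr ?exprn_gt0 // mul1r. Qed.

Lemma init_weightE e : init_weight e = if active e then G%:R^-1 else 0.
Proof. by rewrite /init_weight /active ltNge; case: (_ <= _). Qed.

Lemma init_weight_ge0 e : 0 <= init_weight e.
Proof. by rewrite init_weightE; case: ifP => // _; rewrite invr_ge0. Qed.

Lemma mixture_bounds (W at_ : nat -> R) l : (forall e, 0 <= W e) -> (forall e, 0 <= at_ e <= 2) ->
  0 <= mixture W at_ l <= 2.
Proof.
move=> W0 a2; elim: l => [|l /andP[h0 h2]] /=; first exact: a2.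
have /andP[q0 q2] := a2 (ell - l)%N.
have p0 := mixing_ge0 (W0 (ell - l)%N); have p1 := mixing_le1 (W0 (ell - l)%N).
move: (mixing _) (mixture _ _ _) (at_ _) h0 h2 q0 q2 p0 p1 => p u v *.
by apply/andP; split; nra.
Qed.

Lemma weights_ok t : forall e, 0 <= weight t e /\ (~~ active e -> weight t e = 0).
Proof.
elim: t => [|t IH] e.
  rewrite /weight mod0n eqxx; split; first exact: init_weight_ge0.
  by rewrite init_weightE => /negbTE ->.
rewrite /weight; case: ifP => _.
  split; first exact: init_weight_ge0.
  by rewrite init_weightE => /negbTE ->.
rewrite stored_weightS; have [w0 wi] := IH e.
have [ae|ae] := boolP (active e); last by rewrite (wi ae) /prod_update mul0r.
split=> //; apply: prod_update_ge0 => //; first exact: active_rate.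
rewrite /advantage.
have /andP[h0 h2] := mixture_bounds (ell - e) (fun e => (IH e).1) (a02^~ t).
have /andP[q0 q2] := a02 e t.
by rewrite ler_norml; apply/andP; split; lra.
Qed.

Lemma weight_ge0 t e : 0 <= weight t e. Proof. by case: (weights_ok t e). Qed.

Lemma prob_ge0 e t : 0 <= prob e t. Proof. exact/mixing_ge0/weight_ge0. Qed.

Lemma prob_le1 e t : prob e t <= 1. Proof. exact/mixing_le1/weight_ge0. Qed.

Lemma prob_inactive e t : ~~ active e -> prob e t = 0.
Proof. by move=> ae; rewrite /prob (weights_ok t e).2 // /mixing mul0r. Qed.

Lemma mix_bounds l t : 0 <= mix l t <= 2.
Proof. by apply: mixture_bounds => e; [exact: weight_ge0 | exact: a02]. Qed.

Lemma advantage_le2 t e : `|advantage (weight t) t e| <= 2.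
Proof.
have /andP[h0 h2] := mix_bounds (ell - e) t; have /andP[q0 q2] := a02 e t.
rewrite /mix in h0 h2.
by rewrite ler_norml /advantage; apply/andP; split; lra.
Qed.

Lemma mix_level e t : (0 < e <= ell)%N ->
  mix (ell - e).+1 t = mix (ell - e) t - prob e t * advantage (weight t) t e.
Proof. by move=> /andP[e0 el]; rewrite mixS subKn. Qed.

Let Phi e t : R := ln (1 + weight t e) / rate e.

Lemma Phi_ge0 e t : 0 <= Phi e t.
Proof. by rewrite divr_ge0 ?ln_ge0 ?lerDl ?weight_ge0 // ltW. Qed.

(** A restart after round [t] is covered by [prod_step_reset] with new odds [1 / G], any other round
    by [prod_step_base]. *)
Lemma level_step e t : (0 < e <= ell)%N ->
  mix (ell - e).+1 t + k%:R * `|prob e t.+1 - prob e t|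
  <= mix (ell - e) t + Phi e t - Phi e t.+1 + 2 * G%:R^-1 / rate e.
Proof.
move=> el; rewrite mix_level //.
have Gi : 0 <= 2 * G%:R^-1 / rate e by rewrite divr_ge0 ?(ltW (rate0 e)) // mulr_ge0 // invr_ge0.
have [ae|ae] := boolP (active e); last first.
  by rewrite !(prob_inactive _ ae) mul0r subrr normr0 mulr0 /Phi !(weights_ok _ e).2 // !subr0 addr0 addrK lerDl.
have S := prod_step_reset kR1 (rate0 e) (active_rate ae) (weight_ge0 t e) (advantage_le2 t e).
have B := prod_step_base kR1 (rate0 e) (active_rate ae) (weight_ge0 t e) (advantage_le2 t e).
have [r0|r0] := boolP (t.+1 %% 4 ^ e == 0)%N.
  have := S _ (init_weight_ge0 e).
  rewrite /Phi /prob /weight r0 -/(weight t e) init_weightE ae mulrBl.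
  move: (ln _ / _) (ln _ / _) (_ / _) (k%:R * _) (advantage _ _ _) => *; lra.
move: B; rewrite -stored_weightS.
have -> : stored_weight t.+1 e = weight t.+1 e by rewrite /weight (negbTE r0).
rewrite /Phi /prob mulrBl.
move: (ln _ / _) (ln _ / _) (k%:R * _) (advantage _ _ _) Gi => *; lra.
Qed.

Definition drift e t : R := k%:R * `|prob e t.+1 - prob e t|.

Lemma driftE e t : drift e t = k%:R * `|prob e t.+1 - prob e t|. Proof. by []. Qed.

Lemma drift_ge0 e t : 0 <= drift e t. Proof. by rewrite mulr_ge0. Qed.

Lemma level_sum e b d : (0 < e <= ell)%N ->
  \sum_(b <= t < b + d) (mix (ell - e).+1 t + drift e t)
  <= \sum_(b <= t < b + d) mix (ell - e) t + Phi e b + d%:R * (2 * G%:R^-1 / rate e).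
Proof.
move=> el.
suff H : \sum_(b <= t < b + d) (mix (ell - e).+1 t + drift e t)
  <= \sum_(b <= t < b + d) mix (ell - e) t + Phi e b - Phi e (b + d) + d%:R * (2 * G%:R^-1 / rate e).
  by apply: le_trans H _; rewrite lerD2r lerBlDr lerDl; exact: Phi_ge0.
elim: d => [|d IH].
  by rewrite addn0 !big_geq // mul0r add0r addr0 subrr.
rewrite addnS !big_nat_recr ?leq_addr //=.
have := level_step (b + d) el; rewrite -/(drift e (b + d)) -[d.+1%:R]natr1 => S.
rewrite mulrDl mul1r.
move: (2 * _ / _) (d%:R * _) (Phi _ _) (Phi _ _) (Phi _ _) (\sum_(_ <= _ < _) _) (\sum_(_ <= _ < _) _) IH S => *; lra.
Qed.

Let inv_rate_le e : (e <= ell)%N -> (rate e)^-1 <= 2 ^+ ell.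
Proof.
move=> el; rewrite /rate invf_div ler_pdivrMr ?(lt_le_trans ltr01) //.
apply: le_trans (_ : 2 ^+ ell <= _); last by rewrite ler_peMr // exprn_ge0.
by rewrite ler_weXn2l // ler1n.
Qed.

(** Scales up to [j] all restart at [b], with odds at most [1 / G] and negligible potential. Mixing
    them in thus costs only errors over [G], and this includes their drift. *)
Lemma levels_sum j b d : (j <= ell)%N -> (forall e, (0 < e <= j)%N -> (b %% 4 ^ e == 0)%N) ->
  \sum_(b <= t < b + d) mix ell t + \sum_(1 <= e < j.+1) \sum_(b <= t < b + d) drift e t
  <= \sum_(b <= t < b + d) mix (ell - j) t + j%:R * ((1 + 2 * d%:R) * 2 ^+ ell / G%:R).
Proof.
elim: j => [|j IH] jl b4.
  by rewrite subn0 [X in _ + X]big_geq // mul0r.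
rewrite [X in _ + X]big_nat_recr //= addrA.
have jl' : (0 < j.+1 <= ell)%N by [].
have := level_sum b d jl'; rewrite big_split /= subnSK // => S.
have H := IH (ltnW jl) (fun e he => b4 e ltac:(lia)).
have G1 : 0 <= G%:R^-1 :> R by rewrite invr_ge0.
have P : Phi j.+1 b + d%:R * (2 * G%:R^-1 / rate j.+1) <= (1 + 2 * d%:R) * 2 ^+ ell / G%:R.
  have -> : (1 + 2 * d%:R) * 2 ^+ ell / G%:R = G%:R^-1 * 2 ^+ ell + d%:R * (2 * G%:R^-1 * 2 ^+ ell) :> R by ring.
  apply: lerD; last first.
    by rewrite ler_wpM2l // ler_wpM2l ?mulr_ge0 // inv_rate_le.
  apply: ler_pM; rewrite ?invr_ge0 ?(ltW (rate0 _)) ?inv_rate_le //.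
    by rewrite ln_ge0 // lerDl weight_ge0.
  apply: le_trans (le_ln1Dx _) _; first exact: lt_le_trans (ltrN10 _) (weight_ge0 _ _).
  by rewrite /weight (b4 j.+1 _) ?ltnSn // init_weightE; case: ifP.
rewrite -[j.+1%:R]natr1 mulrDl mul1r.
move: (Phi _ _) (2 * _ / _) ((_ + _) * _ / _) S H P => *; lra.
Qed.

Lemma weight_gt0 t e : active e -> 0 < weight t e.
Proof.
move=> ae; elim: t => [|t IH]; rewrite /weight.
  by rewrite mod0n eqxx init_weightE ae invr_gt0 ltr0n.
case: ifP => _; first by rewrite init_weightE ae invr_gt0 ltr0n.
rewrite stored_weightS.
exact: (prod_update_gt0 kR1 (rate0 e) (active_rate ae) (weight_ge0 t e) (advantage_le2 t e)).
Qed.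

(** Odds of [1 / G] make the potential start at [ln (1 + G) / rate i], and it stays nonnegative. The
    drift after the last round is left out, as it belongs to the restart at the end of the block. *)
Lemma level_regret i b : (0 < i <= ell)%N -> active i -> (b %% 4 ^ i == 0)%N ->
  \sum_(b <= t < b + 4 ^ i) mix (ell - i).+1 t + \sum_(b <= t < (b + 4 ^ i).-1) drift i t
  <= \sum_(b <= t < b + 4 ^ i) a i t + 40 * k%:R * lam * 2 ^+ i
     + ln (1 + G%:R) * 2 ^+ i / lam.
Proof.
move=> il ai b4.
pose Xi (w : R) := ln (1 + w^-1) / rate i.
have Xi0 w : 0 < w -> 0 <= Xi w.
  by move=> w0; rewrite divr_ge0 ?(ltW (rate0 _)) // ln_ge0 // lerDl invr_ge0 ltW.
have step t : mix (ell - i).+1 t +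
    k%:R * `|mixing (stored_weight t.+1 i) - mixing (weight t i)|
    <= a i t + 40 * k%:R * rate i + Xi (weight t i) - Xi (stored_weight t.+1 i).
  have := prod_step_regret kR1 (rate0 i) (active_rate ai) (weight_ge0 t i)
    (advantage_le2 t i) (weight_gt0 t ai).
  rewrite -stored_weightS mix_level // /Xi /prob.
  rewrite [(ln _ - ln _) / _]mulrBl.
  have -> : mix (ell - i) t = a i t + advantage (weight t) t i.
    by rewrite /advantage addrC subrK.
  lra.
have nores d : (0 < d < 4 ^ i)%N -> weight (b + d) i = stored_weight (b + d) i.
  move=> /andP[d0 d4]; rewrite /weight -modnDml (eqP b4) add0n modn_small //.
  by rewrite gtn_eqF.
have partial d : (d < 4 ^ i)%N ->
    \sum_(b <= t < b + d) mix (ell - i).+1 t + \sum_(b <= t < b + d) drift i t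
    <= \sum_(b <= t < b + d) a i t + d%:R * (40 * k%:R * rate i)
       + Xi (weight b i) - Xi (weight (b + d) i).
  elim: d => [|d IH] d4; first by rewrite addn0 !big_geq // mul0r !addr0 addrK.
  rewrite addnS !big_nat_recr ?leq_addr //=.
  have := step (b + d)%N; rewrite -addnS -nores // -/(prob i _) -/(prob i _) addnS -/(drift i (b + d)).
  have {IH} := IH (ltnW d4); rewrite -[d.+1%:R]natr1 mulrDl mul1r.
  lra.
have [N EN] : exists N, (4 ^ i = N.+1)%N.
  by exists (4 ^ i).-1; rewrite prednK // expn_gt0.
have NR : N.+1%:R * rate i = lam * 2 ^+ i.
  rewrite -EN natrX /rate.
  have -> : 4%:R = 2 * 2 :> R by rewrite -natrM.
  by rewrite exprMn; field; rewrite expf_neq0.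
have wb : Xi (weight b i) = ln (1 + G%:R) * 2 ^+ i / lam.
  by rewrite /Xi /weight b4 init_weightE ai invrK /rate invf_div mulrA.
have {partial} := partial N; rewrite EN ltnSn => /(_ isT).
rewrite addnS /= ![\sum_(b <= t < (b + N).+1) _]big_nat_recr ?leq_addr //=.
(* The last round ends with the stored weight, before the restart replaces it. *)
have := step (b + N)%N.
have := Xi0 (stored_weight (b + N).+1 i).
rewrite wb => H1 H2 H3.
have sp : 0 < stored_weight (b + N).+1 i.
  rewrite stored_weightS.
  apply: (prod_update_gt0 kR1 (rate0 i) (active_rate ai) (weight_ge0 _ i) (advantage_le2 _ i)).
  exact: weight_gt0.
have {}H1 := H1 sp.
have E1 : 40 * k%:R * lam * 2 ^+ i = N%:R * (40 * k%:R * rate i) + 40 * k%:R * rate i.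
  by rewrite -mulrA -NR -[N.+1%:R]natr1; ring.
have H4 : 0 <= k%:R * `|mixing (stored_weight (b + N).+1 i) - mixing (weight (b + N) i)|.
  by rewrite mulr_ge0.
rewrite E1.
lra.
Qed.

Lemma drift_le e t : (t.+1 %% 4 ^ e != 0)%N -> drift e t <= 8 * k%:R * rate e.
Proof.
move=> t4; have kr0 : 0 <= 8 * k%:R * rate e by rewrite mulr_ge0 ?(ltW (rate0 _)) // mulr_ge0.
have [ae|ae] := boolP (active e); last first.
  by rewrite /drift !(prob_inactive _ ae) subrr normr0 mulr0.
have := mixing_drift_le kR1 (rate0 e) (active_rate ae) (weight_ge0 t e) (advantage_le2 t e).
by rewrite -stored_weightS /drift /prob /weight (negbTE t4).
Qed.

(** A coarser scale does not restart strictly inside a block of scale [i], so each of fewer than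
    [4 ^ i] drifts is at most [8 k lam / 2 ^ e]. The sum over [e > i] is geometric. *)
Lemma drift_large i b : (b %% 4 ^ i == 0)%N ->
  \sum_(i.+1 <= e < ell.+1) \sum_(b <= t < (b + 4 ^ i).-1) drift e t
  <= 8 * k%:R * lam * 2 ^+ i.
Proof.
move=> b4.
have key e : (i < e)%N -> \sum_(b <= t < (b + 4 ^ i).-1) drift e t
    <= 4 ^+ i * (8 * k%:R * rate e).
  move=> ie.
  apply: le_trans (_ : \sum_(b <= t < (b + 4 ^ i).-1) (8 * k%:R * rate e) <= _).
    rewrite big_nat_cond [leRHS]big_nat_cond; apply: ler_sum => t /andP[/andP[bt tb] _].
    apply: drift_le; apply/negP => te.
    have d4 : (4 ^ i %| 4 ^ e)%N by rewrite dvdn_exp2l // ltnW.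
    have : (4 ^ i %| t.+1 - b)%N.
      by apply: dvdn_sub; [exact: dvdn_trans d4 te | exact: b4].
    move=> /dvdn_leq; lia.
  rewrite sumr_const_nat -[leLHS]mulr_natl ler_wpM2r //.
    by rewrite mulr_ge0 ?(ltW (rate0 _)) // mulr_ge0.
  by rewrite -natrX ler_nat; lia.
have geo m : \sum_(i.+1 <= e < i.+1 + m) 4 ^+ i * (8 * k%:R * rate e)
    <= 8 * k%:R * lam * 2 ^+ i * (1 - 2 ^- m).
  elim: m => [|m IH]; first by rewrite addn0 big_geq // expr0 invr1 subrr mulr0.
  rewrite addnS big_nat_recr ?leq_addr //=; apply: le_trans (lerD IH (lexx _)) _.
  have -> : 4 ^+ i = 2 ^+ i * 2 ^+ i :> R by rewrite -exprMn; congr (_ ^+ _); ring.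
  rewrite /rate exprD !exprS le_eqVlt; apply/orP; left; apply/eqP.
  by field; rewrite !expf_neq0.
have [le_ie|lt_ie] := leqP ell i.
  by rewrite big_geq // !mulr_ge0 // (le_trans ler01).
apply: le_trans (_ : \sum_(i.+1 <= e < i.+1 + (ell - i)) 4 ^+ i * (8 * k%:R * rate e) <= _).
  rewrite addSn subnKC ?(ltnW lt_ie) // big_nat_cond [leRHS]big_nat_cond.
  by apply: ler_sum => e /andP[/andP[ie _] _]; exact: key.
apply: le_trans (geo _) _; rewrite ler_piMr // ?lerBlDr ?lerDl ?invr_ge0 ?exprn_ge0 //.
by rewrite !mulr_ge0 // (le_trans ler01).
Qed.

End Dynamics.
End Hierarchy.

Arguments stored_weight : simpl never.

(** * Expected costs *)

Section Noise.
Variables (R : realType) (n k G N : nat) (pos : nat -> nat) (r : nat -> 'I_n).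
Hypotheses (G0 : (0 < G)%N) (posN : forall j : nat, (j < n)%N -> (pos j < N)%N).
Hypothesis pos_inj : forall i j : nat, (i < n)%N -> (j < n)%N -> pos i = pos j -> i = j.
Implicit Types (w : nat -> nat) (i j : 'I_n).

Let GR0 : 0 < G%:R :> R. Proof. by rewrite ltr0n. Qed.

(** [pos] abstracts from the machine steps at which the samples are drawn; it only has to be
    injective with values below [N]. *)
Definition noise w : nat -> nat := fun i : nat => if (i < n)%N then w (pos i) else 0%N.

Lemma noiseE w i : noise w i = w (pos i). Proof. by rewrite /noise ltn_ord. Qed.

Lemma noise_lt w : (forall j : nat, (w j < G)%N) -> forall i : nat, (noise w i < G)%N.
Proof. by move=> wG i; rewrite /noise; case: ifP. Qed.

Lemma pos_eq i j : (pos i == pos j) = (i == j).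
Proof.
apply/eqP/eqP => [ij|-> //].
exact/val_inj/(pos_inj (ltn_ord i) (ltn_ord j)).
Qed.

Lemma noise_fupd w i g : noise (fupd w (pos i) g) = fupd (noise w) i g.
Proof.
apply/funext => x; rewrite /noise /fupd; case: (ltnP x n) => [xn|nx]; last first.
  by rewrite ifN //; apply/eqP => e; rewrite e leqNgt ltn_ord in nx.
by rewrite (pos_eq (Ordinal xn) i).
Qed.

Lemma noise_swap w i j (x : 'I_n) : noise (fswap w (pos i) (pos j)) x = noise w (tperm i j x).
Proof.
rewrite !noiseE /fswap !pos_eq.
by case: tpermP => [->|->|/eqP/negbTE-> /eqP/negbTE->]; rewrite ?eqxx //; case: eqP => [->|].
Qed.

Lemma tie_prob i j : i != j ->
  EE G N (fun w => (noise w i == noise w j)%:R) <= G%:R^-1 :> R.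
Proof.
move=> ij; rewrite (EE_resample G0 (pos i)) ?posN //.
rewrite -[leRHS](EE_cst G0 N); apply: EE_le => // w _.
rewrite -[leRHS]mulr1 ler_pM2l ?invr_gt0 //.
under eq_bigr => g _ do rewrite noise_fupd /fupd eqxx [_ == nat_of_ord i]eq_sym -[nat_of_ord i == _]/(i == j) (negbTE ij).
rewrite -natr_sum lern1.
have [lt|ge] := ltnP (noise w j) G.
  by rewrite (bigD1 (Ordinal lt)) //= eqxx big1 // => g /eqP ng; case: eqP => // e; case: ng; apply: val_inj.
by rewrite big1 // => g _; case: eqP => // e; rewrite -e leqNgt ltn_ord in ge.
Qed.

(** Exactly [c] pages of [U] have low rank, and by exchanging samples all are equally likely to.
    Breaking ties by page number spoils this symmetry, so the event is enlarged to one on the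
    symmetric ranks [weak]; the two differ only if there is a tie, which accounts for [n / G]. *)
Lemma low_rank_prob (U : {set 'I_n}) i c : i \in U -> (c <= #|U|)%N ->
  EE G N (fun w => (#|U| - c <= rank_in U (tiebreak n (noise w)) i)%N%:R)
  <= c%:R / #|U|%:R + n%:R / G%:R :> R.
Proof.
move=> iU cU; set u := #|U|.
have u0 : (0 < u)%N by apply/card_gt0P; exists i.
pose weak w j := (\sum_(h in U | h != j) (noise w j <= noise w h))%N.
pose bad w j := (u - c <= rank_in U (tiebreak n (noise w)) j)%N.
pose bad' w j := (u - c <= weak w j)%N.
have le_weak w j : (rank_in U (tiebreak n (noise w)) j <= weak w j)%N.
  rewrite /rank_in /weak big_mkcondr; apply: leq_sum => h hU.
  case: eqP => [->|_]; first by rewrite ltnn.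
  case: (leqP (noise w j)) => [_|lt]; first by case: (_ < _)%N.
  by rewrite ltnNge (ltnW (tiebreak_ltn lt)).
have bad_sum w : (\sum_(j in U) bad w j = c)%N.
  have := card_rank_in_lt (noise w) (leq_subr c u).
  rewrite -sum1_card [LHS](eq_bigl _ _ (finset.in_set _)) big_mkcondr /= => H.
  have : (\sum_(j in U) (bad w j + (rank_in U (tiebreak n (noise w)) j < u - c)) = u)%N.
    rewrite -[RHS]sum1_card; apply: eq_bigr => j _; rewrite /bad.
    by case: leqP.
  rewrite big_split /= (_ : (\sum_(j in U) (_ < _) = u - c)%N); first lia.
  by rewrite -[RHS]H; apply: eq_bigr => j _; case: ifP.
have swapE w j : j \in U -> bad' (fswap w (pos i) (pos j)) i = bad' w j.
  move=> jU; rewrite /bad' /weak; congr (_ <= _)%N.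
  rewrite (reindex_inj (@perm_inj _ (tperm i j))) /=; apply: eq_big => [h|h _].
    congr (_ && _).
      by case: tpermP => [->|->|//]; rewrite ?iU ?jU.
    by rewrite -[in RHS](inj_eq (@perm_inj _ (tperm i j))) tpermR.
  by rewrite !noise_swap tpermK tpermL.
have tied w j : j \in U -> (bad' w j <= bad w j + \sum_(h | h != j) (noise w h == noise w j))%N.
  move=> jU; have [s0|s0] := posnP (\sum_(h | h != j) (noise w h == noise w j))%N; last first.
    by apply: leq_trans (leq_trans s0 (leq_addl _ _)); case: (bad' w j).
  rewrite s0 addn0 /bad' /bad; suff : (weak w j <= rank_in U (tiebreak n (noise w)) j)%N.
    by move=> h; case: (boolP (u - c <= weak w j)%N) => // /leq_trans/(_ h) ->.
  rewrite /weak /rank_in [leqRHS](bigID (fun h => h != j)) /=.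
  apply: leq_trans (leq_addr _ _); apply: leq_sum => h /andP[hU hj].
  case: (boolP (noise w j <= noise w h)%N) => // le_jh; rewrite lt0b; apply: tiebreak_ltn.
  rewrite ltn_neqAle le_jh andbT eq_sym; apply/eqP => e.
  by move/eqP: s0; rewrite (bigD1 h) //= e eqxx.
have E1 j : j \in U -> EE G N (fun w => (bad w i)%:R) <= EE G N (fun w => (bad' w j)%:R) :> R.
  move=> jU; have [pi pj] := (posN (ltn_ord i), posN (ltn_ord j)).
  rewrite (EE_ext _ _ (fun w => congr1 (fun b : bool => b%:R) (esym (swapE w j jU)))).
  rewrite (EE_swap G0 (F := fun w => (bad' w i)%:R)) //; apply: EE_le => // w _.
  rewrite ler_nat /bad /bad'.
  by case: (boolP (_ <= rank_in _ _ _)%N) => // /leq_trans/(_ (le_weak w i)) ->.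
have E2 j : j \in U -> EE G N (fun w => (bad' w j)%:R)
    <= EE G N (fun w => (bad w j)%:R) + n%:R / G%:R :> R.
  move=> jU; apply: le_trans (_ : EE G N (fun w => (bad w j)%:R +
     \sum_(h | h != j) (noise w h == noise w j)%:R) <= _).
    by apply: EE_le => // w _; rewrite -natr_sum -natrD ler_nat tied.
  rewrite EED lerD2l EE_sum.
  apply: le_trans (_ : \sum_(h : 'I_n | h != j) G%:R^-1 <= _).
    by apply: ler_sum => h hj; exact: tie_prob.
  rewrite sumr_const -[leLHS]mulr_natl ler_pM2r ?invr_gt0 // ler_nat.
  by rewrite -[leqRHS]card_ord; exact: max_card.
have uR : 0 < u%:R :> R by rewrite ltr0n.
rewrite -(ler_pM2l uR) mulrDr mulrCA divff ?gt_eqF // mulr1.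
apply: le_trans (_ : \sum_(j in U) (EE G N (fun w => (bad w j)%:R) + n%:R / G%:R) <= _).
  have -> : u%:R * EE G N (fun w => (bad w i)%:R) = \sum_(j in U) EE G N (fun w => (bad w i)%:R) :> R.
    by rewrite sumr_const mulr_natl.
  apply: ler_sum => j jU.
  exact: le_trans (E1 j jU) (E2 j jU).
rewrite big_split /= sumr_const -[_ *+ _]mulr_natl lerD2r -EE_sum.
rewrite -[leRHS](EE_cst G0 N); apply: EE_le => // w _.
by rewrite -natr_sum bad_sum.
Qed.

Lemma entering_prob e t Q : (0 < e)%N -> G = (Q * 2 ^ e)%N ->
  EE G N (fun w => ((r t \in expert_cache n k G (noise w) e (counts k r e t.+1))
     && (r t \notin expert_cache n k G (noise w) e (before k r e t)))%:R)
  <= (2 ^+ e)^-1 :> R.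
Proof.
move=> e0 GQ; rewrite (EE_resample G0 (pos (r t))) ?posN //.
rewrite -[leRHS](EE_cst G0 N); apply: EE_le => // w _.
under eq_bigr => g _ do rewrite noise_fupd.
rewrite -natr_sum mulrC ler_pdivrMr // GQ natrM natrX mulrC mulfK ?expf_neq0 // ler_nat -GQ.
exact: leader_entering.
Qed.

End Noise.

(** * Expected misses of marking *)

Section MarkingPotential.
Variables (R : realType) (n k : nat) (r : nat -> 'I_n).
Hypotheses (k0 : (0 < k)%N) (kn : (k <= n)%N).

Let new m := #|marked n m :\: stale n m|.
Let old m := #|marked n m :&: stale n m|.

(** Of the [k - old p] unmarked pages of the previous phase, [new p] have been evicted, each being
    equally likely. *)
Definition miss_prob t : R := let p := before k r 0 t in
  if r t \in marked n p then 0
  else if r t \in stale n p then (new p)%:R / (k - old p)%:R else 1.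

(** Expected misses of a phase with [c] clean requests and [s] returning pages in the worst order,
    all clean requests first. *)
Let psi (c s : nat) : R := c%:R * (1 + \sum_(s' < s) ((k - s')%:R)^-1).

Lemma harmonic_tail s : (s <= k)%N ->
  \sum_(s' < s) ((k - s')%:R)^-1 + harmonic_sum R (k - s) = harmonic_sum R k.
Proof.
elim: s => [|s IH] sk; first by rewrite big_ord0 add0r subn0.
rewrite -(IH (ltnW sk)) big_ord_recr /= -addrA; congr (_ + _).
rewrite /harmonic_sum -[in RHS](subnSK sk) [in RHS]big_nat_recr //= addrC.
by rewrite subnSK.
Qed.

(** For [c > 0] one has [s < k], so the sum in [psi] stops before the last term 1/1 of the harmonic
    sum, which covers the leading 1. *)
Lemma psi_harmonic c s : (c + s <= k)%N -> psi c s <= c%:R * harmonic_sum R k.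
Proof.
case: c => [|c] cs; first by rewrite /psi !mul0r.
rewrite /psi ler_wpM2l // -(@harmonic_tail s); last by lia.
rewrite addrC lerD2l /harmonic_sum big_ltn; last by lia.
by rewrite invr1 lerDl sumr_ge0 // => i _; rewrite invr_ge0.
Qed.

Lemma miss_prob_sum T :
  \sum_(0 <= t < T) miss_prob t
  <= harmonic_sum R k * (\sum_(0 <= t < T) clean k r t)%N%:R.
Proof.
have H0 : 0 <= harmonic_sum R k by apply: sumr_ge0 => i _; rewrite invr_ge0.
have cs m : marking_inv n k m -> (new m + old m <= k)%N.
  by case=> Mk _ _; rewrite addnC /old /new cardsID.
have inv := marking_invP r k0.
(* Closed phases are charged [harmonic_sum R k] per clean request and the open phase its [psi],
   which [psi_harmonic] converts when the phase closes. *)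
suff [H1 H2] : (new (counts k r 0 T) <= \sum_(0 <= t < T) clean k r t)%N /\
  \sum_(0 <= t < T) miss_prob t <= harmonic_sum R k *
     ((\sum_(0 <= t < T) clean k r t)%N%:R - (new (counts k r 0 T))%:R)
     + psi (new (counts k r 0 T)) (old (counts k r 0 T)).
  apply: le_trans H2 _; have := psi_harmonic (cs _ (inv T)).
  rewrite mulrBr [_%:R * harmonic_sum _ _]mulrC; lra.
elim: T => [|t [IH1 IH2]].
  rewrite !big_geq //; have -> : new (counts k r 0 0) = 0%N.
    apply/eqP; rewrite cards_eq0; apply/eqP/setP => i; by rewrite !inE.
  by rewrite subrr mulr0 /psi mul0r addr0.
set m := counts k r 0 t in IH1 IH2 *; set p := before k r 0 t.
have [invp alt lt_k] := marking_before (inv t).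
have [IH1' IH2'] : (new p <= \sum_(0 <= t < t) clean k r t)%N /\
  \sum_(0 <= t < t) miss_prob t <= harmonic_sum R k *
     ((\sum_(0 <= t < t) clean k r t)%N%:R - (new p)%:R) + psi (new p) (old p).
  case: alt => [[_ [M0 _]]|e]; last by rewrite /p e.
  have -> : new p = 0%N by rewrite /new M0 finset.set0D cards0.
  split=> //; rewrite /psi mul0r addr0 subr0; apply: le_trans IH2 _.
  have := psi_harmonic (cs _ (inv t)).
  rewrite mulrBr [_%:R * harmonic_sum _ _]mulrC; lra.
have newS : new (counts k r 0 t.+1) = (new p + clean k r t)%N.
  rewrite /new marked_counts stale_counts -/p /clean -/p.
  have [rS|rS] := boolP (r t \in stale n p).
    rewrite andbF addn0; apply: eq_card => i; rewrite !inE.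
    by case: eqP => [->|] //; move: rS; rewrite inE => ->.
  rewrite andbT addnC; have [rM|rM] := boolP (r t \in marked n p).
    by apply: eq_card => i; rewrite !inE; case: eqP => [->|] //; move: rM; rewrite inE => ->.
  rewrite (_ : _ :\: _ = r t |: (marked n p :\: stale n p)).
    by rewrite cardsU1 finset.in_setD (negbTE rM) andbF.
  by apply/setP => i; rewrite !finset.in_setD !finset.in_setU1 finset.in_setD; case: eqP => [->|//]; rewrite rS.
have oldS : old (counts k r 0 t.+1) = (old p + ((r t \notin marked n p) && (r t \in stale n p)))%N.
  rewrite /old marked_counts stale_counts -/p.
  have [rS|rS] := boolP (r t \in stale n p); last first.
    rewrite andbF addn0; apply: eq_card => i; rewrite !inE.
    by case: eqP => [->|] //; move: rS; rewrite inE => /negbTE ->; rewrite !andbF.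
  rewrite andbT addnC; have [rM|rM] := boolP (r t \in marked n p).
    by apply: eq_card => i; rewrite !inE; case: eqP => [->|] //; move: rM; rewrite inE => ->.
  rewrite (_ : _ :&: _ = r t |: (marked n p :&: stale n p)).
    by rewrite cardsU1 finset.in_setI (negbTE rM).
  by apply/setP => i; rewrite !finset.in_setI !finset.in_setU1 finset.in_setI; case: eqP => [->|//]; rewrite rS.
rewrite !big_nat_recr //= newS oldS; split; first by rewrite leq_add2r.
move: (\sum_(0 <= _ < _) _) (\sum_(0 <= _ < _) _)%N IH2' => A C IH2'.
rewrite /clean -/p /miss_prob -/p.
have [rM|rM] := boolP (r t \in marked n p); first by rewrite /= !addn0 addr0.
have [rS|rS] := boolP (r t \in stale n p) => /=.
  have psiS c s : psi c s.+1 = psi c s + c%:R / (k - s)%:R.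
    by rewrite /psi big_ord_recr /= addrA mulrDr.
  rewrite !addn0 [(old p + 1)%N]addn1 psiS; lra.
have psiS c s : psi c s + 1 <= psi c.+1 s.
  have : 0 <= \sum_(s' < s) ((k - s')%:R)^-1 :> R by apply: sumr_ge0 => i _; rewrite invr_ge0.
  by rewrite /psi -[c.+1%:R]natr1 mulrDl mul1r; lra.
have := psiS (new p) (old p).
rewrite addn0 !addn1 -[C.+1%:R]natr1 -[(new p).+1%:R]natr1; lra.
Qed.

End MarkingPotential.

Section CountBelow.
Variable R : realType.

Definition below (G : nat) (x : R) : nat := (\sum_(g < G) ((g.+1)%:R < x)%R)%N.

Lemma below_leG G x : (below G x <= G)%N.
Proof.
rewrite -[leqRHS]muln1 -[G in leqRHS]card_ord -sum_nat_const.
by apply: leq_sum => g _; case: (_ < _).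
Qed.

Lemma below_le G x : 0 <= x -> (below G x)%:R <= x.
Proof.
move=> x0; rewrite /below; elim: G => [|G IH]; first by rewrite big_ord0.
rewrite big_ord_recr /=; case: (ltP G.+1%:R x) => [lt|_]; last by rewrite addn0.
by apply: le_trans (ltW lt); rewrite ler_nat addn1 ltnS; exact: below_leG.
Qed.

Lemma below_ge G x : x <= G.+1%:R -> x - 1 <= (below G x)%:R.
Proof.
rewrite /below; elim: G => [|G IH] xG; first by rewrite big_ord0 subr_le0.
rewrite big_ord_recr /=; case: (ltP G.+1%:R x) => [lt|le]; last by rewrite addn0 IH.
rewrite (eq_bigr (fun=> 1%N)) => [|g _]; last first.
  by rewrite (lt_trans _ lt) // ltr_nat ltnS ltn_ord.
rewrite sum_nat_const card_ord muln1 addn1 lerBlDr; apply: le_trans xG _.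
by rewrite natr1.
Qed.

Lemma below_between G (x y : R) : 0 <= y -> x <= G.+1%:R -> x <= y ->
  (\sum_(g < G) (((g.+1)%:R < x :> R)%R != ((g.+1)%:R < y :> R)%R))%N%:R <= y - x + 1.
Proof.
move=> y0 xG xy.
have e : (below G x + \sum_(g < G) (((g.+1)%:R < x :> R)%R != ((g.+1)%:R < y :> R)%R) = below G y)%N.
  rewrite /below -big_split; apply: eq_bigr => g _ /=.
  by case: (ltP _ x) => [lt|le]; [rewrite (lt_le_trans lt xy) | case: (_ < y)].
have := below_le G y0; have := below_ge xG; rewrite -e natrD; lra.
Qed.

End CountBelow.

(** * Coins, selection and the expected cost on an interval *)

Section ExpectedExperts.
Variables (R : realType) (n k ell N : nat) (pos : nat -> nat) (r : nat -> 'I_n).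
Let G := (2 ^ (4 * ell))%N.
Hypotheses (k0 : (0 < k)%N) (kn : (k <= n)%N).
Hypothesis posN : forall j : nat, (j < n + ell.+1)%N -> (pos j < N)%N.
Hypothesis pos_inj : forall i j : nat, (i < n + ell.+1)%N -> (j < n + ell.+1)%N -> pos i = pos j -> i = j.
Implicit Types (w : nat -> nat).

Let G0 : (0 < G)%N. Proof. by rewrite expn_gt0. Qed.
Let GR0 : 0 < G%:R :> R. Proof. by rewrite ltr0n. Qed.
Let posN' (j : nat) : (j < n)%N -> (pos j < N)%N.
Proof. by move=> jn; apply: posN; rewrite ltn_addr. Qed.
Let pos_inj' (i j : nat) : (i < n)%N -> (j < n)%N -> pos i = pos j -> i = j.
Proof. by move=> jn kn'; apply: pos_inj; rewrite ltn_addr. Qed.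

Definition acost w (e t : nat) : R := (expert_cost k G r (noise n pos w) e t)%:R.

Lemma acost02 w e t : 0 <= acost w e t <= 2.
Proof. by rewrite /acost ler0n ler_nat expert_cost_le2. Qed.

Lemma marking_expected t :
  EE G N (fun w => acost w 0 t) <= miss_prob R k r t + n%:R / G%:R.
Proof.
set p := before k r 0 t; set U := stale n p :\: marked n p.
have [[Mp Sp _] _ _] := marking_before (marking_invP r k0 t); rewrite -/p in Mp Sp.
have nG : 0 <= n%:R / G%:R :> R by rewrite divr_ge0.
have cost_le w : (forall j : nat, (w j < G)%N) -> acost w 0 t
   <= ((r t \notin marked n p) && ((r t \in stale n p) ==>
      (k - #|marked n p| <= rank_in U (tiebreak n (noise n pos w)) (r t))%N))%:R.
  move=> wG; rewrite ler_nat; apply: marking_cost => //.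
  exact: noise_lt.
rewrite /miss_prob -/p; have [rM|rM] := boolP (r t \in marked n p).
  rewrite add0r; apply: le_trans nG; rewrite -[leRHS](EE_cst G0 N).
  by apply: EE_le => // w /cost_le; rewrite rM.
have [rS|rS] := boolP (r t \in stale n p); last first.
  apply: le_trans (_ : EE G N (fun=> 1) <= _); last by rewrite EE_cst // lerDl.
  by apply: EE_le => // w /cost_le; rewrite rM (negbTE rS).
have Sk : #|stale n p| = k.
  by case: Sp => // S0; rewrite S0 inE in rS.
have rU : r t \in U by rewrite finset.in_setD rM.
have cU : #|U| = (k - #|marked n p :&: stale n p|)%N.
  by rewrite -Sk -(cardsID (marked n p) (stale n p)) finset.setIC addKn.
have cM := cardsID (stale n p) (marked n p).
have sk : (#|marked n p :&: stale n p| <= k)%N by rewrite -Sk; apply: subset_leq_card; exact: finset.subsetIr.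
have kM : (k - #|marked n p| = #|U| - #|marked n p :\: stale n p|)%N by lia.
rewrite -cU; apply: le_trans (low_rank_prob R G0 posN' pos_inj' rU _); last by lia.
apply: EE_le => // w /cost_le; rewrite rM rS /= kM.
by [].
Qed.

(** Misses after the request are bounded for every noise by [leader_loss]. Only the replacements use
    randomness: [4 ^ i] rounds with probability at most [2 ^- i] each. *)
Lemma leader_expected b i (C : {set 'I_n}) : (0 < i <= ell)%N -> (b %% 4 ^ i == 0)%N -> #|C| = k ->
  EE G N (fun w => \sum_(b <= t < b + 4 ^ i) acost w i t)
  <= (\sum_(b <= t < b + 4 ^ i) loss (r t) C)%N%:R + 2 * k%:R * 2 ^+ i + 2 ^+ i.
Proof.
move=> /andP[i0 il] /eqP b4 Ck.
pose post w t := r t \in expert_cache n k G (noise n pos w) i (counts k r i t.+1).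
pose pre w t := r t \in expert_cache n k G (noise n pos w) i (before k r i t).
have lossE : (\sum_(b <= t < b + 4 ^ i) loss (r t) C = 2 * \sum_(b <= t < b + 4 ^ i) (r t \notin C))%N.
  by rewrite big_distrr; apply: eq_bigr => t _; rewrite /loss; case: (_ \in _).
have costE w t : acost w i t = 2 * (~~ post w t)%:R + (post w t && ~~ pre w t)%:R.
  rewrite /acost /expert_cost -/(post w t) -/(pre w t); case: (post w t); rewrite ?mulr0 ?mulr1 ?add0r ?addr0 //.
rewrite lossE.
apply: le_trans (_ : EE G N (fun w => (2 * (\sum_(b <= t < b + 4 ^ i) (r t \notin C) + k * 2 ^ i)%N%:R : R)
   + \sum_(b <= t < b + 4 ^ i) (post w t && ~~ pre w t)%:R) <= _).
  apply: EE_le => // w wG.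
  rewrite (eq_bigr (fun t => 2 * (~~ post w t)%:R + (post w t && ~~ pre w t)%:R)) => [|t _]; last exact: costE.
  rewrite big_split /= lerD2r -mulr_sumr ler_wpM2l // -natr_sum ler_nat.
  by apply: leader_loss => //; apply: noise_lt.
rewrite EED EE_cst // EE_sum natrD !natrM natrX mulrDr !mulrA lerD2l.
apply: le_trans (_ : \sum_(b <= t < b + 4 ^ i) (2 ^+ i)^-1 <= _).
  apply: ler_sum => t _.
  have GQ : G = (2 ^ (4 * ell - i) * 2 ^ i)%N by rewrite -expnD subnK //; lia.
  exact: (@entering_prob R n k G N pos r G0 posN' pos_inj' i t _ i0 GQ).
rewrite sumr_const_nat addKn -[leLHS]mulr_natl natrX.
have -> : 4%:R = 2 * 2 :> R by rewrite -natrM.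
by rewrite exprMn mulfK // expf_neq0.
Qed.

Variable lam : R.
Hypothesis lam1 : 1 <= lam.

Local Notation prob w := (prob ell k G lam (acost w)).
Local Notation mix w := (mix ell k G lam (acost w)).
Local Notation weight w := (weight ell k G lam (acost w)).
Local Notation drift w := (drift ell k G lam (acost w)).

(** The test [w + 1 < G p], cleared of the denominator of [p]. The same sample is used in all
    rounds, so the outcome changes only when [G p] crosses it. *)
Definition coin w e t : bool :=
  (w (pos (n + e)%N) + 1)%:R * (1 + weight w t e) < G%:R * weight w t e.

(** The finest scale whose coin accepts wins, as in [mixture] the finest scale is mixed in last. *)
Fixpoint sel w t l : nat :=
  if l is l'.+1 then if coin w (ell - l') t then (ell - l')%N else sel w t l' else 0%N.

Definition alg_set w t : {set 'I_n} :=
  expert_cache n k G (noise n pos w) (sel w t ell) (counts k r (sel w t ell) t.+1).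

Lemma coinE w e t : coin w e t = ((w (pos (n + e)%N)).+1%:R < G%:R * prob w e t).
Proof.
rewrite /coin addn1 probE /mixing mulrA ltr_pdivlMr //.
by rewrite ltr_wpDr // weight_ge0 //; exact: acost02.
Qed.

Lemma coin_reset w e t : (t %% 4 ^ e == 0)%N -> coin w e t = false.
Proof.
move=> te; rewrite /coin weight_reset // init_weightE; apply/negbTE; rewrite -leNgt.
case: ifP => _; last by rewrite mulr0 addr0 mulr1.
rewrite divff ?gt_eqF //; apply: le_trans (_ : 1 * 1 <= _); first by rewrite mulr1.
by apply: ler_pM => //; [rewrite ler1n addn1 | rewrite lerDl invr_ge0].
Qed.

Lemma sel_range w t l : (l <= ell)%N -> sel w t l = 0%N \/
  (0 < sel w t l <= ell)%N /\ coin w (sel w t l) t.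
Proof.
elim: l => [|l IH] ll /=; first by left.
case: ifP => // c; last exact: IH (ltnW ll).
by right; split=> //; rewrite leq_subr subn_gt0 ll.
Qed.

Lemma alg_set_card w t : #|alg_set w t| = k.
Proof. exact: card_expert_cache. Qed.

Lemma dist_le_k (C C' : {set 'I_n}) : #|C| = k -> (dist C C' <= k)%N.
Proof. by move=> <-; apply: subset_leq_card; exact: finset.subsetDl. Qed.

Definition flip w e t : bool := coin w e t != coin w e t.+1.

Lemma round_loss w t : ((loss (r t) (alg_set w t))%:R : R) <= acost w (sel w t ell) t.
Proof. by rewrite ler_nat; apply: leq_trans (@expert_move n k G r (noise n pos w) (sel w t ell) t); exact: leq_addr. Qed.

(** Without a flip the same expert is followed in both rounds and its movement is part of its cost.
    Otherwise the replacement of up to [k] pages is charged to one flipped coin. *)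
Lemma round_cost w t : (forall j : nat, (w j < G)%N) ->
  ((loss (r t.+1) (alg_set w t.+1) + dist (alg_set w t.+1) (alg_set w t))%N%:R : R)
  <= acost w (sel w t.+1 ell) t.+1 + \sum_(1 <= e < ell.+1) k%:R * (flip w e t)%:R.
Proof.
move=> wG.
have S0 : 0 <= \sum_(1 <= e < ell.+1) k%:R * (flip w e t)%:R :> R.
  by apply: sumr_ge0 => e _; rewrite mulr_ge0.
have [/hasP[e]|/hasPn none] := boolP (has (fun e => flip w e t) (index_iota 1 ell.+1)).
  rewrite mem_index_iota => el fe; rewrite natrD lerD ?round_loss //.
  rewrite (bigD1_seq e) ?mem_index_iota ?iota_uniq //= fe mulr1.
  apply: le_trans (_ : k%:R <= _); first by rewrite ler_nat dist_le_k // alg_set_card.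
  by rewrite lerDl; apply: sumr_ge0 => e' _; rewrite mulr_ge0.
have same l : (l <= ell)%N -> sel w t.+1 l = sel w t l.
  elim: l => [|l IH] ll //=; rewrite IH ?(ltnW ll) //.
  have := none (ell - l)%N; rewrite mem_index_iota => /(_ _).
  by rewrite /flip negbK => /(_ ltac:(lia))/eqP ->.
apply: le_trans (_ : acost w (sel w t.+1 ell) t.+1 <= _); last by rewrite lerDl.
rewrite ler_nat; apply: leq_trans (@expert_move n k G r (noise n pos w) (sel w t.+1 ell) t.+1).
rewrite /alg_set -(same ell) // leq_add2l.
(* A restart between the rounds must not matter: marking keeps its cache when a phase closes, and a
   restarting leader has a rejecting coin and is not selected. *)
suff -> : expert_cache n k G (noise n pos w) (sel w t.+1 ell) (before k r (sel w t.+1 ell) t.+1)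
  = expert_cache n k G (noise n pos w) (sel w t.+1 ell) (counts k r (sel w t.+1 ell) t.+1) by [].
have [->|[/andP[s0 sl] cs]] := sel_range w t.+1 (leqnn ell).
  by apply: expert_cache_before => //; apply: noise_lt.
congr (expert_cache _ _ _ _ _ _); rewrite /before /prepare gtn_eqF //.
by case: ifP => // /(coin_reset w); rewrite cs.
Qed.

Lemma noise_coin w e g : (0 < e <= ell)%N -> noise n pos (fupd w (pos (n + e)) g) = noise n pos w.
Proof.
move=> el; apply/funext => i; rewrite /noise /fupd; case: ifP => // ni.
by case: eqP => // /pos_inj h; have := h ltac:(lia) ltac:(lia); lia.
Qed.

Lemma acost_coin w e g : (0 < e <= ell)%N -> acost (fupd w (pos (n + e)) g) = acost w.
Proof. by move=> el; apply/funext => e'; apply/funext => t; rewrite /acost noise_coin. Qed.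

Lemma coin_other w e e' g t : (0 < e <= ell)%N -> (0 < e' <= ell)%N -> e != e' ->
  coin (fupd w (pos (n + e)) g) e' t = coin w e' t.
Proof.
move=> el el' ee'; rewrite !coinE acost_coin // /fupd; case: eqP => // /pos_inj h.
by have := h ltac:(lia) ltac:(lia); lia.
Qed.

(** Weights do not depend on coins, so the coin of scale [e] can be averaged alone. It flips for the
    integers separating [G p] from [G p'], at most [G |p' - p| + 1] many. *)
Lemma flip_prob e t : (0 < e <= ell)%N ->
  EE G N (fun w => k%:R * (flip w e t)%:R) <= EE G N (fun w => drift w e t) + k%:R / G%:R.
Proof.
move=> el; rewrite (EE_resample G0 (pos (n + e))); last by apply: posN; lia.
rewrite -[X in _ + X](EE_cst G0 N) -EED; apply: EE_le => // w _.
rewrite -mulr_sumr mulrCA -mulrDr ler_wpM2l // -natr_sum.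
rewrite mulrC ler_pdivrMr // mulrDl mulVf ?gt_eqF //.
under eq_bigr => g _ do rewrite /flip !coinE acost_coin // /fupd eqxx.
have P0 t' : 0 <= G%:R * prob w e t' by rewrite mulr_ge0 // prob_ge0 //; exact: acost02.
have P1 t' : G%:R * prob w e t' <= G.+1%:R.
  apply: le_trans (_ : G%:R * 1 <= _); last by rewrite mulr1 ler_nat.
  by rewrite ler_wpM2l // prob_le1 //; exact: acost02.
have E : `|prob w e t.+1 - prob w e t| * G%:R = `|G%:R * prob w e t.+1 - G%:R * prob w e t|.
  by rewrite -mulrBr normrM mulrC [`|G%:R|]ger0_norm.
rewrite E; have [le|lt] := leP (G%:R * prob w e t) (G%:R * prob w e t.+1).
  by rewrite ger0_norm ?subr_ge0 // below_between.
rewrite ler0_norm ?subr_le0 ?(ltW lt) // opprB.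
under eq_bigr => g _ do rewrite eq_sym.
by apply: below_between => //; exact: ltW.
Qed.

Definition coin_free (F : (nat -> nat) -> R) :=
  forall w e g, (0 < e <= ell)%N -> F (fupd w (pos (n + e)%N) g) = F w.

Lemma sel_other w e g t l : (0 < e <= ell)%N -> (l <= ell - e)%N ->
  sel (fupd w (pos (n + e)) g) t l = sel w t l.
Proof.
move=> el; elim: l => [|l IH] ll //=; rewrite IH ?(ltnW ll) //.
by rewrite coin_other //; lia.
Qed.

(** [F] stands for the probability, given the noise, that all finer coins reject; the induction
    averages over one coin and goes on with [F (1 - p)]. A coin accepts with probability between
    [p - 1 / G] and [p], whence the error [2 / G] per level. *)
Lemma sel_expected t l F : (l <= ell)%N -> coin_free F -> (forall w, 0 <= F w <= 1) ->
  EE G N (fun w => F w * acost w (sel w t l) t)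
  <= EE G N (fun w => F w * mix w l t) + l%:R * (2 / G%:R).
Proof.
elim: l F => [|l IH] F ll cF F01 /=; first by rewrite mul0r addr0.
set e := (ell - l)%N; have el : (0 < e <= ell)%N by rewrite /e; lia.
have a02 := acost02.
pose p w := prob w e t.
have p01 w : 0 <= p w <= 1 by rewrite prob_ge0 ?prob_le1 //; exact: a02.
have cp w e' g : (0 < e' <= ell)%N -> p (fupd w (pos (n + e')) g) = p w.
  by move=> el'; rewrite /p acost_coin.
have step1 : EE G N (fun w => F w * acost w (if coin w e t then e else sel w t l) t)
  <= EE G N (fun w => F w * p w * acost w e t + F w * (1 - p w) * acost w (sel w t l) t)
     + 2 / G%:R.
  rewrite (EE_resample G0 (pos (n + e))); last by apply: posN; lia.
  rewrite -[X in _ + X](EE_cst G0 N) -EED; apply: EE_le => // w _.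
  pose h g : R := ((g.+1)%:R < G%:R * p w)%R%:R.
  rewrite (eq_bigr (fun g : 'I_G => F w * (acost w (sel w t l) t + h g * (acost w e t - acost w (sel w t l) t)))) => [|g _]; last first.
    rewrite cF // acost_coin // sel_other ?leqnn //; last by rewrite /e; lia.
    rewrite coinE acost_coin // {1}/fupd eqxx -/(p w) /h.
    by case: ifP => _; rewrite ?mul1r ?mul0r ?addr0 // addrC subrK.
  rewrite -mulr_sumr big_split /= sumr_const card_ord -mulr_suml -natr_sum -/(below _ _).
  have pG0 : 0 <= G%:R * p w by rewrite mulr_ge0 //; case/andP: (p01 w).
  have pG1 : G%:R * p w <= G.+1%:R.
    apply: le_trans (_ : G%:R * 1 <= _); last by rewrite mulr1 ler_nat.
    by rewrite ler_wpM2l //; case/andP: (p01 w).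
  have := below_le G pG0; have := below_ge pG1.
  have -> : (below G (G%:R * p w))%:R = G%:R * ((below G (G%:R * p w))%:R / G%:R) :> R.
    by rewrite [RHS]mulrCA mulfV ?mulr1 // gt_eqF.
  move: (_ / G%:R) => q; rewrite ler_pM2l // => h1 h2.
  have -> : G%:R^-1 * (F w * (acost w (sel w t l) t *+ G + G%:R * q * (acost w e t - acost w (sel w t l) t)))
      = F w * (acost w (sel w t l) t + q * (acost w e t - acost w (sel w t l) t)).
    by rewrite -[_ *+ G]mulr_natl; field; rewrite gt_eqF.
  have {}h1 : p w - G%:R^-1 <= q.
    rewrite -(ler_pM2l GR0); apply: le_trans h1.
    by rewrite mulrBr mulfV ?gt_eqF.
  have /andP[F0 F1] := F01 w.
  have /andP[x0 x2] := a02 w e t; have /andP[y0 y2] := a02 w (sel w t l) t.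
  have G1 : 0 <= G%:R^-1 :> R by rewrite invr_ge0.
  move: (G%:R^-1) (acost _ _ _) (acost _ _ _) (F w) (p w) q G1 h1 h2 F0 F1 x0 x2 y0 y2.
  move=> g y x f pp q' g0 h1' h2' f0 f1 x0' x2' y0' y2'.
  have d0 : 0 <= pp - q' by lra.
  have yx : y - x <= 2 by lra.
  have A2 : (q' - pp) * (x - y) <= 2 * g by have := ler_wpM2l d0 yx; lra.
  have B : f * ((q' - pp) * (x - y)) <= f * (2 * g) by rewrite ler_wpM2l.
  have C : f * (2 * g) <= 1 * (2 * g) by rewrite ler_wpM2r // mulr_ge0.
  lra.
apply: le_trans step1 _; rewrite EED -[l.+1%:R]natr1 mulrDl mul1r.
have F' w : 0 <= F w * (1 - p w) <= 1.
  have /andP[F0 F1] := F01 w; have /andP[p0 p1] := p01 w.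
  by apply/andP; split; nra.
have cF' : coin_free (fun w => F w * (1 - p w)) by move=> w e' g el'; rewrite cF // cp.
have := IH _ (ltnW ll) cF' F'.
have -> : EE G N (fun w => F w * mix w l.+1 t) = EE G N (fun w => F w * p w * acost w e t)
    + EE G N (fun w => F w * (1 - p w) * mix w l t).
  by rewrite -EED; apply: EE_ext => w; rewrite mixS -/e -/(p w); ring.
lra.
Qed.

Lemma interval_expected a m :
  EE G N (fun w => (cost r (alg_set w) a (a + m))%:R)
  <= EE G N (fun w => \sum_(a <= t < a + m) mix w ell t
       + \sum_(1 <= e < ell.+1) \sum_(a <= t < (a + m).-1) drift w e t)
     + m%:R * (ell%:R * (2 + k%:R) / G%:R).
Proof.
have B0 : 0 <= ell%:R * (2 + k%:R) / G%:R :> R by rewrite divr_ge0 // mulr_ge0 // addr_ge0.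
case: m => [|m].
  rewrite addn0 mul0r addr0; apply: EE_le => // w _.
  rewrite /cost !(big_geq (leqnn a)) (big_geq (leqnSn a)) /= add0r; apply: sumr_ge0 => e _.
  by apply: sumr_ge0 => t _; rewrite drift_ge0.
have costE w : (cost r (alg_set w) a (a + m.+1) = loss (r a) (alg_set w a)
    + \sum_(a <= t < a + m) (loss (r t.+1) (alg_set w t.+1) + dist (alg_set w t.+1) (alg_set w t)))%N.
  rewrite /cost addnS big_nat_recl ?leq_addr // big_split /= -addnA; congr (_ + (_ + _))%N.
  by rewrite big_add1.
apply: le_trans (_ : EE G N (fun w => \sum_(a <= t < a + m.+1) acost w (sel w t ell) t
   + \sum_(a <= t < a + m) \sum_(1 <= e < ell.+1) k%:R * (flip w e t)%:R) <= _).
  apply: EE_le => // w wG; rewrite costE addnS big_nat_recl ?leq_addr //= natrD -addrA.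
  apply: lerD; first exact: round_loss.
  rewrite natr_sum -big_split; apply: ler_sum => t _; exact: round_cost.
rewrite !EED !EE_sum addnS /=.
have S t : EE G N (fun w => acost w (sel w t ell) t) <= EE G N (fun w => mix w ell t) + ell%:R * (2 / G%:R).
  have := @sel_expected t ell (fun=> 1) (leqnn _) (fun _ _ _ _ => erefl) _.
  have -> : (fun w => 1 * acost w (sel w t ell) t) = (fun w => acost w (sel w t ell) t).
    by apply/funext => w; rewrite mul1r.
  have -> : (fun w => 1 * mix w ell t) = (fun w => mix w ell t).
    by apply/funext => w; rewrite mul1r.
  by apply=> _; rewrite ler01 lexx.
have Fl t : EE G N (fun w => \sum_(1 <= e < ell.+1) k%:R * (flip w e t)%:R)
   <= \sum_(1 <= e < ell.+1) EE G N (fun w => drift w e t) + ell%:R * (k%:R / G%:R).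
  rewrite EE_sum.
  have -> : ell%:R * (k%:R / G%:R) = \sum_(1 <= e < ell.+1) (k%:R / G%:R) :> R.
    by rewrite sumr_const_nat subn1 mulr_natl.
  rewrite -big_split /= big_nat_cond [leRHS]big_nat_cond.
  by apply: ler_sum => e /andP[/andP[e1 el] _]; apply: flip_prob; rewrite e1.
have S' : \sum_(a <= t < (a + m).+1) EE G N (fun w => acost w (sel w t ell) t)
   <= \sum_(a <= t < (a + m).+1) EE G N (fun w => mix w ell t) + m.+1%:R * (ell%:R * (2 / G%:R)).
  have -> : m.+1%:R * (ell%:R * (2 / G%:R)) = \sum_(a <= t < (a + m).+1) (ell%:R * (2 / G%:R)) :> R.
    by rewrite sumr_const_nat -addnS addKn mulr_natl.
  by rewrite -big_split; apply: ler_sum => t _; exact: S.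
have F' : \sum_(a <= t < a + m) EE G N (fun w => \sum_(1 <= e < ell.+1) k%:R * (flip w e t)%:R)
   <= \sum_(a <= t < a + m) \sum_(1 <= e < ell.+1) EE G N (fun w => drift w e t) + m%:R * (ell%:R * (k%:R / G%:R)).
  have -> : m%:R * (ell%:R * (k%:R / G%:R)) = \sum_(a <= t < a + m) (ell%:R * (k%:R / G%:R)) :> R.
    by rewrite sumr_const_nat addKn mulr_natl.
  by rewrite -big_split; apply: ler_sum => t _; exact: Fl.
have -> : \sum_(1 <= e < ell.+1) EE G N (fun w => \sum_(a <= t < a + m) drift w e t)
  = \sum_(a <= t < a + m) \sum_(1 <= e < ell.+1) EE G N (fun w => drift w e t).
  by under eq_bigr => e _ do rewrite EE_sum; rewrite exchange_big.
have mk : m%:R * (ell%:R * (k%:R / G%:R)) <= m.+1%:R * (ell%:R * (k%:R / G%:R)) :> R.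
  by rewrite ler_wpM2r ?ler_nat // mulr_ge0 // divr_ge0.
have -> : m.+1%:R * (ell%:R * (2 + k%:R) / G%:R) = m.+1%:R * (ell%:R * (2 / G%:R)) + m.+1%:R * (ell%:R * (k%:R / G%:R)) :> R.
  by ring.
lra.
Qed.

End ExpectedExperts.

(** * Performance in terms of discretised samples *)

Section AlignedBlocks.
Variables (R : realType) (B : R) (g : nat -> nat -> R) (imax : nat).
Hypotheses (B0 : 0 <= B) (g_empty : forall a, g a a <= B).
Hypothesis g_cat : forall a b c, (a <= b)%N -> (b <= c)%N -> g a c <= g a b + g b c.
Hypothesis g_block : forall i b, (i <= imax)%N -> (b %% 4 ^ i == 0)%N ->
  g b (b + 4 ^ i)%N <= B * 2 ^+ i.

(** At most three blocks of length [4 ^ i] fit, and the rest costs at most [3 B 2 ^ i]. The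
    resulting [6 B 2 ^ i] equals [3 B 2 ^ (i + 1)], the assumption for the next length. *)
Lemma blocks_left i b m : (i <= imax)%N ->
  (forall b' m', (b' %% 4 ^ i == 0)%N -> (m' < 4 ^ i)%N -> g b' (b' + m')%N <= 3 * B * 2 ^+ i) ->
  (b %% 4 ^ i == 0)%N -> (m < 4 ^ i.+1)%N -> g b (b + m)%N <= 6 * B * 2 ^+ i.
Proof.
move=> im rest b4 m4.
have step s m' : (m' < 4 ^ i)%N -> g b (b + (s * 4 ^ i + m'))%N <= s%:R * (B * 2 ^+ i) + 3 * B * 2 ^+ i.
  elim: s b b4 => [|s IHs] b b4 m'4; first by rewrite mul0n add0n mul0r add0r rest.
  have bs : ((b + 4 ^ i) %% 4 ^ i == 0)%N by rewrite modnDr.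
  have := IHs _ bs m'4; have := g_block im b4.
  have := @g_cat b (b + 4 ^ i) (b + (s.+1 * 4 ^ i + m')) (leq_addr _ _) _.
  have -> : (b + 4 ^ i + (s * 4 ^ i + m') = b + (s.+1 * 4 ^ i + m'))%N by rewrite mulSn; lia.
  move=> /(_ ltac:(rewrite mulSn; lia)); rewrite -[s.+1%:R]natr1; lra.
have := step (m %/ 4 ^ i)%N (m %% 4 ^ i)%N; rewrite -divn_eq ltn_mod expn_gt0 => /(_ isT).
have s3 : (m %/ 4 ^ i <= 3)%N by rewrite -ltnS ltn_divLR ?expn_gt0 // -expnS.
have : (m %/ 4 ^ i)%:R * (B * 2 ^+ i) <= 3 * (B * 2 ^+ i).
  by rewrite ler_wpM2r ?mulr_ge0 ?exprn_ge0 // ler_nat.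
lra.
Qed.

Lemma aligned_left i b m : (i <= imax)%N -> (b %% 4 ^ i == 0)%N -> (m < 4 ^ i.+1)%N ->
  g b (b + m)%N <= 6 * B * 2 ^+ i.
Proof.
have B0' := B0; elim: i b m => [|i IH] b m im b4 m4.
  have rest b' m' : (b' %% 4 ^ 0 == 0)%N -> (m' < 4 ^ 0)%N -> g b' (b' + m')%N <= 3 * B * 2 ^+ 0.
    by rewrite expn0 ltnS leqn0 => _ /eqP ->; rewrite addn0 expr0; have := g_empty b'; lra.
  exact: (blocks_left im rest b4 m4).
apply: blocks_left => // b' m' b'4 m'4.
apply: le_trans (IH b' m' (ltnW im) _ m'4) _; last by rewrite exprS; lra.
exact: dvdn_trans (dvdn_exp2l _ (leqnSn i)) b'4.
Qed.

Lemma aligned_right i b m : (i <= imax.+1)%N -> (b %% 4 ^ i == 0)%N -> (m < 4 ^ i)%N -> (m <= b)%N ->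
  g (b - m)%N b <= 3 * B * 2 ^+ i.
Proof.
have B0' := B0; elim: i b m => [|i IH] b m im b4 m4 mb.
  rewrite expn0 in m4; have -> : m = 0%N by lia.
  by rewrite subn0 expr0; have := g_empty b; lra.
have b4' : (b %% 4 ^ i == 0)%N by exact: dvdn_trans (dvdn_exp2l _ (leqnSn i)) b4.
have step s m' : (m' < 4 ^ i)%N -> (s * 4 ^ i + m' <= b)%N ->
    g (b - (s * 4 ^ i + m'))%N b <= s%:R * (B * 2 ^+ i) + 3 * B * 2 ^+ i.
  elim: s b b4' {b4 mb} => [|s IHs] b b4' m'4 mb; first by rewrite mul0n add0n mul0r add0r IH // ltnW.
  have ib : (4 ^ i <= b)%N by rewrite mulSn in mb; lia.
  have bs : ((b - 4 ^ i) %% 4 ^ i == 0)%N by apply: dvdn_sub; rewrite ?dvdnn.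
  have := IHs _ bs m'4 ltac:(rewrite mulSn in mb; lia).
  have := @g_block i (b - 4 ^ i)%N im bs; rewrite subnK //.
  have := @g_cat (b - (s.+1 * 4 ^ i + m'))%N (b - 4 ^ i)%N b _ (leq_subr _ _).
  have -> : (b - 4 ^ i - (s * 4 ^ i + m') = b - (s.+1 * 4 ^ i + m'))%N by rewrite mulSn; lia.
  move=> /(_ ltac:(rewrite mulSn; lia)); rewrite -[s.+1%:R]natr1; lra.
have := step (m %/ 4 ^ i)%N (m %% 4 ^ i)%N; rewrite -divn_eq ltn_mod expn_gt0 => /(_ isT mb).
have s3 : (m %/ 4 ^ i <= 3)%N by rewrite -ltnS ltn_divLR ?expn_gt0 // -expnS.
have : (m %/ 4 ^ i)%:R * (B * 2 ^+ i) <= 3 * (B * 2 ^+ i).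
  by rewrite ler_wpM2r ?mulr_ge0 ?exprn_ge0 // ler_nat.
by rewrite exprS; lra.
Qed.

(** With [4 ^ i <= m] maximal, the interval is cut at the first multiple [c] of [4 ^ i] from [a] on.
    The parts before and after [c] contribute 3 and 6 to the constant 9. *)
Lemma aligned_interval a m : (0 < m)%N -> (m < 4 ^ imax.+1)%N ->
  g a (a + m)%N <= 9 * B * Num.sqrt m%:R.
Proof.
move=> m0 mmax; set i := trunc_log 4 m.
have /andP[im mi] := trunc_log_bounds (isT : (1 < 4)%N) m0; rewrite -/i in im mi.
have ii : (i <= imax)%N by rewrite -ltnS -(ltn_exp2l _ _ (isT : (1 < 4)%N)); apply: leq_ltn_trans im mmax.
(* The outer remainder makes [d] vanish when [a] is already aligned. *)
pose d := ((4 ^ i - a %% 4 ^ i) %% 4 ^ i)%N; pose c := (a + d)%N.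
have P0 : (0 < 4 ^ i)%N by rewrite expn_gt0.
have d4 : (d < 4 ^ i)%N by rewrite ltn_mod.
have c4 : (c %% 4 ^ i == 0)%N.
  rewrite /c /d modnDmr -modnDml subnKC ?modnn //.
  by rewrite ltnW // ltn_mod.
have cm : (c <= a + m)%N by rewrite leq_add2l; apply: leq_trans im; exact: ltnW.
have H1 : g a c <= 3 * B * 2 ^+ i.
  by have := @aligned_right i c d (leqW ii) c4 d4 (leq_addl _ _); rewrite /c addnK.
have H2 : g c (a + m)%N <= 6 * B * 2 ^+ i.
  rewrite -(subnKC cm); apply: aligned_left => //.
  by apply: leq_ltn_trans mi; rewrite /c; lia.
apply: le_trans (_ : 9 * B * 2 ^+ i <= _).
  by have := g_cat (leq_addr d a) cm; rewrite -/c; lra.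
rewrite ler_wpM2l ?mulr_ge0 // -[leLHS]ger0_norm ?exprn_ge0 // -sqrtr_sqr.
by apply: ler_wsqrtr; rewrite -exprM mulnC exprM -natrX -natrX ler_nat.
Qed.

End AlignedBlocks.

Section Guarantees.
Variables (R : realType) (n k ell N : nat) (pos : nat -> nat) (r : nat -> 'I_n).
Let G := (2 ^ (4 * ell))%N.
Hypotheses (k0 : (0 < k)%N) (kn : (k <= n)%N).
Hypothesis posN : forall j : nat, (j < n + ell.+1)%N -> (pos j < N)%N.
Hypothesis pos_inj : forall i j : nat, (i < n + ell.+1)%N -> (j < n + ell.+1)%N -> pos i = pos j -> i = j.
Hypotheses (ell0 : (0 < ell)%N) (n_le : (n <= 2 ^ ell)%N).

Let lam : R := Num.sqrt ell%:R.

Let G0 : (0 < G)%N. Proof. by rewrite expn_gt0. Qed.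
Let Z : R := 2 ^+ ell.
Let Z1 : 1 <= Z. Proof. by rewrite exprn_ege1 // ler1n. Qed.
Let GZ : G%:R = Z ^+ 4 :> R. Proof. by rewrite natrX mulnC exprM. Qed.
Let kZ : k%:R <= Z. Proof. by rewrite /Z -natrX ler_nat (leq_trans kn). Qed.
Let nZ : n%:R <= Z. Proof. by rewrite /Z -natrX ler_nat. Qed.
Let ellZ : ell%:R <= Z. Proof. by rewrite /Z -natrX ler_nat ltnW // ltn_expl. Qed.

Let lam1 : 1 <= lam.
Proof. by rewrite /lam -[leLHS]sqrtr1 ler_sqrt ?ler0n // ler1n. Qed.

Local Notation mix w := (mix ell k G lam (acost R k ell pos r w)).
Local Notation drift w := (drift ell k G lam (acost R k ell pos r w)).
Local Notation alg w := (alg_set k ell pos r lam w).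

Let a02 w := acost02 R k ell pos r w.

Let Zi0 : 0 <= Z^-1. Proof. by rewrite invr_ge0 (le_trans ler01). Qed.
Let Zn0 : Z != 0. Proof. by rewrite gt_eqF // (lt_le_trans ltr01). Qed.

(** This bound and the next explain the exponent 4 in [G = Z ^ 4]: a block may have
    [4 ^ ell = Z ^ 2] rounds, there are at most [Z] levels, and one more factor [Z] bounds an
    inverse learning rate or [k]. *)
Let err_levels (j d : nat) : (j <= ell)%N -> d%:R <= Z ^+ 2 ->
  j%:R * ((1 + 2 * d%:R) * 2 ^+ ell / G%:R) <= 3 :> R.
Proof.
move=> jl dZ; rewrite GZ -/Z.
have jZ : j%:R <= Z by apply: le_trans ellZ; rewrite ler_nat.
apply: le_trans (_ : Z * ((Z ^+ 2 + 2 * Z ^+ 2) * Z / Z ^+ 4) <= _); last first.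
  by rewrite le_eqVlt; apply/orP; left; apply/eqP; field.
have Zp : 0 <= Z by rewrite (le_trans ler01).
apply: ler_pM => //.
  by rewrite !mulr_ge0 ?invr_ge0 ?exprn_ge0 ?addr_ge0 ?mulr_ge0.
rewrite ler_wpM2r ?invr_ge0 ?exprn_ge0 // ler_wpM2r //.
have : 1 <= Z ^+ 2 by rewrite exprn_ege1.
lra.
Qed.

Let err_round (d : nat) : d%:R <= Z ^+ 2 -> d%:R * (ell%:R * (2 + k%:R) / G%:R) <= 3 :> R.
Proof.
move=> dZ; rewrite GZ; have Zp : 0 <= Z by rewrite (le_trans ler01).
apply: le_trans (_ : Z ^+ 2 * (Z * (2 * Z + Z) / Z ^+ 4) <= _); last first.
  by rewrite le_eqVlt; apply/orP; left; apply/eqP; field.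
apply: ler_pM => //; first by rewrite !mulr_ge0 ?invr_ge0 ?exprn_ge0 ?addr_ge0.
rewrite ler_wpM2r ?invr_ge0 ?exprn_ge0 //; apply: ler_pM => //.
have := Z1; have := kZ; lra.
Qed.

(** All scales are aligned at time 0, so the horizon loses only constants to marking: 3 for
    selection and flips, 3 for the levels, 1 for ties. The term [k * harmonic_sum R k] stems from
    the additive [k] in [clean_offline]. *)
Lemma competitive_bound T (Cs : nat -> {set 'I_n}) : (T <= 2 ^ ell)%N -> (forall t, #|Cs t| = k) ->
  EE G N (fun w => (cost r (alg w) 0 T)%:R)
  <= 2 * harmonic_sum R k * (cost r Cs 0 T)%:R + (k%:R * harmonic_sum R k + 7).
Proof.
move=> TZ Ck.
have TR : T%:R <= Z by rewrite /Z -natrX ler_nat.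
have TR2 : T%:R <= Z ^+ 2.
  by apply: le_trans TR _; rewrite expr2 ler_peMl // (le_trans ler01).
have H0 : 0 <= harmonic_sum R k by apply: sumr_ge0 => i _; rewrite invr_ge0.
have := interval_expected r k0 kn posN pos_inj lam1 0 T; rewrite add0n -/G => I.
have E1 := err_round TR2; have E2 := err_levels (leqnn ell) TR2.
have : EE G N (fun w => \sum_(0 <= t < T) mix w ell t
       + \sum_(1 <= e < ell.+1) \sum_(0 <= t < T.-1) drift w e t)
  <= EE G N (fun w => \sum_(0 <= t < T) acost R k ell pos r w 0 t) + 3.
  rewrite -[X in _ + X](EE_cst G0 N 3) -EED; apply: EE_le => // w _.
  have := @levels_sum R ell k G lam (acost R k ell pos r w) k0 G0 lam1 (a02 w) ell 0 T (leqnn _) (fun e _ => introT eqP (mod0n _)).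
  rewrite add0n subnn => L.
  have D : \sum_(1 <= e < ell.+1) \sum_(0 <= t < T.-1) drift w e t
     <= \sum_(1 <= e < ell.+1) \sum_(0 <= t < T) drift w e t.
    apply: ler_sum => e _; case: (T) => [//|T'] /=.
    by rewrite [leRHS]big_nat_recr //= lerDl drift_ge0.
  move: L; rewrite [X in _ <= X + _](_ : _ = \sum_(0 <= t < T) acost R k ell pos r w 0 t) //; lra.
rewrite EE_sum.
have M : \sum_(0 <= t < T) EE G N (fun w => acost R k ell pos r w 0 t)
   <= \sum_(0 <= t < T) miss_prob R k r t + 1.
  apply: le_trans (_ : \sum_(0 <= t < T) (miss_prob R k r t + n%:R / G%:R) <= _).
    by apply: ler_sum => t _; exact: marking_expected.
  rewrite big_split lerD2l sumr_const_nat subn0 -[leLHS]mulr_natl GZ.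
  have Z4 : 0 < Z ^+ 4 by rewrite exprn_gt0 // (lt_le_trans ltr01).
  rewrite mulrA ler_pdivrMr // mul1r.
  apply: le_trans (_ : Z * Z <= _); first by apply: ler_pM.
  by rewrite -expr2 ler_weXn2l.
have P := miss_prob_sum R r k0 kn T.
have C : harmonic_sum R k * (\sum_(0 <= t < T) clean k r t)%N%:R
    <= harmonic_sum R k * (2 * (cost r Cs 0 T)%:R + k%:R).
  by rewrite ler_wpM2l // -natrM -natrD ler_nat clean_offline.
lra.
Qed.

Let ln2n m : ln (2 ^+ m) <= m%:R :> R.
Proof.
rewrite lnXn //; apply: ler_wMn2r.
by have := @le_ln1Dx R 1; apply; lra.
Qed.

Let lam_ge0 : 0 <= lam. Proof. by rewrite (le_trans ler01). Qed.

Let lnG : ln (1 + G%:R) / lam <= 5 * lam.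
Proof.
rewrite ler_pdivrMr ?(lt_le_trans ltr01) // -mulrA -expr2 sqr_sqrtr //.
apply: le_trans (_ : ln (2 ^+ (4 * ell).+1) <= _).
  rewrite ler_ln ?posrE ?exprn_gt0 ?ltr_wpDr // exprS natrX.
  have : 1 <= 2 ^+ (4 * ell) :> R by rewrite exprn_ege1 // ler1n.
  lra.
apply: le_trans (ln2n _) _; rewrite -natrM ler_nat; lia.
Qed.

(** In units of [k lam 2 ^ i], 62 is 40 + 5 for mixing in expert [i], 8 for the drift of coarser
    scales, 2 + 1 for the leader and 3 + 3 for rounding. If scale [i] is inactive, so are the finer
    ones, and the cost of at most 2 per round suffices. *)
Lemma block_regret i b (C : {set 'I_n}) : (i <= ell)%N -> (b %% 4 ^ i == 0)%N -> #|C| = k ->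
  EE G N (fun w => (cost r (alg w) b (b + 4 ^ i))%:R) - (\sum_(b <= t < b + 4 ^ i) loss (r t) C)%N%:R
  <= 62 * k%:R * lam * 2 ^+ i.
Proof.
move=> il b4 Ck.
have i2 : (4 ^ i)%:R <= Z ^+ 2.
  have E4 : ((2 ^ ell) ^ 2 = 4 ^ ell)%N by rewrite -expnM mulnC expnM.
  by rewrite /Z -natrX -natrX ler_nat E4 leq_exp2l.
have I := interval_expected r k0 kn posN pos_inj lam1 b (4 ^ i); rewrite -/G in I.
have E1 := err_round i2.
have kl1 : 1 <= k%:R * lam by rewrite -[leLHS]mulr1; apply: ler_pM; rewrite ?ler1n.
have i1 : 1 <= 2 ^+ i :> R by rewrite exprn_ege1 // ler1n.
have kli : 1 <= k%:R * lam * 2 ^+ i by rewrite -[leLHS]mulr1; apply: ler_pM.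
have loss0 : 0 <= (\sum_(b <= t < b + 4 ^ i) loss (r t) C)%N%:R :> R by [].
have drift_hi w : \sum_(i.+1 <= e < ell.+1) \sum_(b <= t < (b + 4 ^ i).-1) drift w e t
   <= 8 * k%:R * lam * 2 ^+ i by exact: drift_large.
have split_e (F : nat -> R) : \sum_(1 <= e < ell.+1) F e
   = \sum_(1 <= e < i.+1) F e + \sum_(i.+1 <= e < ell.+1) F e.
  by rewrite (big_cat_nat (n := i.+1)).
have [ai|ai] := boolP (active k lam i); last first.
  have ilt : 2 ^+ i <= 8 * k%:R * lam by rewrite ltW // ltNge.
  have Tot : EE G N (fun w => \sum_(b <= t < b + 4 ^ i) mix w ell t
       + \sum_(1 <= e < ell.+1) \sum_(b <= t < (b + 4 ^ i).-1) drift w e t)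
    <= 2 * (4 ^+ i) + 8 * k%:R * lam * 2 ^+ i.
    rewrite -[leRHS](EE_cst G0 N); apply: EE_le => // w _; apply: lerD.
      apply: le_trans (_ : \sum_(b <= t < b + 4 ^ i) 2 <= _).
        by apply: ler_sum => t _; have /andP[] := mix_bounds ell G k0 lam1 (a02 w) ell t.
      by rewrite sumr_const_nat addKn -mulrnA natrM natrX.
    rewrite split_e [X in X + _](_ : _ = 0) ?add0r //.
    rewrite big_nat_cond big1 // => e /andP[/andP[_ ei] _]; apply: big1 => t _.
    have ae : ~~ active k lam e.
      apply: contra ai => /le_trans; apply; rewrite ler_weXn2l ?ler1n //.
    by rewrite driftE !(prob_inactive ell G k0 lam1 (a02 w) _ ae) subrr normr0 mulr0.
  have : 4 ^+ i <= 8 * k%:R * lam * 2 ^+ i :> R.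
    have -> : 4 = 2 * 2 :> R by rewrite -natrM.
    by rewrite exprMn ler_wpM2r // exprn_ge0.
  lra.
have i0 : (0 < i)%N.
  case: i ai {il b4 i2 I E1 i1 kli loss0 drift_hi split_e} => //.
  by rewrite /active expr0; lra.
have E2 := err_levels (leq_trans (leq_pred i) il) i2.
have Tot : EE G N (fun w => \sum_(b <= t < b + 4 ^ i) mix w ell t
       + \sum_(1 <= e < ell.+1) \sum_(b <= t < (b + 4 ^ i).-1) drift w e t)
   <= EE G N (fun w => \sum_(b <= t < b + 4 ^ i) acost R k ell pos r w i t)
      + (48 * k%:R * lam * 2 ^+ i + 5 * lam * 2 ^+ i + 3).
  rewrite -[X in _ + X](EE_cst G0 N) -EED; apply: EE_le => // w _.
  have b4' e : (0 < e <= i.-1)%N -> (b %% 4 ^ e == 0)%N.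
    by move=> /andP[_ ei]; exact: (dvdn_trans (dvdn_exp2l 4 (leq_trans ei (leq_pred i))) b4).
  (* Scales below [i] are compared with the mixture that has just taken in expert [i];
     [level_regret] then compares that mixture with the expert. *)
  have L := levels_sum k0 G0 lam1 (a02 w) (4 ^ i) (leq_trans (leq_pred i) il) b4'.
  have ee : (ell - i.-1 = (ell - i).+1)%N by rewrite -[in RHS](prednK i0) subnSK // prednK.
  rewrite ee prednK // in L.
  have il' : (0 < i <= ell)%N by rewrite i0.
  have Re := level_regret k0 G0 lam1 (a02 w) il' ai b4.
  have Dh := drift_hi w.
  have D : \sum_(1 <= e < i) \sum_(b <= t < (b + 4 ^ i).-1) drift w e t
     <= \sum_(1 <= e < i) \sum_(b <= t < b + 4 ^ i) drift w e t.
    apply: ler_sum => e _; have : (0 < 4 ^ i)%N by rewrite expn_gt0.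
    case: (4 ^ i)%N => // d _; rewrite addnS /= [leRHS]big_nat_recr ?leq_addr //=.
    by rewrite lerDl drift_ge0.
  rewrite split_e big_nat_recr //=.
  have lg : ln (1 + G%:R) * 2 ^+ i / lam <= 5 * lam * 2 ^+ i.
    by rewrite mulrAC ler_wpM2r ?exprn_ge0.
  lra.
have il' : (0 < i <= ell)%N by rewrite i0.
have Lx := leader_expected R r k0 kn posN pos_inj il' b4 Ck; rewrite -/G in Lx.
have t1 : lam * 2 ^+ i <= k%:R * lam * 2 ^+ i.
  by rewrite ler_wpM2r ?exprn_ge0 // ler_peMl // ler1n.
have t2 : k%:R * 2 ^+ i <= k%:R * lam * 2 ^+ i.
  by rewrite ler_wpM2r ?exprn_ge0 // ler_peMr.
have t3 : 2 ^+ i <= k%:R * lam * 2 ^+ i by rewrite ler_peMl // exprn_ge0.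
lra.
Qed.

Lemma cost_concat (Cs : nat -> {set 'I_n}) a b c : (a <= b)%N -> (b <= c)%N ->
  (forall t, #|Cs t| = k) -> (cost r Cs a c <= cost r Cs a b + cost r Cs b c + k)%N.
Proof.
rewrite leq_eqVlt => /orP[/eqP ->|ab] bc Ck.
  by rewrite addnAC leq_addl.
move: bc; rewrite leq_eqVlt => /orP[/eqP ->|bc].
  by rewrite -addnA leq_addr.
rewrite /cost (big_cat_nat (n := b) (p := c)) /=; [|exact: ltnW|exact: ltnW].
rewrite [(\sum_(a.+1 <= _ < c) _)%N](big_cat_nat (n := b)) /=; [|exact: ab|exact: ltnW].
rewrite [(\sum_(b <= i < c) dist _ _)%N](big_ltn bc) /=.
have : (dist (Cs b) (Cs b.-1) <= k)%N by rewrite -(Ck b); apply: subset_leq_card; exact: finset.subsetDl.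
lia.
Qed.

Lemma interval_regret a m (C : {set 'I_n}) : (m <= 2 ^ ell)%N -> #|C| = k ->
  EE G N (fun w => (cost r (alg w) a (a + m))%:R)
  <= (\sum_(a <= t < a + m) loss (r t) C)%N%:R + 567 * k%:R * lam * Num.sqrt m%:R.
Proof.
move=> mZ Ck; case: m mZ => [|m] mZ.
  rewrite addn0 sqrtr0 mulr0 addr0 big_geq // mulr0n.
  by rewrite -[leRHS](EE_cst G0 N); apply: EE_le => // w _; rewrite /cost !big_geq.
have kl : k%:R <= k%:R * lam by rewrite ler_peMr.
have kl0 : 0 <= k%:R * lam by rewrite mulr_ge0.
(* Joining two intervals adds up to [k] replacements at the seam; the summand [k * lam] absorbs them
   and makes [g] subadditive. It raises 62 to 63, and 9 times 63 is 567. *)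
pose g a c := EE G N (fun w => (cost r (alg w) a c)%:R) - (\sum_(a <= t < c) loss (r t) C)%N%:R + k%:R * lam.
have K0 : 0 <= 63 * k%:R * lam by lra.
have losscat b c d : (b <= c)%N -> (c <= d)%N ->
   (\sum_(b <= t < d) loss (r t) C = \sum_(b <= t < c) loss (r t) C + \sum_(c <= t < d) loss (r t) C)%N.
  by move=> bc cd; rewrite (big_cat_nat (n := c)).
have g_empty b : g b b <= 63 * k%:R * lam.
  rewrite /g big_geq // subr0; apply: le_trans (_ : EE G N (fun=> 0) + k%:R * lam <= _).
    by rewrite lerD2r; apply: EE_le => // w _; rewrite /cost !big_geq.
  by rewrite EE_cst //; lra.
have g_cat b c d : (b <= c)%N -> (c <= d)%N -> g b d <= g b c + g c d.
  move=> bc cd; rewrite /g (losscat b c d) // natrD.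
  have : EE G N (fun w => (cost r (alg w) b d)%:R)
     <= EE G N (fun w => (cost r (alg w) b c)%:R) + EE G N (fun w => (cost r (alg w) c d)%:R) + k%:R :> R.
    have kE : k%:R = EE G N (fun=> k%:R) :> R by rewrite EE_cst.
    rewrite [in X in _ <= X]kE -!EED; apply: EE_le => // w _.
    rewrite -!natrD ler_nat; apply: cost_concat => // t; exact: alg_set_card.
  lra.
have g_block i b : (i <= ell)%N -> (b %% 4 ^ i == 0)%N -> g b (b + 4 ^ i)%N <= 63 * k%:R * lam * 2 ^+ i.
  move=> il b4; rewrite /g; have := block_regret il b4 Ck.
  have i1 : 1 <= 2 ^+ i :> R by rewrite exprn_ege1 // ler1n.
  have : k%:R * lam <= k%:R * lam * 2 ^+ i by rewrite ler_peMr.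
  lra.
have mm : (m.+1 < 4 ^ ell.+1)%N.
  apply: leq_ltn_trans mZ _; apply: leq_trans (_ : 4 ^ ell <= _)%N; last by rewrite leq_exp2l.
  by rewrite ltn_exp2r.
have := aligned_interval K0 g_empty g_cat g_block a (isT : (0 < m.+1)%N) mm.
rewrite /g; lra.
Qed.

End Guarantees.

Local Close Scope ring_scope.

(** * Total correctness of programs *)

Section Logic.
Variable R : realType.
Implicit Types (s : state R) (c : cmd) (K : seq cmd) (w : nat -> R).

Definition seti a i v s : state R := State (upd (imem s) a i v) (rmem s).
Definition setr a i v s : state R := State (imem s) (upd (rmem s) a i v).

Lemma run_add w m1 m2 (C : config R) :
  run w (m1 + m2) C = run (fun j => w (m1 + j)) m2 (run w m1 C).
Proof. by elim: m2 => [|m2 IH]; rewrite ?addn0 // addnS /= IH. Qed.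

Lemma run_first w m (C : config R) :
  run w m.+1 C = run (fun j => w j.+1) m (step (w 0) C).
Proof. by rewrite -add1n run_add. Qed.

Lemma run_halt w m s : run w m ([::], s) = ([::], s).
Proof. by elim: m => //= m ->. Qed.

(* Every loop is assumed to make at most Y iterations. *)
Fixpoint max_steps (Y : nat) c : nat :=
  match c with
  | Seq c1 c2 | Ite _ c1 c2 => (max_steps Y c1 + max_steps Y c2).+1
  | While _ c1 => (Y * (max_steps Y c1).+1).+1
  | _ => 1
  end.

Fixpoint loop_depth c : nat :=
  match c with
  | Seq c1 c2 | Ite _ c1 c2 => maxn (loop_depth c1) (loop_depth c2)
  | While _ c1 => (loop_depth c1).+1
  | _ => 0
  end.

Fixpoint cmd_size c : nat :=
  match c with
  | Seq c1 c2 | Ite _ c1 c2 => (cmd_size c1 + cmd_size c2).+1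
  | While _ c1 => (cmd_size c1).+2
  | _ => 1
  end.

Lemma max_steps_poly Y c : 0 < Y -> max_steps Y c <= cmd_size c * Y ^ loop_depth c.
Proof.
move=> Y0; have P d : 0 < Y ^ d by rewrite expn_gt0 Y0.
have two (a b : cmd) : max_steps Y a <= cmd_size a * Y ^ loop_depth a ->
    max_steps Y b <= cmd_size b * Y ^ loop_depth b ->
    (max_steps Y a + max_steps Y b).+1
    <= (cmd_size a + cmd_size b).+1 * Y ^ maxn (loop_depth a) (loop_depth b).
  move=> Ha Hb; rewrite mulSn mulnDl -addn1 addnC leq_add ?P // leq_add //.
    by apply: leq_trans Ha _; rewrite leq_mul2l leq_pexp2l ?leq_maxl ?orbT.
  by apply: leq_trans Hb _; rewrite leq_mul2l leq_pexp2l ?leq_maxr ?orbT.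
elim: c => [|a i e|a i e|a i|a IHa b IHb|b a IHa c IHc|b c IH] //=; rewrite ?P //; try exact: two.
rewrite expnS; have := P (loop_depth c); nia.
Qed.

(** A total correctness triple with a step bound. The final state is the same for all samples, so
    the sampling loop is treated apart, with exact step numbers. *)
Definition tr Y s c (Q : state R -> Prop) := exists m s',
  [/\ m <= max_steps Y c, Q s' & forall w K, run w m (c :: K, s) = (K, s')].

Lemma tr_weaken Y s c (Q Q' : state R -> Prop) :
  (forall s', Q s' -> Q' s') -> tr Y s c Q -> tr Y s c Q'.
Proof. by move=> QQ [m [s' [? /QQ ? ?]]]; exists m, s'. Qed.

Lemma tr_skip Y s (Q : state R -> Prop) : Q s -> tr Y s Skip Q.
Proof. by move=> Qs; exists 1, s. Qed.

Lemma tr_iset Y s a e v (Q : state R -> Prop) :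
  Q (seti a (ieval s e) (ieval s v) s) -> tr Y s (ISet a e v) Q.
Proof. by move=> Qs; exists 1, (seti a (ieval s e) (ieval s v) s). Qed.

Lemma tr_rset Y s a e v (Q : state R -> Prop) :
  Q (setr a (ieval s e) (reval s v) s) -> tr Y s (RSet a e v) Q.
Proof. by move=> Qs; exists 1, (setr a (ieval s e) (reval s v) s). Qed.

Lemma tr_seq Y s c1 c2 (Q : state R -> Prop) :
  tr Y s c1 (fun s1 => tr Y s1 c2 Q) -> tr Y s (Seq c1 c2) Q.
Proof.
move=> [m1 [s1 [h1 [m2 [s2 [h2 Qs r2]]] r1]]].
exists (m1 + m2).+1, s2; split=> //; first by rewrite /= ltnS leq_add.
by move=> w K; rewrite run_first run_add r1 r2.
Qed.

Lemma tr_ite Y s b c1 c2 (Q : state R -> Prop) :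
  (beval s b -> tr Y s c1 Q) -> (~~ beval s b -> tr Y s c2 Q) -> tr Y s (Ite b c1 c2) Q.
Proof.
case: (boolP (beval s b)) => hb H1 H2.
  have [m1 [s1 [h1 Qs r1]]] := H1 isT; exists m1.+1, s1; split=> //.
    by rewrite /= ltnS (leq_trans h1) ?leq_addr.
  by move=> w K; rewrite run_first /= hb r1.
have [m1 [s1 [h1 Qs r1]]] := H2 isT; exists m1.+1, s1; split=> //.
  by rewrite /= ltnS (leq_trans h1) ?leq_addl.
by move=> w K; rewrite run_first /= (negbTE hb) r1.
Qed.

Lemma tr_while Y N (I : nat -> state R -> Prop) s b c (Q : state R -> Prop) :
  N <= Y -> I 0 s ->
  (forall j s1, j < N -> I j s1 -> beval s1 b /\ tr Y s1 c (I j.+1)) ->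
  (forall s1, I N s1 -> ~~ beval s1 b /\ Q s1) ->
  tr Y s (While b c) Q.
Proof.
move=> NY I0 IS IN.
suff H d j s1 : d + j = N -> I j s1 -> exists m s',
    [/\ m <= d * (max_steps Y c).+1 + 1, Q s' & forall w K, run w m (While b c :: K, s1) = (K, s')].
  have [m [s' [hm Qs' rm]]] := H N 0 s (addn0 N) I0.
  by exists m, s'; split=> //=; apply: leq_trans hm _; rewrite addn1 ltnS leq_mul2r NY orbT.
elim: d j s1 => [|d IH] j s1 dj Ij.
  rewrite add0n in dj; rewrite dj in Ij; have [nb Qs1] := IN _ Ij.
  by exists 1, s1; split=> // w K /=; rewrite (negbTE nb).
have jN : j < N by rewrite -dj addSn ltnS leq_addl.
have [hb [m1 [s2 [h1 I2 r1]]]] := IS j s1 jN Ij.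
have [|m2 [s3 [h2 Q3 r2]]] := IH j.+1 s2 _ I2; first by rewrite addnS -addSn.
exists (m1 + m2).+1, s3; split=> //; first by rewrite mulSn; lia.
by move=> w K; rewrite run_first /= hb run_add r1 r2.
Qed.

Definition var a := IGet a (IConst 0).

Definition For a hi body :=
  Seq (ISet a (IConst 0) (IConst 0))
      (While (BILt (var a) hi)
             (Seq body (ISet a (IConst 0) (IAdd (var a) (IConst 1))))).

Lemma tr_for Y N (I : nat -> state R -> Prop) s a hi body (Q : state R -> Prop) :
  N <= Y ->
  (forall j s1, j <= N -> I j s1 -> imem s1 a 0 = j /\ ieval s1 hi = N) ->
  I 0 (seti a 0 0 s) ->
  (forall j s1, j < N -> I j s1 ->
     tr Y s1 body (fun s2 => imem s2 a 0 = j /\ I j.+1 (seti a 0 j.+1 s2))) ->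
  (forall s1, I N s1 -> Q s1) ->
  tr Y s (For a hi body) Q.
Proof.
move=> NY Ival I0 IS IN; apply: tr_seq; apply: tr_iset.
apply: (tr_while NY I0) => [j s1 jN Ij|s1 I1].
  have [aj hN] := Ival _ _ (ltnW jN) Ij; split; first by rewrite /= aj hN.
  apply: tr_seq; apply: tr_weaken (IS _ _ jN Ij) => s2 [a2 I2].
  by apply: tr_iset; rewrite /= a2 addn1.
by have [aj hN] := Ival _ _ (leqnn _) I1; split; [rewrite /= aj hN ltnn | exact: IN].
Qed.

Definition frame (A B : seq nat) s s' :=
  (forall a, a \notin A -> imem s' a = imem s a) /\
  (forall b, b \notin B -> rmem s' b = rmem s b).

Lemma frame_trans A B s1 s2 s3 : frame A B s1 s2 -> frame A B s2 s3 -> frame A B s1 s3.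
Proof.
move=> [i1 r1] [i2 r2]; split=> x nx; first by rewrite i2 ?i1.
by rewrite r2 ?r1.
Qed.

Lemma frame_sub A B A' B' s s' : {subset A <= A'} -> {subset B <= B'} ->
  frame A B s s' -> frame A' B' s s'.
Proof.
move=> sA sB [i r]; split=> x nx; [apply: i|apply: r]; apply: contra nx; [exact: sA|exact: sB].
Qed.

Lemma frame_seti A B s a i v : a \in A -> frame A B s (seti a i v s).
Proof.
move=> aA; split=> // x nx /=; apply/funext => y; rewrite /upd.
by case: eqP => // e; rewrite e aA in nx.
Qed.

Lemma frame_setr A B s a i v : a \in B -> frame A B s (setr a i v s).
Proof.
move=> aA; split=> // x nx /=; apply/funext => y; rewrite /upd.
by case: eqP => // e; rewrite e aA in nx.
Qed.

End Logic.

(* Arrays of naturals: 0 interface, 1 cache, 2 initialised?, 3 ell, 4 G = 2^(4 ell),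
   5 power of two, 6 random integers, 7 powers of two, 8 counters (expert e, page i
   in cell e * n + i), 9 position in the current block, 10 number of marked pages,
   11 expert costs, 12-14 and 19-20 loop indices, 15 rank, 16 selected expert,
   17 previous rank, 18 digits.
   Arrays of reals: 0 samples, 1 learning rates, 2 weights, 3 mixture cost,
   4 and 6 advantage and its absolute value, 5 initial weights, 7 lambda. *)

Definition c_ i := IConst i.
Definition n_ := IGet 0 (c_ 0).
Definition k_ := IGet 0 (c_ 1).
Definition t_ := IGet 0 (c_ 2).
Definition req_ := IGet 0 (c_ 3).
Definition ell_ := var 3.
Definition g_ := var 4.
Definition idx_ e i := IAdd (IMul e n_) i.
Definition count_ e i := IGet 8 (idx_ e i).
Definition key_ e i :=
  IAdd (IMul (IAdd (IMul (count_ e i) g_) (IMul (IGet 6 i) (IGet 7 e))) n_) i.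

Definition rank_cmd e i :=
  Seq (ISet 15 (c_ 0) (c_ 0))
      (For 14 n_ (Ite (BILt (key_ e i) (key_ e (var 14)))
                      (ISet 15 (c_ 0) (IAdd (var 15) (c_ 1))) Skip)).

Definition reset_cmd e v := For 13 n_ (ISet 8 (idx_ e (var 13)) v).

Definition e_ := var 12.

(** With truncated subtraction [1 - (2 - c)] is the indicator of [1 < c], which turns marks into
    stale bits. *)
Definition prepare_cmd :=
  Ite (BILt e_ (c_ 1))
    (Ite (BAnd (BILt (count_ e_ req_) (c_ 2)) (BNot (BILt (var 10) k_)))
       (Seq (reset_cmd e_ (ISub (c_ 1) (ISub (c_ 2) (count_ e_ (var 13)))))
            (ISet 10 (c_ 0) (c_ 0)))
       Skip)
    (Ite (BILt (IGet 9 e_) (c_ 1))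
       (Seq (reset_cmd e_ (c_ 0)) (RSet 2 e_ (RGet 5 e_)))
       Skip).

(** In the absence of integer division, [t %% 4 ^ e] is kept as a counter that wraps at
    [2 ^ e * 2 ^ e]. *)
Definition register_cmd :=
  Ite (BILt e_ (c_ 1))
    (Ite (BILt (count_ e_ req_) (c_ 2))
       (Seq (ISet 8 (idx_ e_ req_) (IAdd (count_ e_ req_) (c_ 2)))
            (ISet 10 (c_ 0) (IAdd (var 10) (c_ 1))))
       Skip)
    (Seq (ISet 8 (idx_ e_ req_) (IAdd (count_ e_ req_) (c_ 1)))
         (Ite (BILt (IAdd (IGet 9 e_) (c_ 1)) (IMul (IGet 7 e_) (IGet 7 e_)))
              (ISet 9 e_ (IAdd (IGet 9 e_) (c_ 1)))
              (ISet 9 e_ (c_ 0)))).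

Definition cost_cmd :=
  Ite (BILt (var 15) k_)
    (Ite (BILt (var 17) k_) (ISet 11 e_ (c_ 0)) (ISet 11 e_ (c_ 1)))
    (ISet 11 e_ (c_ 2)).

Definition expert_cmd :=
  Seq prepare_cmd (Seq (rank_cmd e_ req_) (Seq (ISet 17 (c_ 0) (var 15))
    (Seq register_cmd (Seq (rank_cmd e_ req_) cost_cmd)))).

Definition scale_ := ISub ell_ (var 20).
Definition w_ := RGet 2 scale_.
Definition rv_ a := RGet a (c_ 0).

(** Scales run from [ell] down to 1, so a later, finer acceptance overwrites the selection. A weight
    can be updated in place because its advantage involves only coarser scales. *)
Definition combine_cmd :=
  Seq (RSet 3 (c_ 0) (RNat (IGet 11 (c_ 0))))
  (Seq (ISet 16 (c_ 0) (c_ 0))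
  (For 20 ell_
    (Seq (Ite (BRLt (RMul (RNat (IAdd (IGet 6 (IAdd n_ scale_)) (c_ 1)))
                          (RAdd (RNat (c_ 1)) w_))
                    (RMul (RNat g_) w_))
              (ISet 16 (c_ 0) scale_) Skip)
    (Seq (RSet 4 (c_ 0) (RSub (rv_ 3) (RNat (IGet 11 scale_))))
    (Seq (Ite (BRLt (rv_ 4) (RNat (c_ 0)))
              (RSet 6 (c_ 0) (RSub (RNat (c_ 0)) (rv_ 4)))
              (RSet 6 (c_ 0) (rv_ 4)))
    (Seq (RSet 3 (c_ 0) (RSub (rv_ 3)
            (RMul (RDiv w_ (RAdd (RNat (c_ 1)) w_)) (rv_ 4))))
         (RSet 2 scale_ (RMul w_ (RAdd (RNat (c_ 1)) (RMul (RGet 1 scale_)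
            (RSub (rv_ 4) (RMul (RMul (RMul (RNat (c_ 4)) (RNat k_)) (RGet 1 scale_))
                                (rv_ 6))))))))))))).

Definition output_cmd :=
  For 13 n_ (Seq (rank_cmd (var 16) (var 13))
    (Ite (BILt (var 15) k_) (ISet 1 (var 13) (c_ 1)) (ISet 1 (var 13) (c_ 0)))).

Definition round_cmd :=
  Seq (For 12 (IAdd ell_ (c_ 1)) expert_cmd) (Seq combine_cmd output_cmd).

Definition sizes_cmd :=
  Seq (ISet 2 (c_ 0) (c_ 1)) (Seq (ISet 3 (c_ 0) (c_ 0)) (Seq (ISet 5 (c_ 0) (c_ 1))
  (Seq (While (BNot (BILt (IMul n_ t_) (var 5)))
         (Seq (ISet 5 (c_ 0) (IMul (c_ 2) (var 5))) (ISet 3 (c_ 0) (IAdd (var 3) (c_ 1)))))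
  (Seq (ISet 4 (c_ 0) (IMul (IMul (var 5) (var 5)) (IMul (var 5) (var 5))))
       (ISet 12 (c_ 0) (c_ 0)))))).

Definition sample_cmd :=
  While (BILt e_ (IAdd n_ (IAdd ell_ (c_ 1))))
    (Seq (Sample 0 e_) (ISet 12 (c_ 0) (IAdd e_ (c_ 1)))).

Definition digit_cmd :=
  Seq (RSet 0 e_ (RMul (RNat (c_ 2)) (RGet 0 e_)))
      (Ite (BRLt (RGet 0 e_) (RNat (c_ 1)))
           (ISet 18 (c_ 0) (IMul (c_ 2) (var 18)))
           (Seq (RSet 0 e_ (RSub (RGet 0 e_) (RNat (c_ 1))))
                (ISet 18 (c_ 0) (IAdd (IMul (c_ 2) (var 18)) (c_ 1))))).

Definition digits_cmd :=
  For 12 (IAdd n_ (IAdd ell_ (c_ 1)))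
    (Seq (ISet 18 (c_ 0) (c_ 0))
    (Seq (For 19 (IMul (c_ 4) ell_) digit_cmd) (ISet 6 e_ (var 18)))).

Definition scales_cmd :=
  Seq (RSet 7 (c_ 0) (RPow (RNat ell_) (RDiv (RNat (c_ 1)) (RNat (c_ 2)))))
  (Seq (ISet 5 (c_ 0) (c_ 1))
  (For 12 (IAdd ell_ (c_ 1))
    (Seq (ISet 7 e_ (var 5))
    (Seq (RSet 1 e_ (RDiv (rv_ 7) (RNat (var 5))))
    (Seq (Ite (BRLt (RNat (var 5)) (RMul (RMul (RNat (c_ 8)) (RNat k_)) (rv_ 7)))
              (RSet 5 e_ (RNat (c_ 0)))
              (RSet 5 e_ (RDiv (RNat (c_ 1)) (RNat g_))))
         (ISet 5 (c_ 0) (IMul (c_ 2) (var 5)))))))).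

Definition paging_cmd :=
  Seq (Ite (BILt (var 2) (c_ 1))
           (Seq sizes_cmd (Seq sample_cmd (Seq digits_cmd scales_cmd)))
           Skip)
      round_cmd.

Lemma eqn_row n e e' i i' : i < n -> i' < n ->
  (e * n + i == e' * n + i') = (e == e') && (i == i').
Proof.
move=> lin lin'; apply/eqP/andP => [E|[/eqP -> /eqP -> //]].
have n0 : 0 < n by apply: leq_ltn_trans lin.
have Ei : i = i'.
  by move: (congr1 (fun x => x %% n) E); rewrite !modnMDl !modn_small.
have Ee : e = e'.
  by move: (congr1 (fun x => x %/ n) E); rewrite !divnMDl // !divn_small // !addn0.
by rewrite Ei Ee.
Qed.

Lemma modnS_small t b : 0 < b -> t.+1 %% b = if (t %% b).+1 < b then (t %% b).+1 else 0.
Proof.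
move=> b0; rewrite -addn1 -modnDml addn1; case: ltnP => h; first by rewrite modn_small.
have -> : (t %% b).+1 = b by apply/eqP; rewrite eqn_leq h ltn_mod b0.
by rewrite modnn.
Qed.

(** * Correctness of one round of the program *)

Section RoundCorrect.
Variables (R : realType) (n k ell Y : nat) (pos : nat -> nat) (r : nat -> 'I_n) (lam : R).
Variable w : nat -> nat.
Let G := 2 ^ (4 * ell).
Let V := noise n pos w.
Hypotheses (nY : n <= Y) (ellY : ell.+1 <= Y) (k0 : 0 < k).
Implicit Types (s : state R).

Definition consts s := 
  [/\ imem s 0 0 = n, imem s 0 1 = k, imem s 2 0 = 1, imem s 3 0 = ell & imem s 4 0 = G] /\
  [/\ forall j, j < n + ell.+1 -> imem s 6 j = w (pos j),
      forall e, e <= ell -> imem s 7 e = 2 ^ e,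
      forall e, e <= ell -> rmem s 1 e = rate lam e
    & forall e, e <= ell -> rmem s 5 e = init_weight k G lam e].

Lemma consts_frame A B s s' :
  all (fun a => a \notin A) [:: 0; 2; 3; 4; 6; 7] -> all (fun b => b \notin B) [:: 1; 5] ->
  frame A B s s' -> consts s -> consts s'.
Proof.
move=> /= /and5P[a0 a2 a3 a4 /and3P[a6 a7 _]] /and3P[b1 b5 _] [i rr] [[H1 H2 H3 H4 H5] [H6 H7 H8 H9]].
by split; split; rewrite ?(i 0) ?(i 2) ?(i 3) ?(i 4) ?(i 6) ?(i 7) ?(rr 1) ?(rr 5).
Qed.

Definition mem_score s E j := imem s 8 (E * n + j) * imem s 4 0 + imem s 6 j * imem s 7 E.

Lemma tr_rank s e i (Q : state R -> Prop) : imem s 0 0 = n ->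
  (forall s', frame [:: 14; 15] [::] s s' -> ieval s' e = ieval s e /\ ieval s' i = ieval s i) ->
  (forall s', frame [:: 14; 15] [::] s s' ->
     imem s' 15 0 = rank n (tiebreak n (mem_score s (ieval s e))) (ieval s i) -> Q s') ->
  tr Y s (rank_cmd e i) Q.
Proof.
move=> s0 ev HQ; set E := ieval s e; set i0 := ieval s i.
set key := tiebreak n (mem_score s E).
apply: tr_seq; apply: tr_iset.
pose I j s1 := frame [:: 14; 15] [::] s s1 /\ imem s1 14 0 = j /\
  imem s1 15 0 = \sum_(h < j) (key i0 < key h).
apply: (@tr_for R Y n I) => // [j s1 _ [fr [-> _]]||j s1 jn [fr [s14 s15]]|s1 [fr [_ h]]].
- by split=> //=; case: fr => -> //.
- split; last by split=> //; rewrite /seti /= /upd /= big_ord0.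
  apply: frame_trans (_ : frame [:: 14; 15] [::] (seti 15 0 0 s) _); first exact: frame_seti.
  exact: frame_seti.
- have [ee ei] := ev _ fr.
  have K x h : ieval s1 x = h -> ieval s1 (key_ e x) = key h.
    move=> xh; rewrite /= xh ee /key /tiebreak /mem_score -/E.
    by case: fr => fi _; rewrite !fi // s0.
  have K1 := K i i0 ei; have K2 := K (var 14) j s14.
  have next v : v = (key i0 < key j) + imem s1 15 0 ->
      forall s2, frame [:: 14; 15] [::] s1 s2 -> imem s2 15 0 = v -> imem s2 14 0 = j ->
      imem s2 14 0 = j /\ I j.+1 (seti 14 0 j.+1 s2).
    move=> vE s2 fr2 s2v s2j; split=> //; split; last first.
      by rewrite /seti /= /upd /=; split=> //; rewrite s2v vE s15 big_ord_recr /= addnC.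
    apply: frame_trans fr _; apply: frame_trans fr2 _; exact: frame_seti.
  have bE : beval s1 (BILt (key_ e i) (key_ e (var 14))) = (key i0 < key j) by rewrite -K1 -K2.
  apply: tr_ite; rewrite bE => lt.
    apply: tr_iset; apply: (next (imem s1 15 0 + 1)); first by rewrite lt addnC.
    + exact: frame_seti.
    + by rewrite /seti /= /upd /=.
    + by rewrite /seti /= /upd /=.
  apply: tr_skip; apply: (next (imem s1 15 0)) => //; by rewrite (negbTE lt).
- exact: HQ.
Qed.

Lemma tr_reset s v (f : nat -> nat) (Q : state R -> Prop) : imem s 0 0 = n ->
  (forall s' j, frame [:: 8; 13] [::] s s' -> imem s' 13 0 = j -> j < n ->
     imem s' 8 (imem s 12 0 * n + j) = imem s 8 (imem s 12 0 * n + j) ->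
     ieval s' v = f (imem s 8 (imem s 12 0 * n + j))) ->
  (forall s', frame [:: 8; 13] [::] s s' ->
     (forall e i, i < n -> imem s' 8 (e * n + i) =
        if e == imem s 12 0 then f (imem s 8 (e * n + i)) else imem s 8 (e * n + i)) -> Q s') ->
  tr Y s (reset_cmd e_ v) Q.
Proof.
move=> s0 ev HQ; set E := imem s 12 0.
pose I j s1 := frame [:: 8; 13] [::] s s1 /\ imem s1 13 0 = j /\
  (forall e i, i < n -> imem s1 8 (e * n + i) =
        if (e == E) && (i < j) then f (imem s 8 (e * n + i)) else imem s 8 (e * n + i)).
apply: (@tr_for R Y n I) => // [j s1 _ [fr [-> _]]||j s1 jn [fr [s13 s8]]|s1 [fr [_ h]]].
- by split=> //=; case: fr => -> //.
- split; first exact: frame_seti.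
  by split=> // e i _; rewrite andbF.
- apply: tr_iset; have E1 : imem s1 12 0 = E by case: fr => ->.
  have vE : ieval s1 v = f (imem s 8 (E * n + j)).
    by apply: ev => //; rewrite s8 // eqxx ltnn.
  have iE : ieval s1 (idx_ e_ (var 13)) = E * n + j.
    by rewrite /= E1 s13; case: fr => -> //; rewrite s0.
  rewrite vE iE; split; first by rewrite /seti /= /upd /=.
  split.
    apply: frame_trans fr _; apply: frame_trans (frame_seti _ _ _ _ _) (frame_seti _ _ _ _ _) => //.
  rewrite /seti /= /upd /=; split=> // e i ni; rewrite eqn_row // s8 // ltnS.
  case: (eqVneq e E) => [->|_] //=; rewrite [i <= j]leq_eqVlt.
  by case: (eqVneq i j) => [->|_] //=; rewrite eqxx.
- apply: HQ => // e i ni; rewrite h // ni andbT; by [].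
Qed.

Lemma rank_tiebreak_ext f f' i : (forall j, j < n -> f j = f' j) -> i < n ->
  rank n (tiebreak n f) i = rank n (tiebreak n f') i.
Proof. by move=> ff ni; apply: eq_bigr => j _; rewrite /tiebreak !ff. Qed.

Lemma consts_score s e m : consts s -> e <= ell ->
  (forall i, i < n -> imem s 8 (e * n + i) = m i) ->
  forall i, i < n -> mem_score s e i = score G V e m i.
Proof.
move=> [[_ _ _ _ H4] [H6 H7 _ _]] el sm i ni; rewrite /mem_score /score sm // H4 H6 ?ltn_addr // H7 //.
by rewrite /V /noise ni.
Qed.

Section Expert.
Variables (t j : nat).
Hypothesis jl : j <= ell.

Let cost_seq := acost R k ell pos r w.

Lemma tr_prepare s (Q : state R -> Prop) : consts s -> imem s 0 3 = r t -> imem s 12 0 = j ->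
  (forall i, i < n -> imem s 8 (j * n + i) = counts k r j t i) ->
  imem s 9 j = t %% 4 ^ j ->
  (j = 0 -> imem s 10 0 = #|marked n (counts k r 0 t)|) ->
  (0 < j -> rmem s 2 j = stored_weight ell k G lam cost_seq t j) ->
  (forall s', frame [:: 8; 10; 13] [:: 2] s s' ->
    (forall e i, i < n -> imem s' 8 (e * n + i) =
       if e == j then before k r j t i else imem s 8 (e * n + i)) ->
    imem s' 10 0 = (if j == 0 then #|marked n (before k r 0 t)| else imem s 10 0) ->
    (forall e, rmem s' 2 e = if (e == j) && (0 < j) then weight ell k G lam cost_seq t j else rmem s 2 e) ->
    Q s') ->
  tr Y s prepare_cmd Q.
Proof.
move=> cs sr s12 s8 s9 s10 s2 HQ.
have [[c0 c1 c2 c3 c4] [c6 c7 c8 c9]] := cs.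
have rn := ltn_ord (r t).
have countE : ieval s (count_ e_ req_) = counts k r j t (r t) by rewrite /= s12 c0 sr s8.
apply: tr_ite => [/= |/=]; rewrite s12 ltnS leqn0 => j0.
  have {}j0 := eqP j0; rewrite j0 in s8 s10 HQ countE.
  have bE : beval s (BAnd (BILt (count_ e_ req_) (c_ 2)) (BNot (BILt (var 10) k_)))
     = (counts k r 0 t (r t) < 2) && (k <= #|marked n (counts k r 0 t)|).
    rewrite [LHS]/= -[X in (X < 2) && _]/(ieval s (count_ e_ req_)) countE c1 -leqNgt.
    by rewrite s10.
  apply: tr_ite; rewrite bE => cond.
    apply: tr_seq; apply: (@tr_reset s _ (fun c => 1 < c : nat)) => // [s' i fr s13 ni|s' fr s8'].
      rewrite s12 j0 => s8i.
      have -> : ieval s' (ISub (c_ 1) (ISub (c_ 2) (count_ e_ (var 13)))) = 1 - (2 - imem s' 8 (0 * n + i)).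
        have [fi _] := fr; rewrite /= s13 (fi 12) // (fi 0) // s12 j0 c0.
        by [].
      by rewrite s8i; case: (imem s 8 _) => [|[|c]].
    rewrite s12 j0 in s8'.
    apply: tr_iset; apply: HQ.
    - apply: frame_trans (frame_sub _ _ fr) (frame_seti _ _ _ _ _) => //.
      by move=> x; rewrite !inE => /orP[] ->; rewrite ?orbT.
    - move=> e i ni; rewrite /seti /= /upd /= s8' //; case: eqP => // -> .
      by rewrite s8 // /before /prepare eqxx cond.
    - rewrite /seti /= /upd /= /before /prepare eqxx cond.
      rewrite (_ : marked _ _ = finset.set0) ?cards0 //; apply/setP => i; rewrite !inE.
      by case: (1 < counts k r 0 t i).
    - by move=> e; rewrite andbF; have [_ ->] := fr.
  have pE : before k r 0 t = counts k r 0 t by rewrite /before /prepare eqxx (negbTE cond).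
  apply: tr_skip; apply: HQ => // [e i ni||e]; rewrite ?pE ?andbF //.
    by case: eqP => // ->; rewrite s8.
  by rewrite eqxx s10.
have j0' : 0 < j by rewrite lt0n.
apply: tr_ite => [/=|/=]; rewrite s12 s9 ltnS leqn0 => t4.
  apply: tr_seq; apply: (@tr_reset s _ (fun=> 0)) => // s' fr s8'.
  rewrite s12 in s8'; apply: tr_rset; apply: HQ.
  - apply: frame_trans (frame_sub _ _ fr) (frame_setr _ _ _ _ _) => //.
    by move=> x; rewrite !inE => /orP[] ->; rewrite ?orbT.
  - by move=> e i ni; rewrite s8' // /before /prepare (negbTE j0) t4.
  - by rewrite (negbTE j0); have [-> //] := fr.
  - have [fi fr'] := fr; move=> e; rewrite /= (fi 12) // s12 /upd /= (fr' 5) // j0' andbT.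
    by rewrite (fr' 2) //; case: eqP => // _; rewrite c9 // /weight t4.
apply: tr_skip; apply: HQ => // [e i ni||e].
- by case: eqP => // ->; rewrite s8 // /before /prepare (negbTE j0) (negbTE t4).
- by rewrite (negbTE j0).
- by case: (eqVneq e j) => // ->; rewrite j0' s2 // /weight (negbTE t4).
Qed.

Lemma tr_register s (Q : state R -> Prop) : consts s -> imem s 0 3 = r t -> imem s 12 0 = j ->
  (forall i, i < n -> imem s 8 (j * n + i) = before k r j t i) ->
  imem s 9 j = t %% 4 ^ j ->
  (j = 0 -> imem s 10 0 = #|marked n (before k r 0 t)|) ->
  (forall s', frame [:: 8; 9; 10] [::] s s' ->
    (forall e i, i < n -> imem s' 8 (e * n + i) =
       if e == j then counts k r j t.+1 i else imem s 8 (e * n + i)) ->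
    (forall e, imem s' 9 e = if (e == j) && (0 < j) then t.+1 %% 4 ^ j else imem s 9 e) ->
    imem s' 10 0 = (if j == 0 then #|marked n (counts k r 0 t.+1)| else imem s 10 0) ->
    Q s') ->
  tr Y s register_cmd Q.
Proof.
move=> cs sr s12 s8 s9 s10 HQ.
have [[c0 c1 c2 c3 c4] [c6 c7 c8 c9]] := cs.
have rn := ltn_ord (r t).
have countE : ieval s (count_ e_ req_) = before k r j t (r t) by rewrite /= s12 c0 sr s8.
have idxE : ieval s (idx_ e_ req_) = j * n + r t by rewrite /= s12 c0 sr.
apply: tr_ite => [/= |/=]; rewrite s12 ltnS leqn0 => j0.
  have {}j0 := eqP j0; rewrite j0 in s8 s10 HQ countE idxE.
  have bE : beval s (BILt (count_ e_ req_) (c_ 2)) = (before k r 0 t (r t) < 2) by rewrite -countE.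
  apply: tr_ite; rewrite bE => cond.
    apply: tr_seq; apply: tr_iset; rewrite idxE.
    have -> : ieval s (IAdd (count_ e_ req_) (c_ 2)) = before k r 0 t (r t) + 2 by rewrite -countE.
    apply: tr_iset; apply: HQ.
    - by apply: frame_trans (frame_seti _ _ _ _ _) (frame_seti _ _ _ _ _).
    - move=> e i ni; rewrite /seti /= /upd /= eqn_row // countsS /register eqxx cond /fupd.
      by case: eqP => [->|] //=; case: eqP => // _; rewrite s8.
    - by move=> e; rewrite andbF.
    - rewrite /seti /= /upd /= marked_counts cardsU1 (_ : _ \notin _) ?s10 ?addn1 //.
      by rewrite inE -leqNgt -ltnS.
  have pE : counts k r 0 t.+1 = before k r 0 t by rewrite countsS /register eqxx (negbTE cond).
  apply: tr_skip; apply: HQ => // [e i ni|e|]; rewrite ?pE ?andbF //.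
    by case: eqP => // ->; rewrite s8.
  by rewrite eqxx s10.
have j0' : 0 < j by rewrite lt0n.
apply: tr_seq; apply: tr_iset; rewrite idxE.
have -> : ieval s (IAdd (count_ e_ req_) (c_ 1)) = before k r j t (r t) + 1 by rewrite -countE.
set s1 := seti 8 _ _ s.
have fin v : v = t.+1 %% 4 ^ j -> Q (seti 9 j v s1).
  move=> vE; apply: HQ.
  - by apply: frame_trans (frame_seti _ _ _ _ _) (frame_seti _ _ _ _ _).
  - move=> e i ni; rewrite /seti /= /upd /= eqn_row // countsS /register (negbTE j0) /fupd.
    by case: eqP => [->|] //=; case: eqP => // _; rewrite s8.
  - by move=> e; rewrite /seti /= /upd /= j0' andbT vE.
  - by rewrite (negbTE j0).
have s1_12 : imem s1 12 0 = j by [].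
have s1_9 : imem s1 9 j = t %% 4 ^ j by [].
have s1_7 : imem s1 7 j = 2 ^ j by rewrite -c7.
clearbody s1; have e4 : 2 ^ j * 2 ^ j = 4 ^ j by rewrite -expnMn.
have := modnS_small t (_ : 0 < 4 ^ j); rewrite expn_gt0 => /(_ isT) mS.
apply: tr_ite => [|]; rewrite [beval _ _]/= s1_12 s1_9 s1_7 addn1 e4 => h; apply: tr_iset;
  rewrite [ieval _ e_]/= s1_12; apply: fin.
  by rewrite /= s1_12 s1_9 addn1 mS h.
by rewrite mS (negbTE h).
Qed.

Lemma tr_expert s (Q : state R -> Prop) : consts s -> imem s 0 3 = r t -> imem s 12 0 = j ->
  (forall i, i < n -> imem s 8 (j * n + i) = counts k r j t i) ->
  imem s 9 j = t %% 4 ^ j ->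
  (j = 0 -> imem s 10 0 = #|marked n (counts k r 0 t)|) ->
  (0 < j -> rmem s 2 j = stored_weight ell k G lam cost_seq t j) ->
  (forall s', frame [:: 8; 9; 10; 11; 13; 14; 15; 17] [:: 2] s s' ->
    (forall e i, i < n -> imem s' 8 (e * n + i) =
       if e == j then counts k r j t.+1 i else imem s 8 (e * n + i)) ->
    (forall e, imem s' 9 e = if (e == j) && (0 < j) then t.+1 %% 4 ^ j else imem s 9 e) ->
    imem s' 10 0 = (if j == 0 then #|marked n (counts k r 0 t.+1)| else imem s 10 0) ->
    (forall e, imem s' 11 e = if e == j then expert_cost k G r V j t else imem s 11 e) ->
    (forall e, rmem s' 2 e = if (e == j) && (0 < j) then weight ell k G lam cost_seq t j else rmem s 2 e) ->
    Q s') ->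
  tr Y s expert_cmd Q.
Proof.
move=> cs sr s12 s8 s9 s10 s2 HQ; have rn := ltn_ord (r t).
have c0 s' : consts s' -> imem s' 0 0 = n by case=> [[]].
apply: tr_seq; apply: tr_prepare => // s1 f1 s1_8 s1_10 s1_2.
have cs1 : consts s1 by apply: consts_frame f1 cs.
have row1 i : i < n -> imem s1 8 (j * n + i) = before k r j t i by move=> ni; rewrite s1_8 // eqxx.
have a1 x : x \notin [:: 8; 10; 13] -> imem s1 x = imem s x by case: f1 => h _; exact: h.
have ev0 s' s'' : frame [:: 14; 15] [::] s' s'' -> ieval s'' e_ = ieval s' e_ /\ ieval s'' req_ = ieval s' req_.
  by case=> h _; rewrite /= !h.
apply: tr_seq; apply: tr_rank => [|s'|s2' f2 s2_15]; [exact: c0|exact: ev0|].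
rewrite /= (a1 12) // (a1 0) // s12 sr in s2_15.
rewrite (rank_tiebreak_ext (consts_score cs1 jl row1)) // in s2_15.
have cs2 : consts s2' by apply: consts_frame f2 cs1.
have a2 x : x \notin [:: 14; 15] -> imem s2' x = imem s1 x by case: f2 => h _; exact: h.
apply: tr_seq; apply: tr_iset; set s3 := seti 17 _ _ _.
have f3 : frame [:: 17] [::] s2' s3 by exact: frame_seti.
have cs3 : consts s3 by apply: consts_frame f3 cs2.
have s3_17 : imem s3 17 0 = rank n (tiebreak n (score G V j (before k r j t))) (r t).
  by rewrite /s3 /seti /= /upd /=.
have a3 x : x \notin [:: 14; 15; 17] -> imem s3 x = imem s1 x.
  rewrite !inE !negb_or => /and3P[x1 x2 x3]; case: f3 => -> //; last by rewrite inE.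
  by move=> _; rewrite a2 // !inE negb_or x1.
apply: tr_seq; apply: tr_register => //.
- by rewrite a3 // a1.
- by rewrite a3 // a1.
- by move=> i ni; rewrite a3 // row1.
- by rewrite a3 // a1.
- by move=> j0; rewrite a3 // s1_10 j0.
move=> s4 f4 s4_8 s4_9 s4_10.
have cs4 : consts s4 by apply: consts_frame f4 cs3.
have row4 i : i < n -> imem s4 8 (j * n + i) = counts k r j t.+1 i by move=> ni; rewrite s4_8 // eqxx.
have a4 x : x \notin [:: 8; 9; 10] -> imem s4 x = imem s3 x by case: f4 => h _; exact: h.
apply: tr_seq; apply: tr_rank => [|s'|s5 f5 s5_15]; [exact: c0|exact: ev0|].
rewrite /= !a4 // !a3 // !a1 // s12 sr in s5_15.
rewrite (rank_tiebreak_ext (consts_score cs4 jl row4)) // in s5_15.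
have a5 x : x \notin [:: 14; 15] -> imem s5 x = imem s4 x by case: f5 => h _; exact: h.
have s5_12 : imem s5 12 0 = j by rewrite a5 // a4 // a3 // a1.
have s5_17 : imem s5 17 0 = rank n (tiebreak n (score G V j (before k r j t))) (r t) by rewrite a5 // a4.
have s5_k : imem s5 0 1 = k by rewrite a5 //; case: cs4 => [[]].
have r5 : rmem s5 2 = rmem s1 2.
  by case: f5 => _ ->; [case: f4 => _ ->; [case: f2 => _ ->|]|].
have fin v : v = expert_cost k G r V j t -> Q (seti 11 j v s5).
  move=> vE; apply: HQ.
  - split=> [x nx|b nb].
      rewrite /seti /=; move: nx; rewrite !inE !negb_or => /and5P[x8 x9 x10 x11 /and4P[x13 x14 x15 x17]].
      apply/funext => y; rewrite /upd (negbTE x11) /= a5 ?inE ?negb_or ?x14 // a4 ?inE ?negb_or ?x8 ?x9 //.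
      by rewrite a3 ?inE ?negb_or ?x14 ?x15 // a1 // !inE !negb_or x8 x10.
    by rewrite /seti /=; case: f5 => _ -> //; case: f4 => _ -> //; case: f2 => _ -> //; case: f1 => _ ->.
  - move=> e i ni; rewrite /seti /= /upd /= a5 // s4_8 //; case: eqP => // ej.
    by rewrite a3 // s1_8 //; case: eqP.
  - by move=> e; rewrite /seti /= /upd /= a5 // s4_9 a3 // a1.
  - by rewrite /seti /= /upd /= a5 // s4_10 a3 // s1_10; case: eqP.
  - move=> e; rewrite /seti /= /upd /=; case: eqP => [_ //|_].
    by rewrite a5 // a4 // a3 // a1.
  - by move=> e; rewrite /seti /= r5 s1_2.
have topE m : (r t \in expert_cache n k G V j m) = (rank n (tiebreak n (score G V j m)) (r t) < k).
  by rewrite inE.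
rewrite /expert_cost !topE in fin.
apply: tr_ite => /=; rewrite s5_15 s5_k => h1; last first.
  by apply: tr_iset; rewrite /= s5_12; apply: fin; rewrite (negbTE h1).
apply: tr_ite => /=; rewrite s5_17 s5_k => h2; apply: tr_iset; rewrite /= s5_12; apply: fin.
  by rewrite h1 h2.
by rewrite h1 h2.
Qed.

End Expert.

End RoundCorrect.

Section RoundInvariant.
Variables (R : realType) (n k ell Y : nat) (pos : nat -> nat) (r : nat -> 'I_n) (lam : R).
Variable w : nat -> nat.
Let G := 2 ^ (4 * ell).
Let V := noise n pos w.
Hypotheses (nY : n <= Y) (ellY : ell.+1 <= Y) (k0 : 0 < k).
Implicit Types (s : state R).

Let a := acost R k ell pos r w.
Local Notation consts := (consts n k ell pos lam w).
Local Notation stored := (stored_weight ell k G lam a).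
Local Notation weight := (weight ell k G lam a).
Local Notation mix := (mix ell k G lam a).
Local Notation sel := (sel k ell pos r lam w).

Definition round_inv t s :=
  [/\ consts s,
      forall e i, e <= ell -> i < n -> imem s 8 (e * n + i) = counts k r e t i,
      forall e, e <= ell -> imem s 9 e = t %% 4 ^ e,
      imem s 10 0 = #|marked n (counts k r 0 t)|
    & forall e, 0 < e <= ell -> rmem s 2 e = stored t e].

Lemma tr_experts t s (Q : state R -> Prop) : round_inv t s -> imem s 0 3 = r t ->
  (forall s', consts s' ->
      (forall e i, e <= ell -> i < n -> imem s' 8 (e * n + i) = counts k r e t.+1 i) ->
      (forall e, e <= ell -> imem s' 9 e = t.+1 %% 4 ^ e) ->
      imem s' 10 0 = #|marked n (counts k r 0 t.+1)| ->
      (forall e, e <= ell -> imem s' 11 e = expert_cost k G r V e t) ->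
      (forall e, 0 < e <= ell -> rmem s' 2 e = weight t e) -> Q s') ->
  tr Y s (For 12 (IAdd ell_ (c_ 1)) expert_cmd) Q.
Proof.
move=> [cs s8 s9 s10 s2] sr HQ.
pose I j s1 := [/\ consts s1 /\ imem s1 0 3 = r t, imem s1 12 0 = j,
   [/\ forall e i, e <= ell -> i < n -> imem s1 8 (e * n + i) = counts k r e (if e < j then t.+1 else t) i,
      forall e, e <= ell -> imem s1 9 e = (if e < j then t.+1 else t) %% 4 ^ e &
      imem s1 10 0 = #|marked n (counts k r 0 (if 0 < j then t.+1 else t))|],
   (forall e, e < j -> imem s1 11 e = expert_cost k G r V e t)
   & forall e, 0 < e <= ell -> rmem s1 2 e = if e < j then weight t e else stored t e].
apply: (@tr_for R Y ell.+1 I) => // [j s1 _ [[cs1 _] s12 _ _ _]|j s1 jl [[cs1 sr1] s12 [s18 s19 s110] s111 s12']|s1 [[cs1 _] _ [s18 s19 s110] s111 s12']].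
- by split=> //=; case: cs1 => [[_ _ _ -> _] _]; rewrite addn1.
- rewrite ltnS in jl; apply: (@tr_expert R n k ell Y pos r lam w nY t j jl) => //.
  + by move=> i ni; rewrite s18 // ltnn.
  + by rewrite s19 // ltnn.
  + by move=> j0; rewrite s110 j0.
  + by move=> j0; rewrite s12' ?j0 // ltnn.
  move=> s' f' s'8 s'9 s'10 s'11 s'2; split; first by have [-> //] := f'.
  have lej e : (e < j.+1) = (e == j) || (e < j) by rewrite ltnS leq_eqVlt.
  split=> //.
  + split; last by have [fi _] := f'; rewrite /seti /= /upd /= fi.
    have f2 : frame [:: 8; 9; 10; 11; 12; 13; 14; 15; 17] [:: 2] s1 (seti 12 0 j.+1 s').
      apply: frame_trans (frame_sub _ _ f') (frame_seti _ _ _ _ _) => //.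
      by move=> x; rewrite !inE => /orP[->|/orP[->|/orP[->|/orP[->|/orP[->|/orP[->|/orP[->|->]]]]]]]; rewrite ?orbT.
    by apply: consts_frame f2 cs1.
  + split=> [e i el ni|e el|].
    * rewrite /seti /= /upd /= s'8 // lej; case: eqP => [-> //|_]; by rewrite s18.
    * rewrite /seti /= /upd /= s'9 lej; case: (eqVneq e j) => [->|_] /=; last by rewrite s19.
      by case: (posnP j) => [j0|//]; rewrite s19 ?j0 // expn0 !modn1.
    * rewrite /seti /= /upd /= s'10; case: eqP => [//|/eqP j0].
      by rewrite s110 lt0n j0.
  + move=> e; rewrite lej /seti /= /upd /= s'11; case: eqP => [-> //|_] /=; exact: s111.
  + move=> e e0; rewrite /seti /= s'2 lej; case: (eqVneq e j) => [ej|_] /=; last by rewrite s12'.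
    by rewrite ej in e0; rewrite ej; case/andP: e0 => ->.
- apply: HQ => // [e i el ni|e el|e e0].
  + by rewrite s18 // ltnS el.
  + by rewrite s19 // ltnS el.
  + by rewrite s12' // ltnS; case/andP: e0 => _ ->.
Qed.

Lemma tr_combine t s (Q : state R -> Prop) : consts s ->
  (forall e, e <= ell -> imem s 11 e = expert_cost k G r V e t) ->
  (forall e, 0 < e <= ell -> rmem s 2 e = weight t e) ->
  (forall s', frame [:: 16; 20] [:: 2; 3; 4; 6] s s' ->
     imem s' 16 0 = sel t ell ->
     (forall e, 0 < e <= ell -> rmem s' 2 e = stored t.+1 e) -> Q s') ->
  tr Y s combine_cmd Q.
Proof.
move=> cs s11 s2 HQ.
apply: tr_seq; apply: tr_rset; apply: tr_seq; apply: tr_iset.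
set s0 := seti 16 _ _ _.
have f0 : frame [:: 16] [:: 3] s s0.
  by apply: frame_trans (frame_setr _ _ _ _ _) (frame_seti _ _ _ _ _).
have s03 : rmem s0 3 0 = mix 0 t by rewrite /s0 /= /upd /= s11.
have s016 : imem s0 16 0 = sel t 0 by [].
clearbody s0.
pose I l s1 := [/\ frame [:: 16; 20] [:: 2; 3; 4; 6] s s1, imem s1 20 0 = l,
   imem s1 16 0 = sel t l, rmem s1 3 0 = mix l t
   & forall e, 0 < e <= ell -> rmem s1 2 e = if ell - l < e then stored t.+1 e else weight t e].
have cst s1 : frame [:: 16; 20] [:: 2; 3; 4; 6] s s1 -> consts s1.
  by move=> f; apply: consts_frame f cs.
apply: (@tr_for R Y ell I) => [||||s1 [f1 _ h16 _ h2]].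
- exact: ltnW.
- by move=> l s1 _ [/cst[[_ _ _ h _] _] h20 _ _ _].
- split=> //.
  + apply: frame_trans (frame_sub _ _ f0) (frame_seti _ _ _ _ _) => //.
      by move=> x; rewrite !inE => ->.
    by move=> x; rewrite !inE => ->; rewrite orbT.
  + move=> e /andP[e0 el]; rewrite /seti /= subn0 ltnNge el /=; case: f0 => _ -> //.
    by rewrite s2 // e0.
- move=> l s1 ll [f1 h20 h16 h3 h2].
  have [[c0 c1 c2 c3 c4] [c6 c7 c8 c9]] := cst _ f1.
  set e := ell - l; have el : 0 < e <= ell by rewrite /e; lia.
  have le : ell - e = l by rewrite /e subKn // ltnW.
  have wE : rmem s1 2 e = weight t e by rewrite h2 // -/e ltnn.
  have scE : ieval s1 scale_ = e by rewrite /= c3 h20.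
  set x := (mix l t - a e t)%R.
  have xE : x = advantage ell a (weight t) t e by rewrite /x /advantage le.
  have coinE : beval s1 (BRLt (RMul (RNat (IAdd (IGet 6 (IAdd n_ scale_)) (c_ 1)))
                          (RAdd (RNat (c_ 1)) w_))
                    (RMul (RNat g_) w_)) = coin k ell pos r lam w e t.
    rewrite /= c3 h20 -/e wE c0 c4 c6 //; last by case/andP: el; lia.
  (* Both outcomes of the coin test continue with the same code, whose effect is established once
     for either state. *)
  have stepQ s2' : frame [:: 16; 20] [:: 2; 3; 4; 6] s s2' -> imem s2' 20 0 = l ->
      imem s2' 16 0 = sel t l.+1 -> rmem s2' 3 0 = mix l t -> rmem s2' 2 = rmem s1 2 ->
      tr Y s2' (Seq (RSet 4 (c_ 0) (RSub (rv_ 3) (RNat (IGet 11 scale_))))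
    (Seq (Ite (BRLt (rv_ 4) (RNat (c_ 0)))
              (RSet 6 (c_ 0) (RSub (RNat (c_ 0)) (rv_ 4)))
              (RSet 6 (c_ 0) (rv_ 4)))
    (Seq (RSet 3 (c_ 0) (RSub (rv_ 3)
            (RMul (RDiv w_ (RAdd (RNat (c_ 1)) w_)) (rv_ 4))))
         (RSet 2 scale_ (RMul w_ (RAdd (RNat (c_ 1)) (RMul (RGet 1 scale_)
            (RSub (rv_ 4) (RMul (RMul (RMul (RNat (c_ 4)) (RNat k_)) (RGet 1 scale_))
                                (rv_ 6))))))))))
      (fun s2 => imem s2 20 0 = l /\ I l.+1 (seti 20 0 l.+1 s2)).
    move=> f2 g20 g16 g3 g2.
    have [[d0 d1 d2 d3 d4] [d6 d7 d8 d9]] := cst _ f2.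
    have g11 : imem s2' 11 e = expert_cost k G r V e t.
      by case: f2 => -> // _; apply: s11; case/andP: el.
    apply: tr_seq; apply: tr_rset; rewrite /= d3 g20 -/e g11 g3.
    set s3 := setr 4 _ _ _.
    have s34 : rmem s3 4 0 = x by rewrite /s3 /= /upd.
    have f3 : frame [::] [:: 4] s2' s3 by exact: frame_setr.
    clearbody s3.
    have a3 y : imem s3 y = imem s2' y by case: f3 => ->.
    have b3 y : y != 4 -> rmem s3 y = rmem s2' y by move=> y4; case: f3 => _ ->; rewrite ?inE.
    apply: tr_seq; apply: (@tr_weaken R Y s3 _ (fun s4 => frame [::] [:: 6] s3 s4 /\ rmem s4 6 0 = `|x|%R)).
      move=> s4 [f4 s46].
      have a4 y : imem s4 y = imem s3 y by case: f4 => ->.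
      have b4 y : y != 6 -> rmem s4 y = rmem s3 y by move=> y4; case: f4 => _ ->; rewrite ?inE.
      apply: tr_seq; apply: tr_rset; apply: tr_rset.
      set v3 := reval s4 _; set s5 := setr 3 0 v3 s4.
      have v3E : v3 = mix l.+1 t.
        rewrite /v3 /= !a4 !a3 d3 g20 -/e (b4 4) // s34 (b4 3) // (b3 3) // g3 (b4 2) // (b3 2) // g2 wE mixS -/e /prob /mixing //.
      have f5 : frame [::] [:: 3] s4 s5 by exact: frame_setr.
      have s53 : rmem s5 3 0 = v3 by [].
      clearbody s5 v3.
      have a5 y : imem s5 y = imem s4 y by case: f5 => ->.
      have b5 y : y != 3 -> rmem s5 y = rmem s4 y by move=> y4; case: f5 => _ ->; rewrite ?inE.
      have s5e : ieval s5 scale_ = e by rewrite /= !a5 !a4 !a3 d3 g20.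
      set v2 := reval s5 _; rewrite s5e; set s6 := setr 2 e v2 s5.
      have v2E : v2 = stored t.+1 e.
        rewrite /v2 [LHS]/= !a5 !a4 !a3 d3 g20 -/e (b5 2) // (b4 2) // (b3 2) // g2 wE (b5 4) // (b4 4) // s34 (b5 6) // s46 (b5 1) // (b4 1) // (b3 1) // d1 d8; last by case/andP: el.
        by rewrite stored_weightS xE.
      have f6 : frame [::] [:: 2] s5 s6 by exact: frame_setr.
      have s62 y : rmem s6 2 y = if y == e then stored t.+1 e else rmem s1 2 y.
        by rewrite /s6 /= /upd /= v2E b5 // b4 // b3 // g2.
      clearbody s6; clear v2 v2E.
      have a6 y : imem s6 y = imem s2' y by case: f6 => -> // _; rewrite a5 a4.
      split; first by rewrite a6.
      split=> //=.
      + apply: frame_trans f2 _; apply: frame_trans (frame_sub _ _ f3) _ => //.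
          by move=> y; rewrite !inE => ->; rewrite ?orbT.
        apply: frame_trans (frame_sub _ _ f4) _ => //.
          by move=> y; rewrite !inE => ->; rewrite ?orbT.
        apply: frame_trans (frame_sub _ _ f5) _ => //.
          by move=> y; rewrite !inE => ->; rewrite ?orbT.
        apply: frame_trans (frame_sub _ _ f6) _ => //.
          by move=> y; rewrite !inE => ->; rewrite ?orbT.
        exact: frame_seti.
      + by rewrite /upd /= a6.
      + by case: f6 => _ -> //; rewrite s53.
      + move=> y yl; rewrite s62; case: (eqVneq y e) => [->|ye].
          by rewrite (_ : ell - l.+1 < e) // /e; lia.
        rewrite h2 // -/e; congr (if _ then _ else _); move: yl ye; rewrite /e; lia.
    apply: tr_ite => /=; rewrite s34 => x0; apply: tr_rset; split; rewrite ?s34.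
    + exact: frame_setr.
    + by rewrite /= /upd /= s34 ltr0_norm // sub0r.
    + exact: frame_setr.
    + by rewrite /= /upd /= s34 ger0_norm // leNgt.
  apply: tr_seq; apply: tr_ite; rewrite coinE => cE.
    apply: tr_iset; rewrite scE; apply: stepQ => //.
    + by apply: frame_trans f1 _; exact: frame_seti.
    + by rewrite /seti /= /upd /= -/e cE.
  by apply: tr_skip; apply: stepQ => //; rewrite h16 /= -/e (negbTE cE).
- by apply: HQ => // e e0; rewrite h2 // subnn; case/andP: e0 => ->.
Qed.

Lemma tr_output s E m (Q : state R -> Prop) : consts s -> E <= ell -> imem s 16 0 = E ->
  (forall i, i < n -> imem s 8 (E * n + i) = m i) ->
  (forall s', frame [:: 1; 13; 14; 15] [::] s s' ->
     read_cache n s' = expert_cache n k G V E m -> Q s') ->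
  tr Y s output_cmd Q.
Proof.
move=> cs El s16 s8 HQ.
have [[c0 c1 _ _ _] _] := cs.
pose I j s1 := [/\ frame [:: 1; 13; 14; 15] [::] s s1, imem s1 13 0 = j
  & forall i, i < j -> (imem s1 1 i != 0) = (rank n (tiebreak n (score G V E m)) i < k)].
apply: (@tr_for R Y n I) => // [j s1 _ [[fi _] -> _]||j s1 jn [f1 s13 s1E]|s1 [f1 _ s1E]].
- by split=> //=; rewrite fi.
- by split=> //; exact: frame_seti.
- have cs1 : consts s1 by apply: consts_frame f1 cs.
  have [[d0 d1 _ _ _] _] := cs1.
  have E1 : imem s1 16 0 = E by case: f1 => ->.
  have row i : i < n -> imem s1 8 (E * n + i) = m i by case: f1 => -> // _; exact: s8.
  apply: tr_seq; apply: (@tr_rank R n Y nY) => // [s2 [fi _]|s2 f2 s15].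
    by rewrite /= !fi.
  rewrite /= E1 s13 (rank_tiebreak_ext (consts_score cs1 El row)) // in s15.
  have a2 x : x \notin [:: 14; 15] -> imem s2 x = imem s1 x by case: f2 => h _; exact: h.
  have fin v : (v != 0) = (rank n (tiebreak n (score G V E m)) j < k) ->
      imem (seti 1 j v s2) 13 0 = j /\ I j.+1 (seti 13 0 j.+1 (seti 1 j v s2)).
    move=> vE; split; first by rewrite /seti /= /upd /= a2.
    split=> //.
    + apply: frame_trans f1 _; apply: frame_trans (frame_sub _ _ f2) _ => //.
        by move=> y; rewrite !inE => /orP[] ->; rewrite ?orbT.
      by apply: frame_trans (frame_seti _ _ _ _ _) (frame_seti _ _ _ _ _).
    + move=> i ij; rewrite /seti /= /upd /=; case: (eqVneq i j) => [->|nij]; first exact: vE.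
      by rewrite a2 // s1E // ltn_neqAle nij.
  by apply: tr_ite => /=; rewrite s15 a2 // d1 => lt; apply: tr_iset; rewrite /= a2 // s13;
    apply: fin; rewrite ?lt // (negbTE lt).
- apply: HQ => //; apply/setP => i; rewrite !inE s1E //.
Qed.

Lemma sel_le t l : sel t l <= ell.
Proof. by elim: l => //= l IH; case: ifP => // _; exact: leq_subr. Qed.

Lemma round_ok t s : round_inv t s -> imem s 0 3 = r t ->
  tr Y s round_cmd (fun s' => round_inv t.+1 s' /\ read_cache n s' = alg_set k ell pos r lam w t).
Proof.
move=> inv sr; apply: tr_seq; apply: (tr_experts inv sr) => s1 cs1 s1_8 s1_9 s1_10 s1_11 s1_2.
apply: tr_seq; apply: (tr_combine cs1 s1_11 s1_2) => s2 f2 s2_16 s2_2.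
have cs2 : consts s2 by apply: consts_frame f2 cs1.
have a2 x : x \notin [:: 16; 20] -> imem s2 x = imem s1 x by case: f2 => h _; exact: h.
apply: (tr_output cs2 (sel_le t ell) s2_16 (m := counts k r (sel t ell) t.+1)) => [i ni|s3 f3 ->].
  by rewrite a2 // s1_8 // sel_le.
have a3 x : x \notin [:: 1; 13; 14; 15] -> imem s3 x = imem s2 x by case: f3 => h _; exact: h.
split=> //; split.
- by apply: consts_frame f3 cs2.
- by move=> e i el ni; rewrite a3 // a2 // s1_8.
- by move=> e el; rewrite a3 // a2 // s1_9.
- by rewrite a3 // a2.
- by move=> e el; case: f3 => _ -> //; exact: s2_2.
Qed.

End RoundInvariant.

(** * Initialisation in the first round *)

Section Init.
Variables (R : realType) (n k T Y : nat).
Hypotheses (k0 : 0 < k) (kn : k <= n) (T0 : 0 < T).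
Let ell := (trunc_log 2 (n * T)).+1.
Let G := 2 ^ (4 * ell).
Hypotheses (fourellY : 4 * ell <= Y) (dY : n + ell.+1 <= Y).
Implicit Types (s : state R) (w : nat -> R).

Lemma tr_sizes s (Q : state R -> Prop) : imem s 0 0 = n -> imem s 0 2 = T ->
  (forall s', frame [:: 2; 3; 4; 5; 12] [::] s s' ->
     imem s' 2 0 = 1 -> imem s' 3 0 = ell -> imem s' 4 0 = G -> imem s' 12 0 = 0 -> Q s') ->
  tr Y s sizes_cmd Q.
Proof.
move=> sn sT HQ; have nT : 0 < n * T by rewrite muln_gt0 T0 (leq_trans k0 kn).
have /andP[lo hi] := trunc_log_bounds (isT : 1 < 2) nT.
do 3 (apply: tr_seq; apply: tr_iset); set s1 := seti 5 _ _ _; apply: tr_seq.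
pose I j s2 := [/\ frame [:: 2; 3; 4; 5; 12] [::] s s2, imem s2 2 0 = 1, imem s2 3 0 = j & imem s2 5 0 = 2 ^ j].
apply: (@tr_while R Y ell I) => [|||s2].
- by lia.
- split=> //; rewrite /s1.
  by apply: frame_trans (frame_seti _ _ _ _ _) (frame_trans (frame_seti _ _ _ _ _) (frame_seti _ _ _ _ _)).
- move=> j s2 jl [f2 s22 s23 s25].
  have a2 x : x \notin [:: 2; 3; 4; 5; 12] -> imem s2 x = imem s x by case: f2 => h _; exact: h.
  split.
    rewrite /= a2 // sn sT s25 -leqNgt; apply: leq_trans lo.
    by rewrite leq_exp2l.
  apply: tr_seq; apply: tr_iset; apply: tr_iset; split=> //.
  + apply: frame_trans f2 _; apply: frame_trans (frame_seti _ _ _ _ _) (frame_seti _ _ _ _ _) => //.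
  + by rewrite /seti /= /upd /= s23 addn1.
  + by rewrite /seti /= /upd /= s25 expnS.
- move=> [f2 s22 s23 s25].
  have a2 x : x \notin [:: 2; 3; 4; 5; 12] -> imem s2 x = imem s x by case: f2 => h _; exact: h.
  split; first by rewrite /= a2 // sn sT s25 hi.
  apply: tr_seq; apply: tr_iset; apply: tr_iset; apply: HQ => //.
  + apply: frame_trans f2 _; apply: frame_trans (frame_seti _ _ _ _ _) (frame_seti _ _ _ _ _) => //.
  + by rewrite /seti /= /upd /= s25 /G -!expnD; congr (_ ^ _); lia.
Qed.

(** An iteration takes 4 steps: loop test, unfolding of the sequence, [Sample], increment. The third
    one reads the sample, hence the index [4 * j + 2]. *)
Lemma run_samples s w K M : imem s 0 0 = n -> imem s 3 0 = ell -> imem s 12 0 = 0 ->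
  M = n + ell.+1 ->
  exists s', [/\ run w (4 * M).+1 (sample_cmd :: K, s) = (K, s'), frame [:: 12] [:: 0] s s'
     & forall j, j < M -> rmem s' 0 j = w (4 * j + 2)].
Proof.
move=> sn sl s12 ME.
have H j : j <= M -> exists s', [/\ run w (4 * j) (sample_cmd :: K, s) = (sample_cmd :: K, s'),
    frame [:: 12] [:: 0] s s', imem s' 12 0 = j & forall i, i < j -> rmem s' 0 i = w (4 * i + 2)].
  elim: j => [_|j IH jM]; first by exists s.
  have [s1 [r1 f1 s1_12 s1_0]] := IH (ltnW jM).
  have a1 x : x \notin [:: 12] -> imem s1 x = imem s x by case: f1 => h _; exact: h.
  exists (seti 12 0 j.+1 (setr 0 j (w (4 * j + 2)) s1)); split=> //.
  - rewrite (_ : 4 * j.+1 = 4 * j + 4); last by lia.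
    rewrite run_add r1 /= s1_12 !a1 // sn sl addn1 -ME jM /= s1_12 addn1.
    by rewrite addn2.
  - apply: frame_trans f1 _; apply: frame_trans (frame_setr _ _ _ _ _) (frame_seti _ _ _ _ _) => //.
  - move=> i; rewrite ltnS /seti /setr /= /upd /= => ij; case: (eqVneq i j) => [-> //|nij].
    by rewrite s1_0 // ltn_neqAle nij.
have [s1 [r1 f1 s1_12 s1_0]] := H M (leqnn _).
have a1 x : x \notin [:: 12] -> imem s1 x = imem s x by case: f1 => h _; exact: h.
exists s1; split=> //.
rewrite -[(4 * M).+1]addn1 run_add r1 /= s1_12 !a1 // sn sl addn1 -ME ltnn //.
Qed.

Lemma tr_digits s u (Q : state R -> Prop) : imem s 0 0 = n -> imem s 3 0 = ell ->
  (forall j, j < n + ell.+1 -> rmem s 0 j = u j) ->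
  (forall s', frame [:: 6; 12; 18; 19] [:: 0] s s' ->
     (forall j, j < n + ell.+1 -> imem s' 6 j = dig (4 * ell) (u j)) -> Q s') ->
  tr Y s digits_cmd Q.
Proof.
move=> sn sl su HQ.
pose I j s1 := [/\ frame [:: 6; 12; 18; 19] [:: 0] s s1, imem s1 12 0 = j,
   forall i, j <= i < n + ell.+1 -> rmem s1 0 i = u i
   & forall i, i < j -> imem s1 6 i = dig (4 * ell) (u i)].
apply: (@tr_for R Y (n + ell.+1) I) => // [j s1 _ [[fi _] -> _ _]||j s1 jM [f1 s12 s1u s16]|s1 [f1 _ _ s16]].
- by split=> //=; rewrite !fi // sn sl addn1.
- split=> //; first exact: frame_seti.
- apply: tr_seq; apply: tr_iset; apply: tr_seq.
  (* The sample cell is overwritten by the remaining fraction, so that it forms with array 18 the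
     state of [dig_iter]. *)
  pose L i s2 := [/\ frame [:: 6; 12; 18; 19] [:: 0] s s2 /\ imem s2 6 = imem s1 6,
     imem s2 12 0 = j, imem s2 19 0 = i,
     dig_iter (u j) i = (imem s2 18 0, rmem s2 0 j)
     & forall i', j < i' < n + ell.+1 -> rmem s2 0 i' = u i'].
  apply: (@tr_for R Y (4 * ell) L) => // [i s2 _ [[[fi _] _] _ -> _ _]||i s2 il [[f2 s26] s212 s219 di s2u]|s2 [[f2 s26] s212 _ di s2u]].
  + by split=> //=; rewrite fi // sl.
  + split=> //.
    * split=> //; apply: frame_trans f1 _; apply: frame_trans (frame_seti _ _ _ _ _) (frame_seti _ _ _ _ _) => //.
    * by rewrite /dig_iter /= s1u // leqnn.
    * by move=> i' /andP[ji' i'M]; rewrite /= s1u // ltnW.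
  + apply: tr_seq; apply: tr_rset; rewrite /= s212.
    have dS : dig_iter (u j) i.+1 = dig_step (imem s2 18 0, rmem s2 0 j) by rewrite -di.
    set s3 := setr 0 j _ s2.
    have f3 : frame [::] [:: 0] s2 s3 by exact: frame_setr.
    have s3j : rmem s3 0 j = (2 * rmem s2 0 j)%R by rewrite /s3 /= /upd /= eqxx.
    have s3i i' : i' != j -> rmem s3 0 i' = rmem s2 0 i' by rewrite /s3 /= /upd /= => /negbTE ->.
    clearbody s3; have a3 x : imem s3 x = imem s2 x by case: f3 => ->.
    have fr s4 : frame [:: 18] [:: 0] s3 s4 -> frame [:: 6; 12; 18; 19] [:: 0] s s4.
      move=> f4; apply: frame_trans f2 _; apply: frame_trans (frame_sub _ _ f3) (frame_sub _ _ f4) => //.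
      by move=> y; rewrite !inE => ->; rewrite ?orbT.
    apply: tr_ite; rewrite [beval _ _]/= a3 s212 s3j => cond.
      apply: tr_iset; set s5 := seti 18 _ _ _.
      have s5_18 : imem s5 18 0 = 2 * imem s2 18 0 by rewrite /s5 /seti /= /upd /= a3.
      have s5a x : x != 18 -> imem s5 x = imem s2 x.
        by move=> nx; rewrite -a3; apply/funext => y; rewrite /s5 /seti /= /upd (negbTE nx).
      have s5r : rmem s5 = rmem s3 by [].
      have f5 : frame [:: 18] [:: 0] s3 s5 by exact: frame_seti.
      clearbody s5; split; first by rewrite s5a.
      split=> //; rewrite /seti /= /upd /=.
      * split; last by apply/funext => y; rewrite s5a // s26.
        by apply: frame_trans (fr _ f5) (frame_seti _ _ _ _ _).
      * by rewrite s5a.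
      * by rewrite -[LHS]/(dig_iter (u j) i.+1) dS /dig_step cond s5_18 s5r s3j.
      * by move=> i' i'j; rewrite s5r s3i ?s2u //; lia.
    apply: tr_seq; apply: tr_rset; rewrite [ieval _ e_]/= a3 s212; apply: tr_iset.
    rewrite [reval _ _]/= a3 s212 s3j; set s5 := seti 18 _ _ _.
    have s5_18 : imem s5 18 0 = 2 * imem s2 18 0 + 1 by rewrite /s5 /seti /= /upd /= a3.
    have s5a x : x != 18 -> imem s5 x = imem s2 x.
      by move=> nx; rewrite -a3; apply/funext => y; rewrite /s5 /seti /= /upd (negbTE nx).
    have s5j : rmem s5 0 j = (2 * rmem s2 0 j - 1)%R by rewrite /s5 /= /upd /= eqxx.
    have s5i i' : i' != j -> rmem s5 0 i' = rmem s2 0 i'.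
      by move=> ij; rewrite /s5 /= /upd /= (negbTE ij) s3i.
    have f5 : frame [:: 18] [:: 0] s3 s5.
      by apply: frame_trans (frame_setr _ _ _ _ _) (frame_seti _ _ _ _ _).
    clearbody s5; split; first by rewrite s5a.
    split=> //; rewrite /seti /= /upd /=.
    * split; last by apply/funext => y; rewrite s5a // s26.
      by apply: frame_trans (fr _ f5) (frame_seti _ _ _ _ _).
    * by rewrite s5a.
    * by rewrite -[LHS]/(dig_iter (u j) i.+1) dS /dig_step (negbTE cond) s5_18 s5j.
    * by move=> i' i'j; rewrite s5i ?s2u //; lia.
  + apply: tr_iset; rewrite /= s212; split; first by rewrite /seti /= /upd /=.
    split=> //.
    * by apply: frame_trans f2 _; apply: frame_trans (frame_seti _ _ _ _ _) (frame_seti _ _ _ _ _).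
    * move=> i ij; rewrite /seti /= /upd /=; case: (eqVneq i j) => [->|nij].
        by rewrite /dig di.
      by rewrite s26 s16 // ltn_neqAle nij.
- exact: HQ.
Qed.

Let lam : R := Num.sqrt ell%:R.

Lemma tr_scales s (Q : state R -> Prop) : imem s 0 1 = k -> imem s 3 0 = ell -> imem s 4 0 = G ->
  (forall s', frame [:: 5; 7; 12] [:: 1; 5; 7] s s' ->
     (forall e, e <= ell -> [/\ imem s' 7 e = 2 ^ e, rmem s' 1 e = rate lam e
        & rmem s' 5 e = init_weight k G lam e]) -> Q s') ->
  tr Y s scales_cmd Q.
Proof.
move=> sk sl sG HQ; apply: tr_seq; apply: tr_rset.
rewrite [ieval _ _]/= [reval _ _]/= sl div1r powR12_sqrt // -/lam.
apply: tr_seq; apply: tr_iset; set s0 := seti 5 _ _ _.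
pose I j s1 := [/\ frame [:: 5; 7; 12] [:: 1; 5; 7] s s1, imem s1 12 0 = j, imem s1 5 0 = 2 ^ j,
  rmem s1 7 0 = lam & forall e, e < j -> [/\ imem s1 7 e = 2 ^ e, rmem s1 1 e = rate lam e
        & rmem s1 5 e = init_weight k G lam e]].
apply: (@tr_for R Y ell.+1 I) => [|j s1 _ [[fi _] -> _ _ _]||j s1 jl [f1 s12 s15 s1l s1e]|s1 [f1 _ _ _ h]].
- by lia.
- by split=> //=; rewrite fi // sl addn1.
- split=> //; by apply: frame_trans (frame_setr _ _ _ _ _) (frame_trans (frame_seti _ _ _ _ _) (frame_seti _ _ _ _ _)).
- have a1 x : x \notin [:: 5; 7; 12] -> imem s1 x = imem s x by case: f1 => h _; exact: h.
  apply: tr_seq; apply: tr_iset; rewrite /= s12 s15.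
  apply: tr_seq; apply: tr_rset; rewrite /= /upd /= s12 s15 s1l.
  set s3 := setr 1 _ _ _.
  have f3 : frame [:: 7] [:: 1] s1 s3.
    by apply: frame_trans (frame_seti _ _ _ _ _) (frame_setr _ _ _ _ _).
  have s37 e : imem s3 7 e = if e == j then 2 ^ j else imem s1 7 e by [].
  have s31 e : rmem s3 1 e = if e == j then rate lam j else rmem s1 1 e.
    by rewrite /s3 /= /upd /= /rate natrX.
  clearbody s3.
  have a3 x : x != 7 -> imem s3 x = imem s1 x by move=> x7; case: f3 => -> //; rewrite inE.
  have b3 x : x != 1 -> rmem s3 x = rmem s1 x by move=> x1; case: f3 => _ -> //; rewrite inE.
  apply: tr_seq; apply: (@tr_weaken R Y s3 _ (fun s4 => s4 = setr 5 j (init_weight k G lam j) s3)).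
    move=> s4 s4E.
    apply: tr_iset; rewrite s4E; split; first by rewrite /= /upd /= a3.
    split=> //.
    + apply: frame_trans f1 _; apply: frame_trans (frame_sub _ _ f3) _ => //.
        by move=> y; rewrite !inE => ->; rewrite ?orbT.
        by move=> y; rewrite !inE => ->; rewrite ?orbT.
      by apply: frame_trans (frame_setr _ _ _ _ _) (frame_trans (frame_seti _ _ _ _ _) (frame_seti _ _ _ _ _)).
    + by rewrite /= /upd /= a3 // s15 expnS.
    + by rewrite /= /upd /= b3.
    + move=> e ej; rewrite /= /upd /= s37 s31 b3 //; case: (eqVneq e j) => [->//|nej].
      by apply: s1e; rewrite ltn_neqAle nej.
  have bE : beval s3 (BRLt (RNat (var 5)) (RMul (RMul (RNat (c_ 8)) (RNat k_)) (rv_ 7)))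
      = (2 ^+ j < 8 * k%:R * lam :> R)%R.
    by rewrite /= a3 // s15 a3 // a1 // sk b3 // s1l natrX.
  apply: tr_ite; rewrite bE => cond; apply: tr_rset; rewrite /= a3 // s12 /init_weight.
    by rewrite cond.
  by rewrite (negbTE cond) a3 // a1 // sG div1r.
- by apply: HQ.
Qed.

End Init.

(** * The program computes the algorithm [alg_set] *)

Section Correct.
Variables (R : realType) (n k T Y B : nat) (r : nat -> 'I_n).
Hypotheses (k0 : 0 < k) (kn : k <= n) (T0 : 0 < T).
Let ell := (trunc_log 2 (n * T)).+1.
Let G := 2 ^ (4 * ell).
Hypotheses (fourellY : 4 * ell <= Y) (dY : n + ell.+1 <= Y).
Hypothesis stepsB : max_steps Y paging_cmd <= B.
Let lam : R := Num.sqrt ell%:R.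
Implicit Types (s : state R) (w : nat -> R).

Let nY : n <= Y. Proof. by apply: leq_trans dY; exact: leq_addr. Qed.
Let ellY : ell.+1 <= Y. Proof. by apply: leq_trans dY; exact: leq_addl. Qed.

Let inv pos w := @round_inv R n k ell pos r lam (fun j => dig (4 * ell) (w j)).
Let alg pos w := alg_set k ell pos r lam (fun j => dig (4 * ell) (w j)).

Let max_steps_seq c1 c2 : max_steps Y (Seq c1 c2) = (max_steps Y c1 + max_steps Y c2).+1.
Proof. by []. Qed.

Let max_steps_ite b c1 c2 : max_steps Y (Ite b c1 c2) = (max_steps Y c1 + max_steps Y c2).+1.
Proof. by []. Qed.

Lemma later_round pos w w' t s : inv pos w t s -> 0 < t ->
  exists s', [/\ play_round paging_cmd B (r t) w' s = ([::], s'), inv pos w t.+1 s'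
     & read_cache n s' = alg pos w t].
Proof.
move=> [cs s8 s9 s10 s2] t0.
have inv0 : inv pos w t (put_request (r t) s).
  by [].
have : tr Y (put_request (r t) s) paging_cmd
    (fun s' => inv pos w t.+1 s' /\ read_cache n s' = alg pos w t).
  have [[_ _ c2 _ _] _] := cs.
  apply: tr_seq; apply: tr_ite; rewrite [beval _ _]/= /upd /= c2 // => _.
  by apply: tr_skip; apply: round_ok.
move=> [m [s' [mB [I' rc] run_s]]]; exists s'; split=> //.
rewrite /play_round -(subnKC (leq_trans mB stepsB)) run_add run_s; exact: run_halt.
Qed.

(** The number [m1] of steps spent on the sizes does not depend on the samples, so one [pos] serves
    all [w]. *)
Lemma first_round : exists pos,
  [/\ forall j, j < n + ell.+1 -> pos j < B,
      forall i j, pos i = pos j -> i = j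
    & forall w, exists s', [/\ play_round paging_cmd B (r 0) w (init_state R n k T) = ([::], s'),
        inv pos w 1 s' & read_cache n s' = alg pos w 0]].
Proof.
set s0 := put_request (r 0) (init_state R n k T).
have : tr Y s0 sizes_cmd (fun s' => [/\ frame [:: 2; 3; 4; 5; 12] [::] s0 s', imem s' 2 0 = 1,
    imem s' 3 0 = ell, imem s' 4 0 = G & imem s' 12 0 = 0]).
  by apply: (tr_sizes k0 kn T0 fourellY dY).
move=> [m1 [s1 [m1B [f1 s1_2 s1_3 s1_4 s1_12] run1]]].
pose M := n + ell.+1.
(* Before the sampling loop come the [m1] steps of [sizes_cmd] and 4 unfoldings, of three sequences
   and one conditional. *)
exists (fun j => m1 + 4 + (4 * j + 2)).
have M1 : (4 * M).+1 <= max_steps Y sample_cmd.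
  by rewrite /= ltnS mulnC leq_mul.
move: stepsB; rewrite /paging_cmd max_steps_seq max_steps_ite 2!max_steps_seq => B1.
split=> [j jM|i j|w].
- apply: leq_trans B1; have : 4 * j + 3 <= 4 * M by rewrite /M; lia.
  have := m1B; have := M1; lia.
- by lia.
have s1_n : imem s1 0 0 = n by case: f1 => ->.
have s1_k : imem s1 0 1 = k by case: f1 => ->.
have s1_r : imem s1 0 3 = r 0 by case: f1 => ->.
have s1_0 a : a \notin [:: 0; 2; 3; 4; 5; 12] -> imem s1 a = fun=> 0.
  rewrite inE negb_or => /andP[a0 aA]; case: f1 => -> // _.
  by apply/funext => i; rewrite /s0 /= /upd (negbTE a0).
have r1_0 b : rmem s1 b = fun=> 0%R by case: f1 => _ ->.
have [s2 [run2 f2 s2_0]] :=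
  run_samples k0 kn T0 fourellY dY (fun j => w (m1 + 4 + j)) [:: Seq digits_cmd scales_cmd; round_cmd] s1_n s1_3 s1_12 (erefl M).
have a2 x : x \notin [:: 12] -> imem s2 x = imem s1 x by case: f2 => h _; exact: h.
pose pos j := m1 + 4 + (4 * j + 2).
have : tr Y s2 (Seq (Seq digits_cmd scales_cmd) round_cmd)
    (fun s' => inv pos w 1 s' /\ read_cache n s' = alg pos w 0).
  apply: tr_seq; apply: tr_seq; apply: (tr_digits k0 kn T0 fourellY dY (u := w \o pos)) => //; rewrite ?a2 //.
  move=> s3 f3 s3_6.
  have a3 x : x \notin [:: 6; 12; 18; 19] -> imem s3 x = imem s2 x by case: f3 => h _; exact: h.
  have s3_k : imem s3 0 1 = k by rewrite a3 // a2.
  have s3_ell : imem s3 3 0 = ell by rewrite a3 // a2.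
  have s3_G : imem s3 4 0 = G by rewrite a3 // a2.
  apply: (tr_scales k0 kn T0 fourellY dY s3_k s3_ell s3_G) => s4 f4 s4_e.
  have a4 x : x \notin [:: 5; 7; 12] -> imem s4 x = imem s3 x by case: f4 => h _; exact: h.
  have z x : x \notin [:: 0; 2; 3; 4; 5; 6; 7; 12; 18; 19] -> imem s4 x = fun=> 0.
    rewrite !inE !negb_or => /and5P[x0 x2 x3 x4 /and5P[x5 x6 x7 x12 /andP[x18 x19]]].
    rewrite a4 ?inE ?negb_or ?x5 ?x7 // a3 ?inE ?negb_or ?x6 ?x12 ?x18 // a2 ?inE //.
    by rewrite s1_0 // !inE !negb_or x0 x2 x3 x4 x5.
  apply: round_ok => //; last by rewrite a4 // a3 // a2.
  split.
  - split; split.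
    + by rewrite a4 // a3 // a2.
    + by rewrite a4.
    + by rewrite a4 // a3 // a2.
    + by rewrite a4.
    + by rewrite a4.
    + by move=> j jM; rewrite a4 // s3_6.
    + by move=> e el; have [] := s4_e e el.
    + by move=> e el; have [] := s4_e e el.
    + by move=> e el; have [] := s4_e e el.
  - by move=> e i _ _; rewrite z.
  - by move=> e _; rewrite z // mod0n.
  - rewrite z // (_ : marked _ _ = finset.set0) ?cards0 //.
  - move=> e _; case: f4 => _ -> //; case: f3 => _ -> //; case: f2 => _ -> //.
    by rewrite r1_0.
(* The triple speaks of one sequence, whose parts are already on the stack here, so the first step
   of its run is dropped; the shifted stream below has a dummy sample 0 for it. *)
move=> [[|m2] [s' [m2B [I' rc] run3]]]; first by have := run3 w [::].
exists s'; split=> //; rewrite /play_round -/s0.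
pose m := (m1 + ((4 * M).+1 + m2).+1).+3.
have mB : m <= B.
  apply: leq_trans B1; rewrite /m; move: m2B M1 m1B; rewrite 2!max_steps_seq; lia.
have run_m : run w m ([:: paging_cmd], s0) = ([::], s').
  rewrite /m 2!run_first [step _ _]/= run_first [step _ _]/= run_add run1.
  rewrite run_first [step _ _]/= run_add.
  have -> : (fun j => w (m1 + j.+1).+3) = (fun j => w (m1 + 4 + j)).
    by apply/funext => j; congr w; lia.
  rewrite run2; have := run3 (fun j => if j is j'.+1 then w (m1 + ((4 * M).+1 + j').+1).+3 else 0%R) [::].
  by rewrite run_first.
by rewrite -(subnKC mB) run_add run_m run_halt.
Qed.

Lemma paging_correct : exists pos,
  [/\ forall j, j < n + ell.+1 -> pos j < B,
      forall i j, pos i = pos j -> i = j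
    & forall w t, (end_of_round paging_cmd k T B r w t).1 = [::] /\
        alg_cache paging_cmd k T B r w t = alg pos w t].
Proof.
have [pos [posB pos_inj first]] := first_round; exists pos; split=> // w.
have {}first : (end_of_round paging_cmd k T B r w 0).1 = [::] /\
    alg_cache paging_cmd k T B r w 0 = alg pos w 0 /\
    inv pos w 1 (end_of_round paging_cmd k T B r w 0).2.
  have [s' [E I' rc]] := first w.
  by rewrite /alg_cache (_ : end_of_round _ _ _ _ _ _ _ = ([::], s')); last exact: E.
have later t : inv pos w t.+1 (end_of_round paging_cmd k T B r w t).2 ->
    (end_of_round paging_cmd k T B r w t.+1).1 = [::] /\
    alg_cache paging_cmd k T B r w t.+1 = alg pos w t.+1 /\
    inv pos w t.+2 (end_of_round paging_cmd k T B r w t.+1).2.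
  move=> It; have [s' [E I' rc]] := later_round (fun j => w (t.+1 * B + j)) It isT.
  by rewrite /alg_cache /end_of_round E.
have all t : (end_of_round paging_cmd k T B r w t).1 = [::] /\
    alg_cache paging_cmd k T B r w t = alg pos w t /\
    inv pos w t.+1 (end_of_round paging_cmd k T B r w t).2.
  by elim: t => // t [_ [_ /later]].
by move=> t; have [? [? _]] := all t.
Qed.

End Correct.

Local Open Scope ring_scope.

(** * Conclusion *)

Section Performance.
Variables (R : realType) (n k T B : nat) (r : nat -> 'I_n).
Hypotheses (k0 : (0 < k)%N) (kn : (k <= n)%N) (T0 : (0 < T)%N).
Let Y := (8 * (n + trunc_log 2 T).+1)%N.
Hypothesis stepsB : (max_steps Y paging_cmd <= B)%N.
Let ell := (trunc_log 2 (n * T)).+1.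

Let n0 : (0 < n)%N. Proof. exact: leq_trans kn. Qed.

Let nT0 : (0 < n * T)%N. Proof. by rewrite muln_gt0 n0. Qed.

Let nT_lt : (n * T < 2 ^ ell)%N. Proof. exact: trunc_log_ltn. Qed.

(** Crude, by [n < 2 ^ n], but enough for [Y] to bound the longest loops, of [4 * ell] and
    [n + ell + 1] iterations, polynomially in [n] and [log T]. *)
Let ell_le : (ell <= n + trunc_log 2 T + 2)%N.
Proof.
rewrite /ell addn2 ltnS -[leqRHS](trunc_expnK _ (isT : 1 < 2)%N); apply: leq_trunc_log.
rewrite -addnS expnD; apply: leq_mul; apply: ltnW; [exact: ltn_expl | exact: trunc_log_ltn].
Qed.

Let fourellY : (4 * ell <= Y)%N. Proof. by rewrite /Y; move: ell_le; lia. Qed.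
Let dY : (n + ell.+1 <= Y)%N. Proof. by rewrite /Y; move: ell_le; lia. Qed.

Let n_le : (n <= 2 ^ ell)%N.
Proof. by rewrite (leq_trans _ (ltnW nT_lt)) // leq_pmulr. Qed.

Let T_le : (T <= 2 ^ ell)%N.
Proof. by rewrite (leq_trans _ (ltnW nT_lt)) // leq_pmull. Qed.

Lemma paging_runs (w : nat -> R) t :
  (end_of_round paging_cmd k T B r w t).1 = [::] /\ #|alg_cache paging_cmd k T B r w t| = k.
Proof.
have [pos [_ _ /(_ w t) [h ->]]] := paging_correct R r k0 kn T0 fourellY dY stepsB.
by split=> //; exact: alg_set_card.
Qed.

Let expected_costE : exists pos,
  [/\ forall j, (j < n + ell.+1)%N -> (pos j < T * B)%N,
      forall i j : nat, (i < n + ell.+1)%N -> (j < n + ell.+1)%N -> pos i = pos j -> i = j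
    & forall a b, expected_cost R paging_cmd k T B r a b =
      (EE (2 ^ (4 * ell)) (T * B)
         (fun w => (cost r (alg_set k ell pos r (Num.sqrt ell%:R : R) w) a b)%:R))%:E].
Proof.
have [pos [posB pos_inj alg]] := paging_correct R r k0 kn T0 fourellY dY stepsB.
exists pos; split=> [j jM|i j _ _|a b]; [|exact: pos_inj|].
  by apply: leq_trans (posB j jM) _; rewrite leq_pmull.
rewrite -expect_uniform_dig // /expected_cost; congr (expect_uniform _ _).
apply/funext => w; congr (cost r _ a b)%:R%:E; apply/funext => t.
by have [_ ->] := alg w t.
Qed.

Lemma expected_cost_fin a b : exists x : R, expected_cost R paging_cmd k T B r a b = x%:E.
Proof. by have [pos [_ _ ->]] := expected_costE; eexists. Qed.

Lemma paging_competitive (Cs : nat -> {set 'I_n}) : (forall t, #|Cs t| = k) ->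
  (expected_cost R paging_cmd k T B r 0 T
   <= (2 * harmonic_sum R k * (cost r Cs 0 T)%:R + (k%:R * harmonic_sum R k + 7))%:E)%E.
Proof.
move=> Ck; have [pos [posN pos_inj ->]] := expected_costE.
by rewrite lee_fin; apply: competitive_bound.
Qed.

Lemma ln2_ge : 2^-1 <= ln 2 :> R.
Proof.
have := @le_ln1Dx R (- 2^-1); rewrite (_ : 1 + - 2^-1 = 2^-1 :> R); last by field.
rewrite lnV ?posrE // => h; have : - 1 < - 2^-1 :> R by lra.
by move=> /h; rewrite lerN2.
Qed.

(** One factor 2 absorbs the successor in [ell], as the binary logarithm is at least 1 here; the
    other is [ln 2 >= 1/2]. *)
Lemma ell_ln : (1 < n * T)%N -> ell%:R <= 4 * ln (n * T)%:R :> R.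
Proof.
move=> nT1; have t1 : (0 < trunc_log 2 (n * T))%N by rewrite trunc_log_gt0.
have : (2 ^ trunc_log 2 (n * T))%:R <= (n * T)%:R :> R by rewrite ler_nat trunc_logP.
rewrite -ler_ln ?posrE ?ltr0n ?expn_gt0 // natrX lnXn // -[leLHS]mulr_natr => h.
have t1' : 1 <= (trunc_log 2 (n * T))%:R :> R by rewrite ler1n.
have h2 : 2^-1 * (trunc_log 2 (n * T))%:R <= ln 2 * (trunc_log 2 (n * T))%:R :> R.
  by rewrite ler_wpM2r // ln2_ge.
rewrite /ell -[_.+1%:R]natr1.
have aux (x y : R) : 1 <= x -> 2^-1 * x <= y -> x + 1 <= 4 * y by lra.
by apply: aux t1' (le_trans h2 h).
Qed.

(** By [ell_ln], [lam] is at most twice the root of [ln (n T)], which doubles 567 to 1134. *)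
Lemma paging_regret a m (C : {set 'I_n}) : (a + m <= T)%N -> #|C| = k ->
  (expected_cost R paging_cmd k T B r a (a + m)
   <= ((\sum_(a <= t < a + m) loss (r t) C)%:R
       + 1134 * k%:R * Num.sqrt (m%:R * ln (n * T)%:R))%:E)%E.
Proof.
move=> amT Ck; have [pos [posN pos_inj ->]] := expected_costE.
rewrite lee_fin; have [nT1|nT1] := ltnP 1 (n * T).
  apply: le_trans (interval_regret R r k0 kn posN pos_inj isT n_le a _ Ck) _.
    by apply: leq_trans T_le; apply: leq_trans amT; exact: leq_addl.
  set S := Num.sqrt (m%:R * _); set lam := Num.sqrt ell%:R.
  have lamS : lam * Num.sqrt m%:R <= 2 * S.
    have -> : 2 = Num.sqrt (2 ^+ 2) :> R by rewrite sqrtr_sqr ger0_norm.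
    rewrite /lam /S -!sqrtrM ?exprn_ge0 // ler_sqrt; last by rewrite !mulr_ge0 // ln_ge0 // ler1n.
    by rewrite mulrC mulrCA ler_wpM2l // expr2 -natrM; exact: ell_ln.
  have aux (c x y : R) : 0 <= c -> x <= 2 * y -> 567 * c * x <= 1134 * c * y by nra.
  by rewrite lerD2l -mulrA; exact: aux.
(* Here the logarithm is 0 and the cost itself must vanish: the only cache holds the only page, and
   a single round has no movement. *)
have nT : n = 1%N /\ T = 1%N by nia.
have k1 : k = 1%N by move: kn k0; rewrite nT.1; lia.
have c0 w : cost r (alg_set k ell pos r (Num.sqrt ell%:R : R) w) a (a + m) = 0%N.
  rewrite /cost [X in (_ + X)%N]big_geq ?addn0; last by rewrite (leq_trans amT) // nT.2.
  rewrite big1 // => t _; rewrite /loss ifT //.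
  suff -> : alg_set k ell pos r (Num.sqrt ell%:R : R) w t = finset.setTfor 'I_n by rewrite finset.in_setT.
  by apply/eqP; rewrite eqEcard finset.subsetT cardsT alg_set_card // card_ord k1 nT.1.
have -> : EE (2 ^ (4 * ell)) (T * B)
   (fun w => (cost r (alg_set k ell pos r (Num.sqrt ell%:R : R) w) a (a + m))%:R) = 0 :> R.
  rewrite (@EE_ext R _ _ _ (fun=> 0)) => [|w]; last by rewrite c0.
  by rewrite EE_cst // expn_gt0.
apply: addr_ge0; first exact: ler0n.
by apply: mulr_ge0; [apply: mulr_ge0; exact: ler0n | exact: sqrtr_ge0].
Qed.

End Performance.

Lemma time_bound_ge n T :
  (max_steps (8 * (n + trunc_log 2 T).+1) paging_cmd
   <= time_bound (cmd_size paging_cmd * 8 ^ loop_depth paging_cmd) (loop_depth paging_cmd) n T)%N.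
Proof.
apply: leq_trans (max_steps_poly _ _) _ => //.
by rewrite /time_bound expnMn mulnA.
Qed.

Theorem corollary2p7 (R : realType) :
  exists (C : R) (p : cmd) (c d : nat), 0 < C /\
  forall n k : nat, (1 <= k)%N -> (k <= n)%N ->
    [/\ forall T : nat, (0 < T)%N ->
          runs_in_time R p n k T (time_bound c d n T),
        competitive p n k (time_bound c d n) (2 * harmonic_sum R k)
      & forall T t0 m : nat, (0 < T)%N -> (t0 + m <= T)%N ->
          (regret R p n k T (time_bound c d n T) t0 m
             <= (C * k%:R * Num.sqrt (m%:R * ln (n * T)%:R))%:E)%E].
Proof.
exists 1134, paging_cmd, (cmd_size paging_cmd * 8 ^ loop_depth paging_cmd)%N, (loop_depth paging_cmd).
split=> [|n k k0 kn]; first by rewrite ltr0n.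
have [C0 C0k] : exists C : {set 'I_n}, #|C| = k.
  by exists (topk n k (tiebreak n id)); exact: card_topk.
have H0 : 0 < harmonic_sum R k.
  rewrite /harmonic_sum big_nat_recl //; apply: ltr_pwDl; first by rewrite invr_gt0 ltr01.
  by apply: sumr_ge0 => i _; rewrite invr_ge0 ler0n.
split.
- by move=> T T0 r w _ t _; apply: paging_runs => //; exact: time_bound_ge.
- exists (k%:R * harmonic_sum R k + 7) => [|T r T0].
    by rewrite ltr_pwDr // mulr_ge0 // ltW.
  set B := time_bound _ _ _ _; have stepsB := time_bound_ge n T : (_ <= B)%N.
  have [x xE] : exists x : R, expected_cost R paging_cmd k T B r 0 T = x%:E.
    exact: expected_cost_fin.
  rewrite xE lee_fin -lerBlDr -ler_pdivrMl ?mulr_gt0 //.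
  (* The expected cost is a real number, so the bound has been solved for the optimum, an infimum,
     and is checked against each schedule; a constant schedule shows that the set is nonempty. *)
  apply: lb_le_inf; first by exists (cost r (fun=> C0) 0 T)%:R, (fun=> C0).
  move=> _ [Cs Ck <-]; rewrite ler_pdivrMl ?mulr_gt0 // lerBlDr -lee_fin -xE.
  exact: paging_competitive.
- move=> T a m T0 amT; apply: ereal_inf_lbound; eexists; last by [].
  move=> r /=.
  set B := time_bound _ _ _ _; have stepsB := time_bound_ge n T : (_ <= B)%N.
  have [x xE] : exists x : R, expected_cost R paging_cmd k T B r a (a + m) = x%:E.
    exact: expected_cost_fin.
  rewrite xE lee_fin -lerBlDr.
  apply: lb_le_inf; first by exists (\sum_(a <= t < a + m) loss (r t) C0)%:R, C0.
  move=> _ [C Ck <-]; rewrite lerBlDr -lee_fin -xE.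
  exact: paging_regret.
Qed.
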